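(* Let $p>2$ be a prime, $\Bbbk$ an algebraically closed field of characteristic $p$, $J=\{1,\dots,p-1\}$, and suppose $m\ge d$, where $m\geq 1$, $d\geq 0$. Let $\boldsymbol\lambda=(\lambda^{(1)},\dots,\lambda^{(p-1)})$ and $\boldsymbol\mu=(\mu^{(1)},\dots,\mu^{(p-1)})$ be elements of $\Lambda^J_+(m,d)$ with $\lambda^{(j)}\in\Lambda_+(m,d_j)$ and $\mu^{(j)}\in\Lambda_+(m,c_j)$ for all $j\in J$, and let $s\in\mathbb{Z}$. Then $\operatorname{ext}^1_{T^{\mathsf Z}(m,d)}(L(\boldsymbol\lambda),q^sL(\boldsymbol\mu))\ne0$ only if one of the following two conditions holds: (i) $s=0$, $c_j=d_j$ for all $j\in J$, and there exists $j\in J$ such that (a) $\operatorname{Ext}^1_{S(m,d_j)}(L(\lambda^{(j)}),L(\mu^{(j)}))\ne0$ and (b) $\lambda^{(i)}=\mu^{(i)}$ for all $i\ne j$. In this case we have $$\operatorname{ext}^1_{T^{\mathsf Z}(m,d)}(L(\boldsymbol\lambda),L(\boldsymbol\mu))\cong\operatorname{Ext}^1_{S(m,d_j)}(L(\lambda^{(j)}),L(\mu^{(j)})).$$ (ii) $s=1$ and there exist $i,j\in J$ such that (a) $|i-j|=1$, (b) $c_i=d_i+1$, (c) $c_j=d_j-1$, (d) $c_k=d_k$ for all $k\ne i,j$.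
   Context: Zigzag algebra: $\mathsf Z$ is the path algebra over $\mathbb{Z}$ of the quiver with vertices $J=\{1,\dots,p-1\}$ and arrows $\mathsf a_{k,j}$ from $j$ to $k$ whenever $|k-j|=1$, modulo: paths of length $\ge3$ are zero; length two paths that are not cycles are zero; all length two cycles at the same vertex are equal. $\mathsf e_j$ are the vertex idempotents ($\mathsf e_k\mathsf a_{k,j}\mathsf e_j=\mathsf a_{k,j}$), $\mathsf c_j:=\mathsf a_{j,j\pm1}\mathsf a_{j\pm1,j}$. It is graded by path length, and a superalgebra with $\mathsf a_{k,j}$ odd and $\mathsf e_j,\mathsf c_j$ even. $\mathsf B=\{\mathsf e_j,\mathsf c_j,\mathsf a_{k,j}\}$ is a $\mathbb{Z}$-basis. Zigzag Schur algebra: let $[m]=\{1,\dots,m\}$, and let $\xi^{\mathsf z}_{r,s}\in M_m(\mathsf Z)$ be the matrix with $\mathsf z$ in position $(r,s)$ and zeros elsewhere. $M_m(\mathsf Z)^{\otimes d}$ is the tensor product of superalgebras (usual sign rule), with $\mathfrak{S}_d$ acting on the right by place permutation with sign: $(\xi^{\mathsf z_1}_{r_1,s_1}\otimes\cdots\otimes\xi^{\mathsf z_d}_{r_d,s_d})^\sigma=(-1)^{N}\xi^{\mathsf z_{\sigma1}}_{r_{\sigma1},s_{\sigma1}}\otimes\cdots\otimes\xi^{\mathsf z_{\sigma d}}_{r_{\sigma d},s_{\sigma d}}$, $N=\#\{k<l:\sigma^{-1}k>\sigma^{-1}l,\ \mathsf z_k,\mathsf z_l\text{ odd}\}$. Put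 $S^{\mathsf Z}(m,d)_{\mathbb Z}:=(M_m(\mathsf Z)^{\otimes d})^{\mathfrak{S}_d}$. For a triple $(\mathbf b,\mathbf r,\mathbf s)\in\mathsf B^d\times[m]^d\times[m]^d$ in which $(b_k,r_k,s_k)=(b_l,r_l,s_l)$ with $k\ne l$ happens only for $b_k$ even, let $\xi^{\mathbf b}_{\mathbf r,\mathbf s}:=\sum(-1)^{\langle\mathbf b,\mathbf r,\mathbf s\rangle+\langle\mathbf b',\mathbf r',\mathbf s'\rangle}\xi^{b'_1}_{r'_1,s'_1}\otimes\cdots\otimes\xi^{b'_d}_{r'_d,s'_d}$, the sum over the distinct triples $(\mathbf b',\mathbf r',\mathbf s')$ in the $\mathfrak{S}_d$-orbit of $(\mathbf b,\mathbf r,\mathbf s)$ under simultaneous place permutation, where, for a fixed total order on $\mathsf B\times[m]\times[m]$, $\langle\mathbf b,\mathbf r,\mathbf s\rangle=\#\{k<l: b_k,b_l\text{ odd},(b_k,r_k,s_k)>(b_l,r_l,s_l)\}$. Let $\eta^{\mathbf b}_{\mathbf r,\mathbf s}:=\big(\prod_{j\in J,\,r,s\in[m]}\#\{k:(b_k,r_k,s_k)=(\mathsf c_j,r,s)\}!\big)\,\xi^{\mathbf b}_{\mathbf r,\mathbf s}$. The $\mathbb{Z}$-span $T^{\mathsf Z}(m,d)_{\mathbb Z}$ of all $\eta^{\mathbf b}_{\mathbf r,\mathbf s}$ is a unital graded subring of $S^{\mathsf Z}(m,d)_{\mathbb Z}$, and $T^{\mathsf Z}(m,d):=\Bbbk\otimes_{\mathbb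 Z}T^{\mathsf Z}(m,d)_{\mathbb Z}$, a non-negatively graded $\Bbbk$-algebra. Irreducible modules: $S(m,d)$ is the classical Schur algebra over $\Bbbk$, with Schur's basis elements $\xi_{\mathbf r,\mathbf s}$. The degree $0$ part satisfies $T^{\mathsf Z}(m,d)/T^{\mathsf Z}(m,d)^{>0}\cong T^{\mathsf Z}(m,d)^0\cong\bigoplus_{d_1+\dots+d_{p-1}=d}S(m,d_1)\otimes\cdots\otimes S(m,d_{p-1})$, where $\xi^{\mathsf e_1^{d_1}\cdots\mathsf e_{p-1}^{d_{p-1}}}_{\mathbf r^1\cdots\mathbf r^{p-1},\,\mathbf s^1\cdots\mathbf s^{p-1}}\mapsto\xi_{\mathbf r^1,\mathbf s^1}\otimes\cdots\otimes\xi_{\mathbf r^{p-1},\mathbf s^{p-1}}$ for $\mathbf r^j,\mathbf s^j\in[m]^{d_j}$ (concatenated words; $\mathsf e_j^{d_j}$ is $\mathsf e_j$ repeated $d_j$ times). $\Lambda_+(m,d)$ is the set of partitions of $d$ with at most $m$ parts, $L(\lambda)$ the irreducible $S(m,d)$-module of highest weight $\lambda\in\Lambda_+(m,d)$, and $\Lambda^J_+(m,d):=\bigsqcup_{d_1+\dots+d_{p-1}=d}\Lambda_+(m,d_1)\times\cdots\times\Lambda_+(m,d_{p-1})$. For $\boldsymbol\lambda\in\Lambda^J_+(m,d)$ with $\lambda^{(j)}\in\Lambda_+(m,d_j)$ for all $j\in J$, $L(\boldsymbol\lambda)$ is the irreducible graded $T^{\mathsf Z}(m,d)$-module, concentrated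 in degree $0$, obtained by inflating the $S(m,d_1)\otimes\cdots\otimes S(m,d_{p-1})$-module $L(\lambda^{(1)})\boxtimes\cdots\boxtimes L(\lambda^{(p-1)})$ along the composite surjection $T^{\mathsf Z}(m,d)\to T^{\mathsf Z}(m,d)/T^{\mathsf Z}(m,d)^{>0}\cong\bigoplus_{d'_1+\dots+d'_{p-1}=d}S(m,d'_1)\otimes\cdots\otimes S(m,d'_{p-1})\to S(m,d_1)\otimes\cdots\otimes S(m,d_{p-1})$, where the first map is the quotient map, the isomorphism sends the class of $\xi^{\mathsf e_1^{d'_1}\cdots\mathsf e_{p-1}^{d'_{p-1}}}_{\mathbf r^1\cdots\mathbf r^{p-1},\,\mathbf s^1\cdots\mathbf s^{p-1}}$ to $\xi_{\mathbf r^1,\mathbf s^1}\otimes\cdots\otimes\xi_{\mathbf r^{p-1},\mathbf s^{p-1}}$, and the last map is the projection onto the summand with $d'_j=d_j$ for all $j\in J$. For a graded module $V$, $q^sV$ is $V$ with grading shifted: $(q^sV)^r=V^{r-s}$. $\operatorname{ext}^t_A$ denotes extension spaces in the category of $\mathbb{Z}$-graded $A$-modules (morphisms of degree $0$), and $\operatorname{Ext}^t$ ungraded extensions. *)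

(* Defs.v *)
From HB Require Import structures.
From mathcomp Require Import all_boot all_order all_fingroup all_algebra.

Set Implicit Arguments.
Unset Strict Implicit.
Unset Printing Implicit Defensive.

Import Order.TTheory GRing.Theory Num.Theory.
Local Open Scope ring_scope.

(* The vertex set J = {1, ..., n} is 'I_n, so the vertex j is written j - 1. *)
Definition adj n (k j : 'I_n) : bool := (k.+1 == j :> nat) || (j.+1 == k :> nat).

(* The basis B: vertex idempotents e_j, two-cycles c_j, arrows a_{k,j} from j
   to k. *)
Inductive zz n : Type :=
| Ze of 'I_n
| Zc of 'I_n
| Za (k j : 'I_n) of adj k j.

Section ZigzagFin.
Variable n : nat.

Definition zz_code (b : zz n) : 'I_n + 'I_n + {x : 'I_n * 'I_n | adj x.1 x.2} :=
  match b with
  | Ze j => inl (inl j)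
  | Zc j => inl (inr j)
  | Za k j kj => inr (Sub (k, j) kj)
  end.

Definition zz_decode (x : 'I_n + 'I_n + {x : 'I_n * 'I_n | adj x.1 x.2}) : zz n :=
  match x with
  | inl (inl j) => Ze j
  | inl (inr j) => Zc j
  | inr (exist x kj) => Za kj
  end.

Lemma zz_codeK : cancel zz_code zz_decode.
Proof. by case. Qed.

HB.instance Definition _ := Finite.copy (zz n) (can_type zz_codeK).

End ZigzagFin.

Section Zigzag.
Variable n : nat.
Implicit Types b : zz n.

Definition ztgt b : 'I_n := match b with Ze j => j | Zc j => j | Za k _ _ => k end.
Definition zsrc b : 'I_n := match b with Ze j => j | Zc j => j | Za _ j _ => j end.
Definition zodd b : bool := if b is Za _ _ _ then true else false.
Definition zdeg b : nat := match b with Ze _ => 0 | Zc _ => 2 | Za _ _ _ => 1 end.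
Definition zis_e b : bool := if b is Ze _ then true else false.
Definition zis_c b : bool := if b is Zc _ then true else false.

(* Multiplication of the zigzag algebra on its basis: composition of paths
   (right to left) modulo the relations; [None] is the zero product. *)
Definition zz_mul b b' : option (zz n) :=
  if zsrc b != ztgt b' then None else
  match b, b' with
  | Ze _, _ => Some b'
  | _, Ze _ => Some b
  | Za k _ _, Za _ l _ => if k == l then Some (Zc k) else None
  | _, _ => None
  end.

End Zigzag.

(* A letter (z, r, s) is the element xi^z_{r,s} of M_m(Z), and a word of length
   d is the pure tensor of its letters. *)
Definition letter n m := (zz n * 'I_m * 'I_m)%type.
Definition word n m d := {ffun 'I_d -> letter n m}.

Section Letters.
Variables n m : nat.
Implicit Types x y : letter n m.

Definition lodd x : bool := zodd x.1.1.
Definition lis_c x : bool := zis_c x.1.1.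

Definition letter_mul x y : option (letter n m) :=
  if x.2 == y.1.2 then
    if zz_mul x.1.1 y.1.1 is Some b then Some (b, x.1.2, y.2) else None
  else None.

Definition letter_one x : bool := zis_e x.1.1 && (x.1.2 == x.2).

End Letters.

Definition npairs d (P : rel 'I_d) : nat :=
  #|[set kl : 'I_d * 'I_d | (kl.1 < kl.2)%N && P kl.1 kl.2]|.

Definition sgn_pairs d (P : rel 'I_d) : int := (-1) ^+ npairs P.

Definition tens n m d : Type := {ffun word n m d -> int}.
HB.instance Definition _ n m d := GRing.Zmodule.copy (tens n m d) {ffun word n m d -> int}.

Section Tens.
Variables n m d : nat.
Local Notation W := (word n m d).
Local Notation T := (tens n m d).
Implicit Types (u v w : W) (x y z : T) (s t : 'S_d).

Definition wmul u v w : bool := [forall k, letter_mul (u k) (v k) == Some (w k)].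

(* Usual sign rule: moving v_k past u_l for k < l. *)
Definition tens_sgn u v : int := sgn_pairs (fun k l => lodd (u l) && lodd (v k)).

Definition tens_mul x y : T :=
  [ffun w => \sum_u \sum_(v | wmul u v w) tens_sgn u v * x u * y v].

Definition tens_one : T := [ffun w : W => ([forall k, letter_one (w k)])%:R].

Definition wact w s : W := [ffun k => w (s k)].

(* The sign of the place permutation action of s on the word w. *)
Definition place_sgn s w : int :=
  sgn_pairs (fun k l => [&& (s^-1%g l < s^-1%g k)%N, lodd (w k) & lodd (w l)]).

(* x is fixed by the signed place permutations, i.e. x is in S^Z(m,d)_Z. *)
Definition tens_inv x : bool :=
  [forall s, forall w, x (wact w s) == place_sgn s w * x w].

Definition admissible w : bool :=
  [forall k, forall l, (k != l) && (w k == w l) ==> ~~ lodd (w k)].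

(* The fixed total order on letters is the enumeration order of the finite type
   of letters. *)
Definition winv w : nat :=
  npairs (fun k l => [&& lodd (w k), lodd (w l)
                       & (enum_rank (w l) < enum_rank (w k))%N]).

Definition same_orbit w w' : bool := [exists s, w' == wact w s].

Definition xi w : T :=
  [ffun w' => if same_orbit w w' then (-1) ^+ (winv w + winv w') else 0].

Definition cfact w : nat :=
  (\prod_(j < n) \prod_(r < m) \prod_(s < m) #|[set k | w k == (Zc j, r, s)]|`!)%N.

Definition eta w : T := xi w *+ cfact w.

Definition TZ x : Prop :=
  exists c : W -> int, x = \sum_(w | admissible w) eta w *~ c w.

End Tens.

Section Pairs.
Variable d : nat.
Implicit Types (P Q : rel 'I_d) (s : 'S_d).

Definition xpairs P := \big[addb/false]_(kl : 'I_d * 'I_d | (kl.1 < kl.2)%N) P kl.1 kl.2.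

Lemma odd_npairs P : odd (npairs P) = xpairs P.
Proof.
rewrite /npairs -sum1_card (big_morph odd oddD (erefl _)) /xpairs.
rewrite big_mkcond [RHS]big_mkcond; apply: eq_bigr => kl _.
by rewrite inE; case: (_ < _)%N; case: (P _ _).
Qed.

Lemma sgn_pairsE P : sgn_pairs P = (-1) ^+ xpairs P.
Proof. by rewrite /sgn_pairs -signr_odd odd_npairs. Qed.

Lemma eq_xpairs P Q : (forall k l : 'I_d, (k < l)%N -> P k l = Q k l) -> xpairs P = xpairs Q.
Proof. by move=> eqPQ; apply: eq_bigr => kl; apply: eqPQ. Qed.

Lemma xpairsD P Q : xpairs (fun k l => P k l (+) Q k l) = xpairs P (+) xpairs Q.
Proof. by rewrite /xpairs big_split. Qed.

Lemma xpairs0 : xpairs (fun _ _ => false) = false.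
Proof. by rewrite /xpairs big1. Qed.

Lemma xpairs_perm P s : xpairs (fun k l => P (s k) (s l)) =
  xpairs (fun k l => if (s^-1%g k < s^-1%g l)%N then P k l else P l k).
Proof.
pose g (kl : 'I_d * 'I_d) := (s^-1%g kl.1, s^-1%g kl.2).
have gbij : bijective g.
  exists (fun kl => (s kl.1, s kl.2)) => -[k l] /=; first by rewrite /g /= !permKV.
  by rewrite /g /= !permK.
rewrite /xpairs (reindex g) /=; last exact: onW_bij.
rewrite (eq_bigr (fun kl => P kl.1 kl.2)); last by move=> [k l] _; rewrite /= !permKV.
rewrite (bigID (fun kl : 'I_d * 'I_d => (kl.1 < kl.2)%N)) /=.
rewrite [X in _ (+) X](reindex (fun kl : 'I_d * 'I_d => (kl.2, kl.1))) /=; last first.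
  by apply: onW_bij; exists (fun kl : 'I_d * 'I_d => (kl.2, kl.1)) => -[].
rewrite [RHS](bigID (fun kl : 'I_d * 'I_d => (s^-1%g kl.1 < s^-1%g kl.2)%N)) /=.
congr (_ (+) _).
  rewrite (eq_bigl (fun kl : 'I_d * 'I_d => (kl.1 < kl.2)%N && (s^-1%g kl.1 < s^-1%g kl.2)%N)); last first.
    by move=> kl; rewrite andbC.
  by apply: eq_bigr => kl /andP[_ ->].
rewrite [RHS](eq_bigr (fun kl => P kl.2 kl.1)); last first.
  by move=> kl /andP[_ /negbTE ->].
apply: eq_bigl => -[k l] /=; rewrite -!leqNgt.
have [->|kl] := eqVneq k l; first by rewrite !ltnn.
rewrite andbC [(k <= l)%N]leq_eqVlt (inj_eq val_inj) (negbTE kl) /=.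
by rewrite [(s^-1%g l <= _)%N]leq_eqVlt !(inj_eq val_inj) (inj_eq perm_inj) eq_sym (negbTE kl).
Qed.

End Pairs.

Section Group.
Variables (d : nat).
Implicit Type s : 'S_d.

(* Permutations preserving the fibres of f and moving only the positions whose
   value satisfies P. *)
Definition fibperm (X : finType) (f : 'I_d -> X) (P : pred X) : {set 'S_d} :=
  [set s : 'S_d | [forall k, (f (s k) == f k) && (P (f k) || (s k == k))]].

Lemma fibpermP (X : finType) (f : 'I_d -> X) (P : pred X) s :
  reflect (forall k, f (s k) = f k /\ (~~ P (f k) -> s k = k)) (s \in fibperm f P).
Proof.
rewrite inE; apply: (iffP forallP) => h k.
  have /andP[/eqP ? /orP[Pk|/eqP ->]] := h k; split=> //.
  by rewrite Pk.
have [-> i] := h k; rewrite eqxx /=.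
by case: (boolP (P (f k))) => //= nP; rewrite i.
Qed.

Lemma fibperm_group_set (X : finType) (f : 'I_d -> X) P : group_set (fibperm f P).
Proof.
apply/group_setP; split; first by apply/fibpermP => k; rewrite perm1.
move=> s t /fibpermP hs /fibpermP ht; apply/fibpermP => k; rewrite permM.
have [e1 i1] := hs k; have [e2 i2] := ht (s k).
by split=> [|nP]; rewrite ?e2 // i2 ?i1 // e1.
Qed.
Canonical fibperm_group (X : finType) (f : 'I_d -> X) P :=
  Group (@fibperm_group_set X f P).

Lemma eq_fibperm (X : finType) (f : 'I_d -> X) (P Q : pred X) :
  P =1 Q -> fibperm f P = fibperm f Q.
Proof. by move=> PQ; apply/setP => s; rewrite !inE; apply: eq_forallb => k; rewrite PQ. Qed.

Lemma card_fibperm_split (X : finType) (f : 'I_d -> X) (P Q : pred X) :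
  (forall x, P x -> ~~ Q x) ->
  #|fibperm f (predU P Q)| = (#|fibperm f P| * #|fibperm f Q|)%N.
Proof.
move=> PQ; rewrite -TI_cardMg; last first.
  apply/trivgP/subsetP => s; rewrite !inE -!/(is_true (s \in fibperm _ _)).
  move=> /andP[/forallP h1 /forallP h2]; apply/eqP/permP => k; rewrite perm1.
  have := h1 k; have := h2 k.
  case: (boolP (P (f k))) => [Pk|_]; last by move=> _ /andP[_ /eqP].
  by rewrite (negbTE (PQ _ Pk)) => /andP[_ /eqP].
congr #|pred_of_set _|; apply/setP => s; apply/idP/mulsgP.
  move=> /fibpermP hs.
  pose A := [set k | P (f k)].
  have sA : s \in ('N(A | 'P))%g.
    apply/astabsP => k; rewrite /= /aperm !inE; have [-> _] := hs k.
    by [].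
  pose t := restr_perm A s.
  have tE k : t k = if P (f k) then s k else k.
    rewrite /t; case: ifPn => Pk; first by rewrite restr_permE // inE.
    by apply: (out_perm (restr_perm_on A s)); rewrite inE.
  have tP : t \in fibperm f P.
    apply/fibpermP => k; rewrite tE; case: ifPn => // Pk.
    by have [-> _] := hs k.
  exists t (t^-1 * s)%g => //; last by rewrite mulKVg.
  apply/fibpermP => k; rewrite permM.
  set l := t^-1%g k; have kE : k = t l by rewrite /l permKV.
  rewrite kE tE; have [e i] := hs l; case: ifPn => Pl.
    by rewrite e.
  by rewrite e; split=> // nQ; apply: i; rewrite negb_or Pl.
case=> t u /fibpermP ht /fibpermP hu ->; apply/fibpermP => k; rewrite permM.
have [e1 i1] := ht k; have [e2 i2] := hu (t k); split; first by rewrite e2.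
by rewrite negb_or => /andP[nP nQ]; rewrite i2 ?i1 // e1.
Qed.

Lemma card_fibperm1 (X : finType) (f : 'I_d -> X) x :
  #|fibperm f (pred1 x)| = (#|[set k | f k == x]|`!)%N.
Proof.
rewrite -card_perm; apply: eq_card => s; apply/fibpermP/idP.
  move=> hs; apply/subsetP => k; rewrite !inE; apply: contraNT => nx.
  by have [_ i] := hs k; rewrite i.
move=> /= sA; have h k : f k != x -> s k = k.
  by move=> nx; apply: (out_perm sA); rewrite inE.
move=> k; split; last exact: h.
have [fk|/h->//] := eqVneq (f k) x.
by have := perm_closed k sA; rewrite !inE fk eqxx => /eqP.
Qed.

Lemma card_fibperm (X : finType) (f : 'I_d -> X) (P : pred X) :
  #|fibperm f P| = (\prod_(x | P x) #|[set k | f k == x]|`!)%N.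
Proof.
rewrite -big_filter; have: uniq [seq x <- index_enum X | P x].
  by rewrite filter_uniq ?index_enum_uniq.
have : P =1 mem [seq x <- index_enum X | P x].
  by move=> x; rewrite inE mem_filter mem_index_enum andbT.
move: (filter _ _) => r; elim: r P => [|x r IHr] P PE.
  move=> _; rewrite big_nil; apply/eqP; rewrite -trivg_card1; apply/eqP/trivgP.
  apply/subsetP => s /fibpermP hs; rewrite inE; apply/eqP/permP => k.
  by have [_ i] := hs k; rewrite perm1 i // PE.
rewrite /= => /andP[xr ur]; rewrite big_cons -(IHr (mem r)) // -card_fibperm1.
rewrite -card_fibperm_split; last by move=> y /= /eqP ->.
by congr #|pred_of_set _|; apply: eq_fibperm => y; rewrite PE !inE.
Qed.

Lemma fibpermS (X Y : finType) (f : 'I_d -> X) (P : pred X) (g : 'I_d -> Y) (Q : pred Y) :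
  (forall k l, f k = f l -> g k = g l) -> (forall k, P (f k) -> Q (g k)) ->
  fibperm f P \subset fibperm g Q.
Proof.
move=> fg PQ; apply/subsetP => s /fibpermP hs; apply/fibpermP => k.
have [e i] := hs k; split; first exact: fg.
by move=> nQ; apply: i; apply: contra nQ; apply: PQ.
Qed.

Local Open Scope group_scope.
Lemma dvd_sum_orbits (aT : finGroupType) (G : {group aT}) (X : finType)
    (to : {action aT &-> X}) (F : X -> int) :
  {in G, forall g x, F (to x g) = F x} ->
  (forall x, (#|'C_G[x | to]|%:Z %| F x)%Z) ->
  (#|G|%:Z %| \sum_x F x)%Z.
Proof.
move=> Finv Fdvd.
have GX : [acts G, on setT | to].
  by apply/subsetP => g _; rewrite !inE; apply/subsetP => x _; rewrite !inE.
rewrite (eq_bigl (fun x => x \in [set: X])); last by move=> x; rewrite inE.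
rewrite (set_partition_big _ (orbit_partition GX)).
apply: rpred_sum => _ /imsetP[x _ ->].
have FE y : y \in orbit to G x -> F y = F x by case/imsetP => g gG ->; apply: Finv.
rewrite (eq_bigr _ FE) sumr_const -(card_orbit_in_stab to (G := G) x).
rewrite -mulr_natl PoszM; apply: dvdz_mul => //.
  by rewrite natz.
exact: subsetT.
Qed.

End Group.

Section LetterTheory.
Variables n m : nat.
Implicit Types x y z : letter n m.

Lemma lodd_mul x y z : letter_mul x y = Some z -> lodd z = lodd x (+) lodd y.
Proof.
case: x y z => -[bx rx] sx [[by_ ry] sy] [[bz rz] sz].
rewrite /letter_mul /lodd /zz_mul /=; case: ifP => // _.
by case: bx => [jx|jx|kx jx ax]; case: by_ => [jy|jy|ky jy ay] //=;
  case: eqP => //= _; try (case: eqP => //= _); case=> <- _ _.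
Qed.

Lemma zz_mulA (b1 b2 b3 : zz n) :
  obind (fun a => zz_mul a b3) (zz_mul b1 b2) = obind (zz_mul b1) (zz_mul b2 b3).
Proof.
rewrite /zz_mul.
case: b1 => [j1|j1|k1 j1 a1]; case: b2 => [j2|j2|k2 j2 a2]; case: b3 => [j3|j3|k3 j3 a3] /=;
  repeat (case: eqVneq => //= ?; subst => //=); rewrite ?eqxx //=;
  repeat (case: eqVneq => //= ?; subst => //=);
  by match goal with h : is_true (?a != ?a) |- _ => rewrite eqxx in h end.
Qed.

Lemma letter_mulA x y z :
  obind (fun a => letter_mul a z) (letter_mul x y) =
  obind (fun b => letter_mul x b) (letter_mul y z).
Proof.
case: x y z => -[b1 r1] s1 [[b2 r2] s2] [[b3 r3] s3].
rewrite /letter_mul /=; have := zz_mulA b1 b2 b3.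
case: (s1 =P r2) => [e1|ne1]; case: (s2 =P r3) => [e2|ne2] //=.
- case: (zz_mul b1 b2) => [p|]; case: (zz_mul b2 b3) => [q|] //=.
  + by rewrite e1 e2 !eqxx => ->.
  + by rewrite e2 eqxx => ->.
  + by rewrite e1 eqxx => <-.
- by case: (zz_mul b1 b2) => [p|] //=; case: (s2 =P r3).
- by case: (zz_mul b2 b3) => [q|] //=; case: (s1 =P r2).
Qed.

Lemma letter_mul1l x z : letter_one x ->
  (letter_mul x z == Some z) = (x == (Ze (ztgt z.1.1), z.1.2, z.1.2)).
Proof.
case: x z => -[bx rx] sx [[bz rz] sz]; rewrite /letter_one /letter_mul /zz_mul /=.
case: bx => //= j /eqP ->.
have [->|ne] := eqVneq sx rz; last by apply/esym/eqP => -[] _ e; rewrite e eqxx in ne.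
have [->|ne] := eqVneq j (ztgt bz); first by rewrite !eqxx.
by apply/esym/eqP => -[] e; rewrite e eqxx in ne.
Qed.

Lemma letter_mul1l_eq x y z : letter_one x -> letter_mul x y = Some z -> y = z.
Proof.
case: x y z => -[bx rx] sx [[by_ ry] sy] [[bz rz] sz].
rewrite /letter_one /letter_mul /zz_mul /=; case: bx => //= j /eqP ->.
by case: eqP => // ->; case: eqP => //= _; case=> -> -> ->.
Qed.

Lemma letter_mul1r x z : letter_one x ->
  (letter_mul z x == Some z) = (x == (Ze (zsrc z.1.1), z.2, z.2)).
Proof.
case: x z => -[bx rx] sx [[bz rz] sz]; rewrite /letter_one /letter_mul /zz_mul /=.
case: bx => //= j /eqP ->.
have [->|ne] := eqVneq sz sx; last by apply/esym/eqP => -[] _ e; rewrite e eqxx in ne.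
have [<-|ne] := eqVneq (zsrc bz) j; first by case: bz => [?|?|???] /=; rewrite !eqxx.
by apply/esym/eqP => -[] e; rewrite e eqxx in ne.
Qed.

Lemma letter_mul1r_eq x y z : letter_one x -> letter_mul y x = Some z -> y = z.
Proof.
case: x y z => -[bx rx] sx [[by_ ry] sy] [[bz rz] sz].
rewrite /letter_one /letter_mul /zz_mul /=; case: bx => //= j /eqP ->.
case: eqP => // ->; case: by_ => [?|?|???] /=; case: eqP => //= e; try by case=> -> -> ->.
by rewrite e; case=> -> -> ->.
Qed.

Lemma letter_one_even x : letter_one x -> lodd x = false.
Proof. by rewrite /letter_one /lodd; case: x => -[[]]. Qed.

Lemma lis_c_even x : lis_c x -> lodd x = false.
Proof. by rewrite /lis_c /lodd; case: x => -[[]]. Qed.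

(* A product equal to some c_j has exactly one factor c_j or two odd factors. *)
Lemma lis_c_mul x y z : letter_mul x y = Some z ->
  lis_c z = [|| lis_c x, lis_c y | lodd x && lodd y] /\ ~~ (lis_c x && lis_c y).
Proof.
case: x y z => -[bx rx] sx [[by_ ry] sy] [[bz rz] sz].
rewrite /letter_mul /lodd /lis_c /zz_mul /=; case: ifP => // _.
by case: bx => [jx|jx|kx jx ax]; case: by_ => [jy|jy|ky jy ay] //=;
  case: eqP => //= _; try (case: eqP => //= _); case=> <- _ _.
Qed.

End LetterTheory.

Section TensTheory.
Variables n m d : nat.
Local Notation W := (word n m d).
Local Notation T := (tens n m d).
Implicit Types (u v w : W) (x y z : T) (s t : 'S_d).

Lemma wact1 w : wact w 1%g = w.
Proof. by apply/ffunP => k; rewrite ffunE perm1. Qed.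

Lemma wactM w s t : wact w (s * t)%g = wact (wact w t) s.
Proof. by apply/ffunP => k; rewrite !ffunE permM. Qed.

Lemma wactK s : cancel (fun w => wact w s) (fun w => wact w s^-1%g).
Proof. by move=> w; rewrite -wactM mulVg wact1. Qed.

Lemma wactKV s : cancel (fun w => wact w s^-1%g) (fun w => wact w s).
Proof. by move=> w; rewrite -wactM mulgV wact1. Qed.

Lemma wact_bij s : bijective (fun w => wact w s).
Proof. by exists (fun w => wact w s^-1%g); [apply: wactK | apply: wactKV]. Qed.

Lemma wmulP u v w : reflect (forall k, letter_mul (u k) (v k) = Some (w k)) (wmul u v w).
Proof. by apply: (iffP forallP) => h k; [apply/eqP|apply/eqP]. Qed.

Lemma wmul_act u v w s : wmul (wact u s) (wact v s) (wact w s) = wmul u v w.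
Proof.
apply/wmulP/wmulP => h k; last by rewrite !ffunE.
by have := h (s^-1%g k); rewrite !ffunE permKV.
Qed.

Lemma wmul_fun u v w w' : wmul u v w -> wmul u v w' -> w = w'.
Proof.
move=> /wmulP h /wmulP h'; apply/ffunP => k.
by have := h k; rewrite h' => -[].
Qed.

Lemma tens_sgn_act u v w s : wmul u v w ->
  tens_sgn (wact u s) (wact v s) * place_sgn s u * place_sgn s v
  = place_sgn s w * tens_sgn u v.
Proof.
move=> /wmulP uvw; rewrite /tens_sgn /place_sgn !sgn_pairsE -!signr_addb.
congr (_ ^+ nat_of_bool _).
under eq_xpairs do rewrite !ffunE.
rewrite (xpairs_perm (fun k l => lodd (u l) && lodd (v k))) -!xpairsD.
apply: eq_xpairs => k l kl.
rewrite (lodd_mul (uvw k)) (lodd_mul (uvw l)) ltnNge leq_eqVlt.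
rewrite (inj_eq val_inj) (inj_eq perm_inj) eq_sym -val_eqE (ltn_eqF kl) /=.
case: ltnP => _ /=; case: (lodd (u k)); case: (lodd (v k)); case: (lodd (u l));
  by case: (lodd (v l)).
Qed.

Lemma place_sgn_sqr s w : place_sgn s w * place_sgn s w = 1.
Proof. by rewrite /place_sgn !sgn_pairsE -signr_addb addbb. Qed.

Lemma tens_sgn_sqr u v : tens_sgn u v * tens_sgn u v = 1.
Proof. by rewrite /tens_sgn !sgn_pairsE -signr_addb addbb. Qed.

Lemma tens_invP x :
  reflect (forall s w, x (wact w s) = place_sgn s w * x w) (tens_inv x).
Proof.
apply: (iffP forallP) => [h s w|h s]; last by apply/forallP => w; rewrite h.
by have /forallP/(_ w)/eqP := h s.
Qed.

Let K u v w : int := (wmul u v w)%:R * tens_sgn u v.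

Lemma tens_mulE x y w : tens_mul x y w = \sum_u \sum_v K u v w * (x u * y v).
Proof.
rewrite ffunE; apply: eq_bigr => u _; rewrite big_mkcond; apply: eq_bigr => v _.
by rewrite /K; case: (wmul u v w); rewrite ?mul1r ?mulrA // !mul0r.
Qed.

Lemma tens_mul_inv x y : tens_inv x -> tens_inv y -> tens_inv (tens_mul x y).
Proof.
move=> /tens_invP hx /tens_invP hy; apply/tens_invP => s w.
rewrite !tens_mulE mulr_sumr (reindex _ (onW_bij _ (wact_bij s))) /=.
apply: eq_bigr => u _; rewrite mulr_sumr (reindex _ (onW_bij _ (wact_bij s))) /=.
apply: eq_bigr => v _; rewrite hx hy /K wmul_act.
case: (boolP (wmul u v w)) => [uvw|_]; last by rewrite !mul0r mulr0.
rewrite !mul1r [RHS]mulrA -(tens_sgn_act s uvw) -!mulrA; congr (_ * _).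
by rewrite [x u * _]mulrCA.
Qed.

Lemma tens_sgn_mull u v a c : wmul u v a -> tens_sgn a c = tens_sgn u c * tens_sgn v c.
Proof.
move=> /wmulP uva; rewrite /tens_sgn !sgn_pairsE -signr_addb -xpairsD.
congr (_ ^+ nat_of_bool _); apply: eq_xpairs => k l _.
by rewrite (lodd_mul (uva l)) andb_addl.
Qed.

Lemma tens_sgn_mulr u v c b : wmul v c b -> tens_sgn u b = tens_sgn u v * tens_sgn u c.
Proof.
move=> /wmulP vcb; rewrite /tens_sgn !sgn_pairsE -signr_addb -xpairsD.
congr (_ ^+ nat_of_bool _); apply: eq_xpairs => k l _.
by rewrite (lodd_mul (vcb k)) andb_addr.
Qed.

Let tri u v c w : bool :=
  [forall k, obind (fun a => letter_mul a (c k)) (letter_mul (u k) (v k)) == Some (w k)].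

Lemma K_triL u v c w : \sum_a K u v a * K a c w =
  (tri u v c w)%:R * (tens_sgn u v * tens_sgn u c * tens_sgn v c).
Proof.
case: (boolP (tri u v c w)) => [/forallP h|h]; last first.
  rewrite mul0r big1 // => a _; rewrite /K.
  case: (boolP (wmul u v a)) => [/wmulP uva|_]; last by rewrite !mul0r.
  case: (boolP (wmul a c w)) => [/wmulP acw|_]; last by rewrite !mul0r mulr0.
  by case/forallP: h => k; rewrite uva /= acw.
pose a : W := [ffun k => odflt (u k) (letter_mul (u k) (v k))].
have uva : wmul u v a.
  apply/wmulP => k; rewrite ffunE; have := h k.
  by case: letter_mul.
have acw : wmul a c w.
  by apply/wmulP => k; have := h k; move/wmulP: uva => -> /= /eqP.
rewrite (bigD1 a) //= big1 ?addr0; last first.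
  move=> a' ne; rewrite /K; case: (boolP (wmul u v a')) => [uva'|_]; last by rewrite !mul0r.
  by rewrite (wmul_fun uva uva') eqxx in ne.
by rewrite /K uva acw !mul1r (tens_sgn_mull c uva) mulrA.
Qed.

Lemma K_triR u v c w : \sum_b K v c b * K u b w =
  (tri u v c w)%:R * (tens_sgn u v * tens_sgn u c * tens_sgn v c).
Proof.
have triE : tri u v c w =
    [forall k, obind (fun b => letter_mul (u k) b) (letter_mul (v k) (c k)) == Some (w k)].
  by apply: eq_forallb => k; rewrite letter_mulA.
rewrite triE; case: (boolP [forall k, _]) => [/forallP h|h]; last first.
  rewrite mul0r big1 // => b _; rewrite /K.
  case: (boolP (wmul v c b)) => [/wmulP vcb|_]; last by rewrite !mul0r.
  case: (boolP (wmul u b w)) => [/wmulP ubw|_]; last by rewrite !mul0r mulr0.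
  by case/forallP: h => k; rewrite vcb /= ubw.
pose b : W := [ffun k => odflt (u k) (letter_mul (v k) (c k))].
have vcb : wmul v c b.
  apply/wmulP => k; rewrite ffunE; have := h k.
  by case: letter_mul.
have ubw : wmul u b w.
  by apply/wmulP => k; have := h k; move/wmulP: vcb => -> /= /eqP.
rewrite (bigD1 b) //= big1 ?addr0; last first.
  move=> b' ne; rewrite /K; case: (boolP (wmul v c b')) => [vcb'|_]; last by rewrite !mul0r.
  by rewrite (wmul_fun vcb vcb') eqxx in ne.
by rewrite /K vcb ubw !mul1r (tens_sgn_mulr u vcb) mulrC.
Qed.

Lemma tens_mulA : associative (@tens_mul n m d).
Proof.
move=> x y z; apply/ffunP => w; apply: esym.
transitivity (\sum_u \sum_v \sum_c (\sum_a K u v a * K a c w) * (x u * y v * z c)).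
  rewrite tens_mulE.
  under eq_bigr => a _ do under eq_bigr => c _ do
    rewrite tens_mulE mulr_suml mulr_sumr.
  under eq_bigr => a _ do under eq_bigr => c _ do under eq_bigr => u _ do
    rewrite mulr_suml mulr_sumr.
  under eq_bigr => a _ do rewrite exchange_big /=.
  rewrite exchange_big /=; apply: eq_bigr => u _.
  under eq_bigr => a _ do rewrite exchange_big /=.
  rewrite exchange_big /=; apply: eq_bigr => v _.
  rewrite exchange_big /=; apply: eq_bigr => c _.
  by rewrite mulr_suml; apply: eq_bigr => a _; rewrite [K u v a * K a c w]mulrC -!mulrA.
transitivity (\sum_u \sum_v \sum_c (\sum_b K v c b * K u b w) * (x u * y v * z c)).
  apply: eq_bigr => u _; apply: eq_bigr => v _; apply: eq_bigr => c _.
  by rewrite K_triL K_triR.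
rewrite tens_mulE; apply: eq_bigr => u _.
under [RHS]eq_bigr => b _ do rewrite tens_mulE !mulr_sumr.
under [RHS]eq_bigr => b _ do under eq_bigr => v _ do rewrite !mulr_sumr.
rewrite [RHS]exchange_big /=; apply: eq_bigr => v _.
rewrite [RHS]exchange_big /=; apply: eq_bigr => c _.
rewrite mulr_suml; apply: eq_bigr => b _.
move: (K v c b) (K u b w) => k1 k2.
by rewrite -!mulrA [LHS]mulrCA [in RHS](mulrCA (x u)).
Qed.

Lemma tens_mul1 : left_id (@tens_one n m d) (@tens_mul n m d).
Proof.
move=> x; apply/ffunP => w; rewrite tens_mulE.
pose u0 : W := [ffun k => (Ze (ztgt (w k).1.1), (w k).1.2, (w k).1.2)].
have one0 : [forall k, letter_one (u0 k)].
  by apply/forallP => k; rewrite ffunE /letter_one /= eqxx.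
have sgn1 u v : [forall k, letter_one (u k)] -> tens_sgn u v = 1.
  move=> /forallP h; rewrite /tens_sgn sgn_pairsE -[RHS](expr0 (-1)) -[0%N]/(nat_of_bool false).
  rewrite -(xpairs0 d); congr (_ ^+ nat_of_bool _); apply: eq_xpairs => k l _.
  by rewrite letter_one_even.
have mul0 : wmul u0 w w.
  by apply/wmulP => k; apply/eqP; move/forallP: one0 => /(_ k) /letter_mul1l ->; rewrite ffunE.
rewrite (bigD1 u0) //= (bigD1 w) //= [X in _ + X + _]big1 ?addr0; last first.
  move=> v ne; rewrite /K; case: (boolP (wmul u0 v w)) => [h|_]; last by rewrite !mul0r.
  case/eqP: ne; apply/ffunP => k.
  by move/wmulP/(_ k): h => /letter_mul1l_eq ->//; apply/forallP: k.
rewrite big1 ?addr0; last first.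
  move=> u ne; apply: big1 => v _; rewrite ffunE /K.
  case: (boolP [forall k, letter_one (u k)]) => [one|_]; last by rewrite mul0r mulr0.
  case: (boolP (wmul u v w)) => [h|_]; last by rewrite !mul0r.
  case/eqP: ne; apply/ffunP => k; move/forallP: one => /(_ k) one.
  move/wmulP/(_ k): h => h; have e := letter_mul1l_eq one h; rewrite e in h.
  by move/eqP: h; rewrite letter_mul1l // => /eqP ->; rewrite ffunE.
by rewrite /K mul0 sgn1 // ffunE one0 !mul1r.
Qed.

Lemma tens_mulr1 : right_id (@tens_one n m d) (@tens_mul n m d).
Proof.
move=> x; apply/ffunP => w; rewrite tens_mulE.
pose u0 : W := [ffun k => (Ze (zsrc (w k).1.1), (w k).2, (w k).2)].
have one0 : [forall k, letter_one (u0 k)].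
  by apply/forallP => k; rewrite ffunE /letter_one /= eqxx.
have sgn1 u v : [forall k, letter_one (v k)] -> tens_sgn u v = 1.
  move=> /forallP h; rewrite /tens_sgn sgn_pairsE -[RHS](expr0 (-1)) -[0%N]/(nat_of_bool false).
  rewrite -(xpairs0 d); congr (_ ^+ nat_of_bool _); apply: eq_xpairs => k l _.
  by rewrite (letter_one_even (h k)) andbF.
have mul0 : wmul w u0 w.
  by apply/wmulP => k; apply/eqP; move/forallP: one0 => /(_ k) /letter_mul1r ->; rewrite ffunE.
rewrite exchange_big (bigD1 u0) //= (bigD1 w) //= [X in _ + X + _]big1 ?addr0; last first.
  move=> v ne; rewrite /K; case: (boolP (wmul v u0 w)) => [h|_]; last by rewrite !mul0r.
  case/eqP: ne; apply/ffunP => k.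
  by move/wmulP/(_ k): h => /letter_mul1r_eq ->//; apply/forallP: k.
rewrite big1 ?addr0; last first.
  move=> u ne; apply: big1 => v _; rewrite ffunE /K.
  case: (boolP [forall k, letter_one (u k)]) => [one|_]; last by rewrite !mulr0.
  case: (boolP (wmul v u w)) => [h|_]; last by rewrite !mul0r.
  case/eqP: ne; apply/ffunP => k; move/forallP: one => /(_ k) one.
  move/wmulP/(_ k): h => h; have e := letter_mul1r_eq one h; rewrite e in h.
  by move/eqP: h; rewrite letter_mul1r // => /eqP ->; rewrite ffunE.
by rewrite /K mul0 sgn1 // ffunE one0 !mul1r mulr1.
Qed.

Lemma tens_mulDl : left_distributive (@tens_mul n m d) +%R.
Proof.
move=> x y z; apply/ffunP => w; rewrite [RHS]ffunE !tens_mulE -big_split /=.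
apply: eq_bigr => u _; rewrite -big_split /=; apply: eq_bigr => v _.
by rewrite [(x + y) u]ffunE mulrDl mulrDr.
Qed.

Lemma tens_mulDr : right_distributive (@tens_mul n m d) +%R.
Proof.
move=> x y z; apply/ffunP => w; rewrite [RHS]ffunE !tens_mulE -big_split /=.
apply: eq_bigr => u _; rewrite -big_split /=; apply: eq_bigr => v _.
by rewrite [(y + z) v]ffunE mulrDr mulrDr.
Qed.

End TensTheory.

HB.instance Definition _ n m d := GRing.Zmodule_isPzRing.Build (tens n m d)
  (@tens_mulA n m d) (@tens_mul1 n m d) (@tens_mulr1 n m d)
  (@tens_mulDl n m d) (@tens_mulDr n m d).

Section TZTheory.
Variables n m d : nat.
Local Notation W := (word n m d).
Local Notation T := (tens n m d).
Implicit Types (u v w o : W) (x y z : T) (s t : 'S_d).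

Lemma cfactE w : cfact w = #|fibperm w (@lis_c n m)|.
Proof.
rewrite card_fibperm /cfact.
under [LHS]eq_bigr => j _ do rewrite pair_bigA /=.
rewrite pair_bigA /=.
pose h (q : 'I_n * ('I_m * 'I_m)) : letter n m := (Zc q.1, q.2.1, q.2.2).
rewrite (reindex h) /=; last first.
  exists (fun x : letter n m => (zsrc x.1.1, (x.1.2, x.2))) => [[j [r q]] _ //|].
  by move=> [[b r] q]; rewrite unfold_in /lis_c /h; case: b.
by [].
Qed.

Lemma cfact_gt0 w : (0 < cfact w)%N.
Proof. by rewrite cfactE cardG_gt0. Qed.

Lemma cfact_act w s : cfact (wact w s) = cfact w.
Proof.
apply: eq_bigr => j _; apply: eq_bigr => r _; apply: eq_bigr => q _.
congr (_ `!)%N; rewrite -(card_preimset [set k | w k == _] (@perm_inj _ s)).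
by apply: eq_card => k; rewrite !inE ffunE.
Qed.

(* By TZP this decides membership in TZ, which makes it a subring: TZc1, TZcM. *)
Definition TZc x : bool := tens_inv x && [forall w, (cfact w %| x w)%Z].

Lemma TZcP x : reflect
  ((forall s w, x (wact w s) = place_sgn s w * x w) /\ forall w, (cfact w %| x w)%Z)
  (TZc x).
Proof.
apply: (iffP andP) => [[/tens_invP ? /forallP] //|[? ?]].
by split; [apply/tens_invP | apply/forallP].
Qed.

Lemma TZc0 : TZc 0.
Proof. by apply/TZcP; split=> *; rewrite !ffunE ?mulr0 ?dvdz0. Qed.

Lemma TZcD x y : TZc x -> TZc y -> TZc (x + y).
Proof.
move=> /TZcP[ix dx] /TZcP[iy dy]; apply/TZcP; split=> *.
  by rewrite !ffunE ix iy mulrDr.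
by rewrite ffunE rpredD.
Qed.

Lemma TZcN x : TZc x -> TZc (- x).
Proof.
move=> /TZcP[ix dx]; apply/TZcP; split=> *.
  by rewrite !ffunE ix mulrN.
by rewrite ffunE rpredN.
Qed.

Lemma TZcZ x (a : int) : TZc x -> TZc (x *~ a).
Proof.
move=> hx; have hn k : TZc (x *+ k).
  by elim: k => [|k IH]; rewrite ?mulr0n ?TZc0 // mulrS TZcD.
by case: a => k; rewrite ?NegzE ?mulrNz ?TZcN // -pmulrn.
Qed.

Lemma TZc_sum (I : finType) (P : pred I) (F : I -> T) :
  (forall i, P i -> TZc (F i)) -> TZc (\sum_(i | P i) F i).
Proof. by move=> h; apply: (big_ind TZc) => //; [apply: TZc0 | apply: TZcD]. Qed.

Lemma place_sgn_tperm (k l : 'I_d) w :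
  (k < l)%N -> lodd (w k) -> lodd (w l) -> place_sgn (tperm k l) w = -1.
Proof.
move=> kl ok ol.
rewrite /place_sgn sgn_pairsE -[RHS](expr1 (-1)) -[1%N]/(nat_of_bool true).
congr (_ ^+ nat_of_bool _); rewrite tpermV.
pose mid (i : 'I_d) := [&& (k < i)%N, (i < l)%N & lodd (w i)].
pose A (i j : 'I_d) := (i == k) && (j == l).
pose B (i j : 'I_d) := (i == k) && mid j.
pose C (i j : 'I_d) := mid i && (j == l).
rewrite (@eq_xpairs _ _ (fun i j => A i j (+) (B i j (+) C i j))); last first.
  have kNl : (k == l) = false by rewrite -val_eqE (ltn_eqF kl).
  have lNk : (l == k) = false by rewrite eq_sym.
  have lk : (l < k)%N = false by rewrite ltnNge ltnW.
  move=> i j ij; rewrite /A /B /C /mid.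
  have ji : (j < i)%N = false by rewrite ltnNge ltnW.
  case: (tpermP k l i) => [ei|ei|/eqP ik /eqP il];
    case: (tpermP k l j) => [ej|ej|/eqP jk /eqP jl]; subst;
    rewrite ?eqxx ?ltnn ?ok ?ol ?kNl ?lNk ?(negbTE ik) ?(negbTE il) ?(negbTE jk) ?(negbTE jl) /=;
    rewrite ?andbT ?andbF ?addbF ?addFb //= ?lk ?ji ?ij //=.
    by rewrite (ltnNge j k) (ltnW (ltn_trans kl ij)).
  by rewrite (ltnNge l i) (ltnW (ltn_trans ij kl)).
rewrite !xpairsD.
have -> : xpairs A = true.
  rewrite /xpairs (bigD1 (k, l)) //= /A !eqxx big1 ?addbF // => -[i j] /= /andP[_].
  by rewrite -pair_eqE /= => /negbTE.
suff -> : xpairs B = xpairs C by rewrite addbb addbF.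
rewrite /xpairs -!(pair_big_dep xpredT (fun i j : 'I_d => (i < j)%N)) /=.
rewrite (bigD1 k) //= [X in _ (+) X]big1 ?addbF; last first.
  by move=> i ik; rewrite big1 // => j _; rewrite /B (negbTE ik).
rewrite [RHS](exchange_big_dep xpredT) //= [RHS](bigD1 l) //= [X in _ = _ (+) X]big1 ?addbF; last first.
  by move=> j jl; rewrite big1 // => i _; rewrite /C (negbTE jl) andbF.
rewrite !(big_mkcond (fun _ => (_ < _)%N)) /=; apply: eq_bigr => i _.
by rewrite /B /C /mid !eqxx andbT; case: (k < i)%N; case: (i < l)%N.
Qed.

Lemma tens_inv_nadm x w : tens_inv x -> ~~ admissible w -> x w = 0.
Proof.
move=> /tens_invP ix; rewrite negb_forall => /existsP[k].
rewrite negb_forall => /existsP[l]; rewrite negb_imply negbK.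
move=> /andP[/andP[nkl /eqP wkl] odk].
wlog kl : k l nkl wkl odk / (k < l)%N.
  move=> h; case: (ltngtP k l) => [kl|lk|/val_inj e]; first exact: (h k l).
    by apply: (h l k) => //; rewrite ?wkl -?wkl // eq_sym.
  by rewrite e eqxx in nkl.
have ws : wact w (tperm k l) = w.
  by apply/ffunP => i; rewrite ffunE; case: tpermP => // ->.
have := ix (tperm k l) w; rewrite ws place_sgn_tperm -?wkl // mulN1r => /eqP.
by rewrite -addr_eq0 -mulr2n mulrn_eq0 => /eqP.
Qed.

Lemma place_sgn_even s w :
  (forall k, lodd (w k) -> s k = k) -> place_sgn s w = 1.
Proof.
move=> h; rewrite /place_sgn sgn_pairsE (@eq_xpairs _ _ (fun _ _ => false)) ?xpairs0 //.
have hV k : lodd (w k) -> s^-1%g k = k by move=> ok; rewrite -{1}(h k ok) permK.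
move=> k l kl; apply/negbTE/negP => /and3P[lk ok ol].
by move: lk; rewrite !hV // ltnNge ltnW.
Qed.

Lemma place_sgn_winv s w : admissible w ->
  place_sgn s w = (-1) ^+ (winv w + winv (wact w s)).
Proof.
move=> /forallP adm.
pose I (k l : 'I_d) := [&& lodd (w k), lodd (w l) & (enum_rank (w l) < enum_rank (w k))%N].
rewrite exprD -!/(sgn_pairs _) /winv -!/(sgn_pairs _).
rewrite /place_sgn !sgn_pairsE -signr_addb; congr (_ ^+ nat_of_bool _).
rewrite [X in _ (+) X](@eq_xpairs _ _ (fun k l => I (s k) (s l))); last first.
  by move=> k l _; rewrite !ffunE.
rewrite (xpairs_perm I) -xpairsD; apply: eq_xpairs => k l kl.
rewrite -/(I k l); case: (ltngtP (s^-1%g k) (s^-1%g l)) => [_|_|e]; last first.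
- by move: kl; rewrite (perm_inj (val_inj e)) ltnn.
- rewrite /I /=; case: (boolP (lodd (w k))) => ok; case: (boolP (lodd (w l))) => //= ol.
  have := adm k => /forallP /(_ l); rewrite -val_eqE (ltn_eqF kl) /= ok /=.
  case: eqP => //= ne _; case: (ltngtP (enum_rank (w k)) (enum_rank (w l))) => // /val_inj.
  by move/enum_rank_inj.
- by rewrite addbb.
Qed.

Lemma sgn_sqr k : (-1) ^+ k * (-1) ^+ k = 1 :> int.
Proof. by rewrite -exprD addnn -mul2n exprM sqrrN expr1n. Qed.

Lemma sgn_dbl k : (-1) ^+ (k + k) = 1 :> int.
Proof. by rewrite exprD sgn_sqr. Qed.

Lemma admissible_act w s : admissible (wact w s) = admissible w.
Proof.
have imp w' t : admissible w' -> admissible (wact w' t).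
  move=> /forallP h; apply/forallP => k; apply/forallP => l.
  have := h (t k) => /forallP/(_ (t l)).
  by rewrite !ffunE (inj_eq perm_inj).
apply/idP/idP => [/(imp _ s^-1%g)|]; last exact: imp.
by rewrite wactK.
Qed.

Lemma same_orbit_act w w' s : same_orbit w (wact w' s) = same_orbit w w'.
Proof.
apply/existsP/existsP => -[t /eqP e].
  by exists (s^-1 * t)%g; rewrite wactM -e wactK.
by exists (s * t)%g; rewrite wactM e.
Qed.

Lemma same_orbitP w w' : reflect (exists s, w' = wact w s) (same_orbit w w').
Proof. by apply: (iffP existsP) => -[s /eqP]; exists s => //; apply/eqP. Qed.

Lemma same_orbit_refl w : same_orbit w w.
Proof. by apply/same_orbitP; exists 1%g; rewrite wact1. Qed.

Lemma tens_mulrnE x k w : (x *+ k) w = x w *+ k.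
Proof. by elim: k => [|k IH]; rewrite ?mulr0n ?ffunE // !mulrS ffunE IH. Qed.

Lemma tens_mulrzE x (a : int) w : (x *~ a) w = x w * a.
Proof.
case: a => k; first by rewrite -pmulrn tens_mulrnE pmulrn mulrzz.
by rewrite NegzE mulrNz mulrN ffunE -pmulrn tens_mulrnE pmulrn mulrzz.
Qed.

Lemma etaE w w' : eta w w' =
  if same_orbit w w' then (-1) ^+ (winv w + winv w') * (cfact w)%:R else 0.
Proof.
by rewrite /eta tens_mulrnE ffunE; case: ifP => _; rewrite ?mul0rn // mulr_natr.
Qed.

Lemma TZc_eta w : admissible w -> TZc (eta w).
Proof.
move=> adm; apply/TZcP; split=> [s w'|w']; rewrite !etaE; last first.
  case: ifP => [/same_orbitP[s ->]|_]; last exact: dvdz0.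
  by rewrite cfact_act natz dvdz_mull // dvdzz.
rewrite same_orbit_act; case: ifP => [/same_orbitP[t e]|_]; last by rewrite mulr0.
rewrite place_sgn_winv; last by rewrite e admissible_act.
rewrite mulrA -exprD [(winv w' + _)%N]addnC addnACA [in RHS]exprD.
by rewrite sgn_dbl mulr1 addnC.
Qed.

(* One representative of each orbit: its first word in the enumeration order. *)
Definition is_rep w : bool :=
  admissible w && [forall s, (enum_rank w <= enum_rank (wact w s))%N].

Lemma exists_rep w : admissible w -> exists s, is_rep (wact w s).
Proof.
move=> adm; pose F (s : 'S_d) : nat := enum_rank (wact w s).
case: (@arg_minnP _ (1%g : 'S_d) xpredT F isT) => s _ smin.
exists s; rewrite /is_rep admissible_act adm; apply/forallP => t.
by rewrite -wactM; apply: smin.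
Qed.

Lemma rep_uniq w w' : is_rep w -> is_rep w' -> same_orbit w w' -> w = w'.
Proof.
move=> /andP[_ /forallP h] /andP[_ /forallP h'] /same_orbitP[s e].
apply/enum_rank_inj/val_inj/eqP; rewrite eqn_leq {1}e h /=.
by have := h' s^-1%g; rewrite {2}e wactK.
Qed.

Definition tzcoef x w : int := (x w %/ (cfact w)%:Z)%Z.

Lemma TZ_expand x : TZc x -> x = \sum_(o | is_rep o) eta o *~ tzcoef x o.
Proof.
move=> /TZcP[ix dx]; apply/ffunP => w; rewrite sum_ffunE.
under eq_bigr => o _ do rewrite tens_mulrzE etaE.
case: (boolP (admissible w)) => [adm|nadm]; last first.
  rewrite tens_inv_nadm //; last by apply/tens_invP.
  rewrite big1 // => o /andP[ao _]; case: ifP => [/same_orbitP[s e]|]; last by rewrite mul0r.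
  by rewrite e admissible_act ao in nadm.
have [s hs] := exists_rep adm.
have so : same_orbit (wact w s) w.
  by apply/same_orbitP; exists s^-1%g; rewrite wactK.
rewrite (bigD1 (wact w s)) //= so big1 ?addr0; last first.
  move=> o /andP[ro /negbTE ne]; case: ifP => [ow|]; last by rewrite mul0r.
  have : same_orbit o (wact w s) by rewrite same_orbit_act.
  by move/(rep_uniq ro hs)/eqP; rewrite ne.
have e : tzcoef x (wact w s) * (cfact (wact w s))%:R = x (wact w s).
  by rewrite natz /tzcoef divzK.
rewrite -mulrA [_%:R * _]mulrC e ix place_sgn_winv // mulrA addnC -exprD exprD.
by rewrite sgn_sqr mul1r.
Qed.

Lemma TZ_expand_uniq (c : W -> int) o : is_rep o ->
  tzcoef (\sum_(o | is_rep o) eta o *~ c o) o = c o.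
Proof.
move=> ro; rewrite /tzcoef sum_ffunE (bigD1 o) //= big1 ?addr0; last first.
  move=> o' /andP[ro' /negbTE ne]; rewrite tens_mulrzE etaE.
  case: ifP => [/(rep_uniq ro' ro)/eqP|]; last by rewrite mul0r.
  by rewrite ne.
rewrite tens_mulrzE etaE same_orbit_refl sgn_dbl mul1r natz mulKz //.
by rewrite -lt0n cfact_gt0.
Qed.

Lemma TZP x : TZ x <-> TZc x.
Proof.
split=> [[c ->]|/TZ_expand ->]; first by apply: TZc_sum => w adm; apply/TZcZ/TZc_eta.
exists (fun w => if is_rep w then tzcoef x w else 0).
rewrite [RHS](bigID is_rep) /= [X in _ = _ + X]big1 ?addr0; last first.
  by move=> w /andP[_ /negbTE ->]; rewrite mulr0z.
apply: eq_big => [w|w ->//]; rewrite andbC.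
by case: (boolP (is_rep w)) => // /andP[->].
Qed.

Lemma TZc1 : TZc 1.
Proof.
apply/TZcP; split=> [s w|w]; rewrite !ffunE.
  have -> : [forall k, letter_one (wact w s k)] = [forall k, letter_one (w k)].
    apply/forallP/forallP => h k; last by rewrite ffunE.
    by have := h (s^-1%g k); rewrite ffunE permKV.
  case: (boolP [forall k, _]) => [/forallP h|_]; last by rewrite mulr0.
  by rewrite place_sgn_even ?mulr1 // => k; rewrite letter_one_even.
case: (boolP [forall k, _]) => [/forallP h|_]; last exact: dvdz0.
suff -> : cfact w = 1%N by [].
rewrite cfactE; apply/eqP; rewrite -trivg_card1; apply/eqP/trivgP.
apply/subsetP => s /fibpermP hs; rewrite inE; apply/eqP/permP => k.
have [_ i] := hs k; rewrite perm1 i //; move: (h k); rewrite /letter_one /lis_c.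
by case: (w k) => -[[]].
Qed.

Lemma TZcM x y : TZc x -> TZc y -> TZc (x * y).
Proof.
move=> tx ty; have /TZcP[ix dx] := tx; have /TZcP[iy dy] := ty.
have invx : tens_inv x by apply/tens_invP.
have invy : tens_inv y by apply/tens_invP.
rewrite /TZc tens_mul_inv //=; apply/forallP => w.
pose F (p : W * W) : int :=
  (wmul p.1 p.2 w)%:R * (tens_sgn p.1 p.2 * x p.1 * y p.2).
have -> : (x * y) w = \sum_p F p.
  rewrite [LHS]ffunE -(pair_bigA _ (fun u v => F (u, v))) /=.
  apply: eq_bigr => u _; rewrite big_mkcond; apply: eq_bigr => v _.
  by rewrite /F /=; case: wmul; rewrite ?mul1r ?mul0r.
pose to (p : W * W) s := (wact p.1 s^-1%g, wact p.2 s^-1%g).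
have toA : is_action [set: 'S_d] to.
  split=> [s p q /=|p s t _ _]; last by rewrite /to invMg !wactM.
  case: p q => [p1 p2] [q1 q2] [/(can_inj (@wactKV _ _ _ s)) -> /(can_inj (@wactKV _ _ _ s)) ->].
  by [].
pose a := Action toA.
have aE p s : a p s = (wact p.1 s^-1%g, wact p.2 s^-1%g) by [].
rewrite cfactE; apply: (@dvd_sum_orbits _ (fibperm_group w (@lis_c n m)) _ a).
  move=> s sG p; rewrite aE /F /=.
  have /fibpermP ht : s^-1%g \in fibperm w (@lis_c n m) by rewrite groupV.
  set t := s^-1%g in ht *.
  have wt : wact w t = w by apply/ffunP => k; rewrite ffunE; have [-> _] := ht k.
  rewrite -{1}wt wmul_act; case: (boolP (wmul p.1 p.2 w)) => [h|_]; last by rewrite !mul0r.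
  rewrite !mul1r ix iy; have := tens_sgn_act t h.
  rewrite [place_sgn t w]place_sgn_even ?mul1r => [<-|k ok]; last first.
    have [_] := ht k; apply.
    by apply/negP => /lis_c_even; rewrite ok.
  rewrite mulrA -!mulrA; congr (_ * _); congr (_ * _).
  by rewrite mulrCA.
move=> [u v]; rewrite /F /=.
case: (boolP (wmul u v w)) => [/wmulP uvw|_]; last by rewrite mul0r dvdz0.
rewrite mul1r -mulrA dvdz_mull //.
case: (boolP (admissible u)) => [/forallP au|nu]; last first.
  by rewrite (tens_inv_nadm invx nu) mul0r dvdz0.
pose f (k : 'I_d) := (u k, v k).
pose P1 (q : letter n m * letter n m) := lis_c q.1.
pose P2 (q : letter n m * letter n m) := lis_c q.2 && ~~ lis_c q.1.
have sub : ('C_(fibperm w (@lis_c n m))[(u, v) | a])%g \subset fibperm f (predU P1 P2).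
  apply/subsetP => s; rewrite inE => /andP[/fibpermP hs].
  rewrite inE => /andP[_]; rewrite inE sub1set inE /= => /eqP[us vs].
  have us' k : u (s k) = u k by rewrite -{1}us ffunE permK.
  have vs' k : v (s k) = v k by rewrite -{1}vs ffunE permK.
  apply/fibpermP => k; split; first by rewrite /f us' vs'.
  have [_ i] := hs k; rewrite /P1 /P2 /= negb_or => /andP[nc1].
  rewrite nc1 andbT => nc2.
  have [cE _] := lis_c_mul (uvw k).
  case: (boolP (lis_c (w k))) => [|/i//]; rewrite cE (negbTE nc1) (negbTE nc2) /=.
  move=> /andP[ou _]; apply/eqP/contraT => ne.
  have /forallP/(_ k) := au (s k).
  by rewrite ne us' eqxx ou.
apply: (@dvdz_trans (#|fibperm f (predU P1 P2)|)%:Z); first exact: cardSg.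
rewrite card_fibperm_split; last by move=> q p1; rewrite /P2 negb_and negbK; apply/orP; right.
rewrite PoszM; apply: dvdz_mul.
  apply: dvdz_trans (dx u); rewrite cfactE; apply: cardSg.
  by apply: fibpermS => // k l [].
apply: dvdz_trans (dy v); rewrite cfactE; apply: cardSg.
by apply: fibpermS => [k l []//|k /andP[]].
Qed.

End TZTheory.

Definition rep_word n m d := {w in @is_rep n m d}.

(* k (x)_Z TZ in coordinates: the eta_w, w ranging over representatives of the
   orbits of admissible words, form a Z-basis of TZ (TZP, TZ_expand,
   TZ_expand_uniq). *)
Definition tzschur (k : fieldType) n m d : Type := {ffun rep_word n m d -> k^o}.
HB.instance Definition _ k n m d := GRing.Lmodule.copy (tzschur k n m d) {ffun rep_word n m d -> k^o}.

Section TZSchur.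
Variables (k : fieldType) (n m d : nat).
Local Notation TK := (tzschur k n m d).
Local Notation T := (tens n m d).
Local Notation W := (word n m d).
Local Notation I := (rep_word n m d).
Implicit Types (x y z : TK) (o : I) (u v : T).

(* u |-> 1 (x) u, meaningful for u in TZ *)
Definition tz_base u : TK := [ffun o : I => (tzcoef u (val o))%:~R].

Definition tz_mul x y : TK :=
  \sum_o1 \sum_o2 (x o1 * y o2) *: tz_base (eta (val o1) * eta (val o2)).

Definition tz_eta (w : W) : TK := tz_base (eta w).

Lemma rep_wordP o : is_rep (val o).
Proof. exact: (valP o). Qed.

Lemma TZc_basis o : TZc (eta (val o)).
Proof. by apply: TZc_eta; have /andP[] := rep_wordP o. Qed.

Lemma TZ_expand_rep u : TZc u -> u = \sum_(o : I) eta (val o) *~ tzcoef u (val o).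
Proof. by move=> /TZ_expand {1}->; rewrite -(big_sub _ (fun w => eta w *~ tzcoef u w)). Qed.

Lemma tz_base_sum (J : finType) (c : J -> int) (F : J -> T) :
  (forall j, TZc (F j)) ->
  tz_base (\sum_j F j *~ c j) = \sum_j (c j)%:~R *: tz_base (F j).
Proof.
move=> hF; apply/ffunP => o; rewrite ffunE sum_ffunE.
have -> : tzcoef (\sum_j F j *~ c j) (val o) = \sum_j c j * tzcoef (F j) (val o).
  rewrite /tzcoef sum_ffunE.
  under eq_bigr => j _ do rewrite tens_mulrzE.
  have d0 : (cfact (val o))%:Z != 0 by rewrite -lt0n cfact_gt0.
  rewrite -[RHS](mulzK _ d0) mulr_suml; congr (_ %/ _)%Z; apply: eq_bigr => j _.
  by have /TZcP[_ dj] := hF j; rewrite -mulrA divzK // mulrC.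
rewrite rmorph_sum /=; apply: eq_bigr => j _.
by rewrite !ffunE rmorphM.
Qed.

Lemma tz_expand x : x = \sum_o x o *: tz_base (eta (val o)).
Proof.
apply/ffunP => o; rewrite sum_ffunE (bigD1 o) //= big1 ?addr0 => [|o' ne]; rewrite !ffunE.
  rewrite /tzcoef etaE same_orbit_refl sgn_dbl mul1r natz divzz -lt0n cfact_gt0.
  by rewrite /GRing.scale /= mulr1.
rewrite /tzcoef etaE; case: ifP => [h|_]; last by rewrite div0z /GRing.scale /= mulr0.
by case/eqP: ne; apply/val_inj/(rep_uniq (rep_wordP o') (rep_wordP o)).
Qed.

Lemma tz_mulDl : left_distributive tz_mul +%R.
Proof.
move=> x y z; rewrite /tz_mul -big_split; apply: eq_bigr => o1 _ /=.
rewrite -big_split; apply: eq_bigr => o2 _ /=.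
by rewrite [(x + y) o1]ffunE mulrDl scalerDl.
Qed.

Lemma tz_mulDr : right_distributive tz_mul +%R.
Proof.
move=> x y z; rewrite /tz_mul -big_split; apply: eq_bigr => o1 _ /=.
rewrite -big_split; apply: eq_bigr => o2 _ /=.
by rewrite [(y + z) o2]ffunE mulrDr scalerDl.
Qed.

Lemma tz_mulZl a x y : tz_mul (a *: x) y = a *: tz_mul x y.
Proof.
rewrite /tz_mul scaler_sumr; apply: eq_bigr => o1 _.
rewrite scaler_sumr; apply: eq_bigr => o2 _.
by rewrite [(a *: x) o1]ffunE scalerA mulrA.
Qed.

Lemma tz_mulZr a x y : tz_mul x (a *: y) = a *: tz_mul x y.
Proof.
rewrite /tz_mul scaler_sumr; apply: eq_bigr => o1 _.
rewrite scaler_sumr; apply: eq_bigr => o2 _.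
by rewrite [(a *: y) o2]ffunE scalerA mulrCA.
Qed.

Lemma tz_mul0l y : tz_mul 0 y = 0.
Proof. by have := tz_mulZl 0 0 y; rewrite !scale0r. Qed.

Lemma tz_mul0r x : tz_mul x 0 = 0.
Proof. by have := tz_mulZr 0 x 0; rewrite !scale0r. Qed.

Lemma tz_mul_suml (J : finType) (F : J -> TK) y :
  tz_mul (\sum_j F j) y = \sum_j tz_mul (F j) y.
Proof.
by apply: (big_morph (fun x => tz_mul x y)) => [a b|]; rewrite ?tz_mulDl ?tz_mul0l.
Qed.

Lemma tz_mul_sumr (J : finType) (F : J -> TK) x :
  tz_mul x (\sum_j F j) = \sum_j tz_mul x (F j).
Proof.
by apply: (big_morph (fun y => tz_mul x y)) => [a b|]; rewrite ?tz_mulDr ?tz_mul0r.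
Qed.

Lemma tz_base_delta o o' : tz_base (eta (val o)) o' = (o == o')%:R.
Proof.
rewrite ffunE /tzcoef etaE; have [->|ne] := eqVneq o o'.
  by rewrite same_orbit_refl sgn_dbl mul1r natz divzz -lt0n cfact_gt0.
case: ifP => [h|_]; last by rewrite div0z.
by case/eqP: ne; apply/val_inj/(rep_uniq (rep_wordP o) (rep_wordP o')).
Qed.

Lemma tz_mul_basis o1 o2 :
  tz_mul (tz_base (eta (val o1))) (tz_base (eta (val o2))) =
  tz_base (eta (val o1) * eta (val o2)).
Proof.
rewrite /tz_mul (bigD1 o1) //= (bigD1 o2) //= !tz_base_delta !eqxx mulr1 scale1r.
rewrite big1 ?addr0 => [|o ne]; last by rewrite tz_base_delta eq_sym (negbTE ne) mulr0 scale0r.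
rewrite big1 ?addr0 // => o ne; apply: big1 => o' _.
by rewrite tz_base_delta eq_sym (negbTE ne) mul0r scale0r.
Qed.

Local Opaque tz_mul tz_base.

Lemma tz_baseM u v : TZc u -> TZc v -> tz_base (u * v) = tz_mul (tz_base u) (tz_base v).
Proof.
move=> tu tv; rewrite (TZ_expand_rep tu) (TZ_expand_rep tv).
rewrite !tz_base_sum; try exact: TZc_basis.
rewrite mulr_suml tz_mul_suml.
under eq_bigr => o1 _ do rewrite mulr_sumr.
rewrite pair_bigA /=.
under eq_bigr => p _ do rewrite mulrzAl mulrzAr -mulrzA.
rewrite tz_base_sum; last by move=> p; apply: TZcM; apply: TZc_basis.
under [RHS]eq_bigr => o1 _ do rewrite tz_mul_sumr.
rewrite pair_bigA /=; apply: eq_bigr => p _.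
by rewrite tz_mulZl tz_mulZr tz_mul_basis scalerA mulrC intrM.
Qed.

Lemma tz_mulA : associative tz_mul.
Proof.
pose b o : TK := tz_base (eta (val o)).
have A3 o1 o2 o3 : tz_mul (b o1) (tz_mul (b o2) (b o3)) = tz_mul (tz_mul (b o1) (b o2)) (b o3).
  have h1 := TZc_basis o1; have h2 := TZc_basis o2; have h3 := TZc_basis o3.
  by rewrite -(tz_baseM h2 h3) -(tz_baseM h1 (TZcM h2 h3)) mulrA
    (tz_baseM (TZcM h1 h2) h3) (tz_baseM h1 h2).
have A2 o1 o2 z : tz_mul (b o1) (tz_mul (b o2) z) = tz_mul (tz_mul (b o1) (b o2)) z.
  rewrite (tz_expand z) (tz_mul_sumr _ (b o2)) (tz_mul_sumr _ (b o1)).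
  rewrite (tz_mul_sumr _ (tz_mul (b o1) (b o2))); apply: eq_bigr => o3 _.
  by rewrite (tz_mulZr _ (b o2)) (tz_mulZr _ (b o1)) (tz_mulZr _ (tz_mul _ _)) A3.
have A1 o1 y z : tz_mul (b o1) (tz_mul y z) = tz_mul (tz_mul (b o1) y) z.
  rewrite (tz_expand y) [tz_mul (\sum_o _) z]tz_mul_suml 2!(tz_mul_sumr _ (b o1)).
  rewrite [RHS]tz_mul_suml; apply: eq_bigr => o2 _.
  by rewrite (tz_mulZl _ (b o2)) 2!(tz_mulZr _ (b o1)) [RHS]tz_mulZl A2.
move=> x y z; rewrite (tz_expand x) (tz_mul_suml _ (tz_mul y z)) (tz_mul_suml _ y).
rewrite (tz_mul_suml _ z); apply: eq_bigr => o1 _.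
by rewrite (tz_mulZl _ _ (tz_mul y z)) (tz_mulZl _ _ y) (tz_mulZl _ _ z) A1.
Qed.

Lemma tz_mul1l : left_id (tz_base 1) tz_mul.
Proof.
move=> x; rewrite {1}(tz_expand x) tz_mul_sumr [RHS]tz_expand.
apply: eq_bigr => o _; rewrite tz_mulZr -tz_baseM ?mul1r //.
  exact: TZc1.
exact: TZc_basis.
Qed.

Lemma tz_mul1r : right_id (tz_base 1) tz_mul.
Proof.
move=> x; rewrite {1}(tz_expand x) tz_mul_suml [RHS]tz_expand.
apply: eq_bigr => o _; rewrite tz_mulZl -tz_baseM ?mulr1 //.
  exact: TZc_basis.
exact: TZc1.
Qed.

End TZSchur.

HB.instance Definition _ (k : fieldType) n m d := GRing.Zmodule_isPzRing.Build (tzschur k n m d)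
  (@tz_mulA k n m d) (@tz_mul1l k n m d) (@tz_mul1r k n m d)
  (@tz_mulDl k n m d) (@tz_mulDr k n m d).

Section TZSchurScalars.
Variables (k : fieldType) (n m d : nat).
Local Notation TK := (tzschur k n m d).

Definition tz_scal (a : k) : TK := a *: (1 : TK).

Fact tz_scal_is_nmod_morphism : nmod_morphism tz_scal.
Proof. by split=> [|a b]; rewrite /tz_scal ?scale0r ?scalerDl. Qed.

Fact tz_scal_is_monoid_morphism : monoid_morphism tz_scal.
Proof.
split=> [|a b]; first exact: scale1r.
by rewrite /tz_scal /GRing.mul /= tz_mulZl tz_mulZr scalerA tz_mul1l.
Qed.

HB.instance Definition _ := GRing.isNmodMorphism.Build k TK tz_scal tz_scal_is_nmod_morphism.
HB.instance Definition _ := GRing.isMonoidMorphism.Build k TK tz_scal tz_scal_is_monoid_morphism.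

Definition word_deg (w : word n m d) : nat := (\sum_i zdeg (w i).1.1)%N.

Definition tz_homog (r : int) (x : TK) : Prop :=
  forall o, x o != 0 -> (word_deg (val o))%:Z = r.

End TZSchurScalars.

Definition mword m d := {ffun 'I_d -> 'I_m}.

Definition mwact m d (r : mword m d) (s : 'S_d) : mword m d := [ffun a => r (s a)].

(* M_m(k)^{(x) d} is the algebra of matrices with rows and columns indexed by
   [m]^d; the tensor of the xi_{r_a,t_a} is the matrix unit at (r, t). *)
Definition schur_inv (k : fieldType) m d (A : 'M[k]_#|mword m d|) : bool :=
  [forall s, forall r, forall t,
     A (enum_rank (mwact r s)) (enum_rank (mwact t s)) == A (enum_rank r) (enum_rank t)].

(* The S_d-invariants of M_m(k)^{(x) d} *)
Record schur (k : fieldType) m d := Schur {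
  schur_val : 'M[k]_#|mword m d|;
  _ : schur_inv schur_val }.

Section SchurAlgebra.
Variables (k : fieldType) (m d : nat).
Local Notation I := (mword m d).

HB.instance Definition _ := [isSub for @schur_val k m d].
HB.instance Definition _ := [Choice of schur k m d by <:].

Lemma schur_invP (A : 'M[k]_#|I|) : reflect
  (forall s r t, A (enum_rank (mwact r s)) (enum_rank (mwact t s)) =
                 A (enum_rank r) (enum_rank t)) (schur_inv A).
Proof.
apply: (iffP forallP) => [h s r t|h s].
  by have /forallP/(_ r)/forallP/(_ t)/eqP := h s.
by apply/forallP => r; apply/forallP => t; rewrite h.
Qed.

Lemma mwact_inj s : injective (fun r : I => mwact r s).
Proof.
move=> r t /ffunP h; apply/ffunP => a.
by have := h (s^-1%g a); rewrite !ffunE permKV.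
Qed.

Fact schur_subring_closed : subring_closed (@schur_inv k m d).
Proof.
split.
- apply/schur_invP => s r t; rewrite !mxE !(inj_eq enum_rank_inj).
  by rewrite (inj_eq (@mwact_inj s)).
- move=> A B /schur_invP hA /schur_invP hB; apply/schur_invP => s r t.
  by rewrite !mxE hA hB.
- move=> A B /schur_invP hA /schur_invP hB; apply/schur_invP => s r t.
  rewrite !mxE !(reindex _ (onW_bij _ (@enum_rank_bij I))) /=.
  rewrite (reindex_inj (@mwact_inj s)); apply: eq_bigr => q _.
  by rewrite hA hB.
Qed.

HB.instance Definition _ :=
  GRing.SubChoice_isSubPzRing.Build 'M[k]_#|I| (@schur_inv k m d) (schur k m d)
    schur_subring_closed.

Fact schur_subsemimod_closed : GRing.subsemimod_closed (@schur_inv k m d).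
Proof.
split; first exact: GRing.zmod_closedD (GRing.subring_closedB schur_subring_closed).
move=> a A /schur_invP hA; apply/schur_invP => s r t.
by rewrite !mxE hA.
Qed.

HB.instance Definition _ :=
  GRing.SubZmodule_isSubLmodule.Build k 'M[k]_#|I| (@schur_inv k m d) (schur k m d)
    schur_subsemimod_closed.

Fact schur_scal_inv (a : k) : schur_inv (a%:M : 'M[k]_#|I|).
Proof.
apply/schur_invP => s r t; rewrite !mxE !(inj_eq enum_rank_inj).
by rewrite (inj_eq (@mwact_inj s)).
Qed.

Definition schur_scal (a : k) : schur k m d := Schur (schur_scal_inv a).

Fact schur_scal_is_nmod_morphism : nmod_morphism schur_scal.
Proof. by split=> [|a b]; apply: val_inj; rewrite /= ?raddf0 ?raddfD. Qed.

Fact schur_scal_is_monoid_morphism : monoid_morphism schur_scal.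
Proof. by split=> [|a b]; apply: val_inj; rewrite //= scalar_mxM. Qed.

HB.instance Definition _ :=
  GRing.isNmodMorphism.Build k (schur k m d) schur_scal schur_scal_is_nmod_morphism.
HB.instance Definition _ :=
  GRing.isMonoidMorphism.Build k (schur k m d) schur_scal schur_scal_is_monoid_morphism.

(* The matrix units summed to get Schur's xi_{r,t} are those at the distinct
   pairs in the orbit of (r,t). *)
Definition schur_xi_mx (r t : I) : 'M[k]_#|I| :=
  \matrix_(i, j) ([exists s, (enum_val i == mwact r s) && (enum_val j == mwact t s)])%:R.

Fact schur_xi_inv r t : schur_inv (schur_xi_mx r t).
Proof.
apply/schur_invP => s r' t'; rewrite !mxE !enum_rankK; congr (nat_of_bool _)%:R.
have actM q u v : mwact q (u * v)%g = mwact (mwact q v) u :> I.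
  by apply/ffunP => a; rewrite !ffunE permM.
apply/existsP/existsP => -[u /andP[/eqP er /eqP et]].
  exists (s^-1 * u)%g; apply/andP; split; apply/eqP; apply: (@mwact_inj s).
    by rewrite -actM mulKVg er.
  by rewrite -actM mulKVg et.
by exists (s * u)%g; rewrite !actM er et !eqxx.
Qed.

Definition schur_xi (r t : I) : schur k m d := Schur (schur_xi_inv r t).

End SchurAlgebra.

(* A vector space presented by representatives of its elements: [es_eqv] is
   equality of classes, and addition, scalar multiplication and zero are given
   as relations between representatives. *)
Record extspace (k : Type) := ExtSpace {
  es_car :> Type;
  es_eqv : es_car -> es_car -> Prop;
  es_add : es_car -> es_car -> es_car -> Prop;
  es_scale : k -> es_car -> es_car -> Prop;
  es_zero : es_car -> Prop }.

Definition es_nonzero k (X : extspace k) : Prop := exists E : X, ~ es_zero E.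

(* k-linear isomorphism: a k-linear map inducing a bijection on classes *)
Definition es_iso k (X Y : extspace k) : Prop :=
  exists F : X -> Y,
    [/\ forall E E', es_eqv E E' <-> es_eqv (F E) (F E'),
        forall E', exists E, es_eqv (F E) E',
        forall E1 E2 E, es_add E1 E2 E -> es_add (F E1) (F E2) (F E) &
        forall a E E', es_scale a E E' -> es_scale a (F E) (F E')].

Section Yoneda.
(* A is regarded as a k-algebra through iota. *)
Variables (k : Type) (A : pzRingType) (iota : k -> A).

(* 0 -> N -> ext_mid -> M -> 0 *)
Record extension (M N : lmodType A) := Extension {
  ext_mid : lmodType A;
  ext_inc : {linear N -> ext_mid};
  ext_prj : {linear ext_mid -> M};
  ext_inj : injective ext_inc;
  ext_surj : forall x, exists e, ext_prj e = x;
  ext_exact : forall e, ext_prj e = 0 <-> exists y, ext_inc y = e }.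

Section Ungraded.
Variables M N : lmodType A.
Implicit Types E : extension M N.

(* f is a morphism of extensions that is g on N and the identity on M. *)
Definition ext_map E E' (g : N -> N) (f : ext_mid E -> ext_mid E') : Prop :=
  (forall y, f (ext_inc E y) = ext_inc E' (g y)) /\
  (forall e, ext_prj E' (f e) = ext_prj E e).

Definition ext_eqv E E' : Prop :=
  exists f : {linear ext_mid E -> ext_mid E'}, ext_map id f.

(* E' is the pushout of E along multiplication by a on N. *)
Definition ext_scale (a : k) E E' : Prop :=
  exists f : {linear ext_mid E -> ext_mid E'}, ext_map (fun y => iota a *: y) f.

(* The elements of the pullback of E1 and E2 over M *)
Definition ext_pull E1 E2 (x : ext_mid E1 * ext_mid E2) : Prop :=
  ext_prj E1 x.1 = ext_prj E2 x.2.

(* f is a morphism from the pullback of E1 and E2 over M, an extension of M by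
   N x N, to the extension E, that is y1 + y2 on N x N and the identity on M;
   it exhibits E as the Baer sum of E1 and E2. Its values outside the pullback
   are irrelevant. *)
Definition ext_baer_map E1 E2 E (f : ext_mid E1 * ext_mid E2 -> ext_mid E) : Prop :=
  [/\ forall a x y, ext_pull x -> ext_pull y -> f (a *: x + y) = a *: f x + f y,
      forall y1 y2, f (ext_inc E1 y1, ext_inc E2 y2) = ext_inc E (y1 + y2) &
      forall x, ext_pull x -> ext_prj E (f x) = ext_prj E1 x.1].

Definition ext_add E1 E2 E : Prop := exists f, @ext_baer_map E1 E2 E f.

Definition ext_split E : Prop :=
  exists s : {linear M -> ext_mid E}, forall x, ext_prj E (s x) = x.

Definition Ext1 : extspace k := ExtSpace ext_eqv ext_add ext_scale ext_split.

End Ungraded.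

Section Graded.
(* [hom r] is the homogeneous component of degree r of A. *)
Variable hom : int -> A -> Prop.

Record grading (V : lmodType A) := Grading {
  gr_comp :> int -> V -> Prop;
  gr_0 : forall r, gr_comp r 0;
  gr_sub : forall r u v, gr_comp r u -> gr_comp r v -> gr_comp r (u - v);
  gr_act : forall i r a v, hom i a -> gr_comp r v -> gr_comp (i + r) (a *: v);
  gr_dec : forall v, exists (s : seq int) (f : int -> V),
    [/\ uniq s, forall r, gr_comp r (f r) & v = \sum_(r <- s) f r];
  gr_dir : forall (s : seq int) (f : int -> V), uniq s ->
    (forall r, gr_comp r (f r)) -> \sum_(r <- s) f r = 0 ->
    forall r, r \in s -> f r = 0 }.

Record gmod := GMod { gmod_car :> lmodType A; gmod_gr : grading gmod_car }.

Section Shift.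
Variables (q : int) (V : gmod).

Let comp (r : int) (v : V) : Prop := gmod_gr V (r - q) v.

Fact gshift_act i r a v : hom i a -> comp r v -> comp (i + r) (a *: v).
Proof. by rewrite /comp -addrA; apply: gr_act. Qed.

Fact gshift_dec v : exists (s : seq int) (f : int -> V),
  [/\ uniq s, forall r, comp r (f r) & v = \sum_(r <- s) f r].
Proof.
have [s [f [us hf ->]]] := gr_dec (gmod_gr V) v.
exists [seq r + q | r <- s], (fun r => f (r - q)); split=> [|r|].
- by rewrite map_inj_uniq //; apply: addIr.
- exact: hf.
- by rewrite big_map; apply: eq_bigr => r _; rewrite addrK.
Qed.

Fact gshift_dir (s : seq int) (f : int -> V) : uniq s ->
  (forall r, comp r (f r)) -> \sum_(r <- s) f r = 0 -> forall r, r \in s -> f r = 0.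
Proof.
move=> us hf sf r rs.
have := @gr_dir _ (gmod_gr V) [seq r - q | r <- s] (fun r => f (r + q)) _ _ _ (r - q).
rewrite subrK; apply.
- by rewrite map_inj_uniq //; apply: addIr.
- by move=> i; have := hf (i + q); rewrite /comp addrK.
- by rewrite big_map -[RHS]sf; apply: eq_bigr => i _; rewrite subrK.
- exact: map_f.
Qed.

Definition gshift : gmod :=
  @GMod V (@Grading V comp (fun r => gr_0 _ _) (fun r u v => @gr_sub _ _ _ u v)
    gshift_act gshift_dec gshift_dir).

End Shift.

Variables M N : gmod.

Record gextension := GExtension {
  gext :> extension M N;
  gext_gr : grading (ext_mid gext);
  gext_inc_deg : forall r y, gmod_gr N r y -> gext_gr r (ext_inc gext y);
  gext_prj_deg : forall r e, gext_gr r e -> gmod_gr M r (ext_prj gext e) }.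

Implicit Types E : gextension.

Definition gext_eqv E E' : Prop :=
  exists f : {linear ext_mid E -> ext_mid E'},
    ext_map id f /\ forall r e, gext_gr E r e -> gext_gr E' r (f e).

Definition gext_scale (a : k) E E' : Prop :=
  exists f : {linear ext_mid E -> ext_mid E'},
    ext_map (fun y => iota a *: y) f /\
    forall r e, gext_gr E r e -> gext_gr E' r (f e).

Definition gext_add E1 E2 E : Prop :=
  exists f, @ext_baer_map M N E1 E2 E f /\
    forall r x, ext_pull x -> gext_gr E1 r x.1 -> gext_gr E2 r x.2 ->
      gext_gr E r (f x).

Definition gext_split E : Prop :=
  exists s : {linear M -> ext_mid E},
    (forall x, ext_prj E (s x) = x) /\
    forall r x, gmod_gr M r x -> gext_gr E r (s x).

Definition gExt1 : extspace k := ExtSpace gext_eqv gext_add gext_scale gext_split.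

End Graded.
End Yoneda.

Definition simple_module (A : pzRingType) (V : lmodType A) : Prop :=
  (exists v : V, v <> 0) /\
  forall U : V -> Prop, U 0 -> (forall a u v, U u -> U v -> U (a *: u + v)) ->
    (forall v, U v -> v = 0) \/ (forall v, U v).

Definition weight m := {ffun 'I_m -> nat}.

Definition is_part m d (la : weight m) : Prop :=
  (\sum_i la i)%N = d /\ forall i j : 'I_m, (i <= j)%N -> (la j <= la i)%N.

Definition content m d (r : mword m d) : weight m :=
  [ffun i => #|[set a | r a == i]|].

Definition dominated m (al la : weight m) : Prop :=
  forall t : nat, (\sum_(i < m | i < t) al i <= \sum_(i < m | i < t) la i)%N.

(* The weight space of weight content r of V is xi_{r,r} V. *)
Definition is_weight (k : fieldType) m d (V : lmodType (schur k m d)) (al : weight m) : Prop :=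
  exists r : mword m d, content r = al /\ exists v : V, schur_xi k r r *: v <> 0.

(* V is L(la). *)
Definition is_irr (k : fieldType) m d (V : lmodType (schur k m d)) (la : weight m) : Prop :=
  [/\ simple_module V, is_weight V la & forall al, is_weight V al -> dominated al la].

(* Maps multilinear over k out of a product of S(m,dd_j)-modules; k acts on the
   target by sc. *)
Definition multilinear (k : fieldType) n m (dd : 'I_n -> nat)
    (L : forall j, lmodType (schur k m (dd j))) (W : zmodType) (sc : k -> W -> W)
    (t : (forall j, L j) -> W) : Prop :=
  forall j (a : k) (v v1 v2 : forall j, L j),
    (forall i, i != j -> v1 i = v i /\ v2 i = v i) ->
    v j = schur_scal m (dd j) a *: v1 j + v2 j -> t v = sc a (t v1) + t v2.

Section Box.
Variables (k : fieldType) (n m d : nat) (dd : 'I_n -> nat).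
Variable L : forall j, lmodType (schur k m (dd j)).

(* t exhibits V as the tensor product over k of the L j. *)
Definition is_tensor (V : lmodType (tzschur k n m d)) (t : (forall j, L j) -> V) : Prop :=
  multilinear (fun a v => tz_scal n m d a *: v) t /\
  forall (W : lmodType k) (f : (forall j, L j) -> W), multilinear (fun a w => a *: w) f ->
    exists g : V -> W,
      [/\ forall a x y, g (tz_scal n m d a *: x + y) = a *: g x + g y,
          forall v, g (t v) = f v &
          forall g' : V -> W,
            (forall a x y, g' (tz_scal n m d a *: x + y) = a *: g' x + g' y) ->
            (forall v, g' (t v) = f v) -> forall x, g' x = g x].

(* The concatenation of the letters (e_j, r^j_a, t^j_a) over all j and a *)
Definition econcat (r t : forall j, mword m (dd j)) : seq (letter n m) :=
  flatten [seq [seq (Ze j, r j a, t j a) | a <- enum 'I_(dd j)] | j <- enum 'I_n].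

(* The graded T^Z(m,d)-module V is concentrated in degree 0 and is the inflation
   of the outer tensor product of the L j. An admissible word containing exactly
   dd j letters e_j for each j has no other letter, since the dd j add up to d;
   all other eta_w, which are of positive degree or in another summand of the
   degree 0 part, act by zero. *)
Definition is_box (V : gmod (@tz_homog k n m d)) : Prop :=
  (forall x, gmod_gr V 0 x) /\
  exists t : (forall j, L j) -> V,
    [/\ is_tensor t,
        forall (r q : forall j, mword m (dd j)) (w : word n m d),
          codom w = econcat r q ->
          forall v, tz_eta k w *: t v = t (fun j => schur_xi k (r j) (q j) *: v j) &
        forall w : word n m d, admissible w ->
          (exists j, #|[set a | (w a).1.1 == Ze j]| != dd j) ->
          forall x : V, tz_eta k w *: x = 0].

End Box.

(* Main.v *)
From HB Require Import structures.
Require Import Defs.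
From mathcomp Require Import all_boot all_order all_fingroup all_algebra.
From Stdlib Require Import ClassicalEpsilon FunctionalExtensionality.

Set Implicit Arguments.
Unset Strict Implicit.
Unset Printing Implicit Defensive.

Import Order.TTheory GRing.Theory Num.Theory.
Local Open Scope ring_scope.

(** Write A for the algebra T^Z(m,d) over k, and let E be a nonsplit graded
    extension of M = L(lambda), which lives in degree 0, by N = q^s L(mu), which
    lives in degree s.

    Suppose that s is not 0. The degree 0 part of E maps onto M, so it would be a
    complement of N if it were a submodule. Hence some eta_w of degree s maps it
    nontrivially to N. Since m >= d, there are enough matrix indices to write every
    eta_w of degree at least 2, up to sign, as a product of two such elements of
    positive degree ([eta_factor], [eta_decomp]); one of the factors then acts
    by zero for reasons of degree, unless s = 1 ([gext_nonsplit_degree]). In that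
    case w has a single arrow as a letter, and all its other letters are vertex
    idempotents. Counting the sources and the targets of its letters compares the
    compositions (d_j) and (c_j) and gives condition (ii) ([nonzero_counts],
    [degree1_counts]).

    Suppose that s = 0. Then elements of positive degree act by zero on E, and what
    is left of A are the coefficients of an element at the tensors of letters
    e_j, which multiply like matrices ([evM]). The coefficients that belong to the
    composition (d_j) describe the tensor product of the Schur algebras S(m,d_j):
    [theta] lifts families of elements of the factors to A. If (c_j) differs from
    (d_j), an idempotent splits E ([ext_split_content]). If lambda and mu differ at
    two vertices, then two commuting elements from different factors separate M
    from N, and E splits too ([ext_split_two]). Otherwise lambda and mu agree
    except at one vertex j. Let e be the product of the weight idempotents of
    lambda^(i) in the factors i other than j. The functor V |-> eV is then an
    equivalence from a class of A-modules that contains M, N and their extensions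
    to S(m,d_j)-modules, and it sends M and N to L(lambda^(j)) and L(mu^(j)). So it
    identifies the extension spaces ([corner_gext_iso], [box_truncation]).

    The equivalence has two ingredients. For words i, j of weight lambda the
    product xi_{i,l} xi_{l,j} with l = min(i, j) is triangular, so that the
    weight algebra of lambda acts by scalars on modules with no weights above
    lambda ([schur_weight_scalar]), and hence e A e acts through S(m,d_j). The
    identity of L(lambda^(i)) factors through its highest weight line
    ([irr_resolution]), so V = AeV. Both facts pass to extensions
    ([ext_truncatable]). *)

(** * Truncation at an idempotent *)

Section LinearMaps.
Variables (A : pzRingType) (V W : lmodType A).

Definition lin_of (f : V -> W) (fl : linear f) : {linear V -> W} :=
  HB.pack f (GRing.isLinear.Build A V W *:%R f fl).

Lemma linear_split (f : V -> W) :
  {morph f : x y / x + y} -> (forall a x, f (a *: x) = a *: f x) -> linear f.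
Proof. by move=> fD fZ a x y; rewrite fD fZ. Qed.

(** A linear relation that is total and single valued is the graph of a linear
    map; the value is picked by classical choice. *)
Lemma linear_of_graph (G : V -> W -> Prop) :
  (forall x, exists y, G x y) -> (forall y, G 0 y -> y = 0) ->
  (forall a x x' y y', G x y -> G x' y' -> G (a *: x + x') (a *: y + y')) ->
  exists f : {linear V -> W}, forall x, G x (f x).
Proof.
move=> tot func lin.
pose f x := proj1_sig (constructive_indefinite_description _ (tot x)).
have fG x : G x (f x) by rewrite /f; case: constructive_indefinite_description.
have uniq x y y' : G x y -> G x y' -> y = y'.
  move=> h h'; apply/eqP; rewrite -subr_eq0; apply/eqP/func.
  by have := lin (-1) _ _ _ _ h' h; rewrite !scaleN1r addNr addrC.
have flin : linear f.
  by move=> a x y; apply: uniq (fG _) _; apply: lin; apply: fG.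
by exists (lin_of flin).
Qed.

End LinearMaps.

(** An equivalence between modules over A and modules over S induced by the
    idempotent e = tr_in 1 of A, in the form of a Morita context: tr_in embeds S
    in the corner eAe, tr_out retracts the corner, in the guise a |-> eae, onto S,
    and the elements sum_c tr_l c * e * tr_r c act as the identity. All the
    identities that involve tr_in hold on suitable modules only, see
    [truncatable]. *)
Record truncation (k : Type) (A S : pzRingType) (iA : k -> A) (iS : k -> S) := Truncation {
  tr_in : S -> A;
  tr_out : A -> S;
  tr_ix : finType;
  tr_l : tr_ix -> A;
  tr_r : tr_ix -> A;
  tr_outD : forall x y, tr_out (x + y) = tr_out x + tr_out y;
  tr_out1 : tr_out 1 = 1;
  tr_out_in : forall x s y, tr_out (x * tr_in s * y) = tr_out x * s * tr_out y;
  tr_out_res : forall x y, \sum_c tr_out (x * tr_l c) * tr_out (tr_r c * y) = tr_out (x * y);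
  tr_out_scal : forall c x, tr_out (x * iA c) = tr_out x * iS c }.

Section Truncation.
Variables (k : Type) (A S : pzRingType) (iA : k -> A) (iS : k -> S).
Variable tr : truncation iA iS.

Local Notation e := (tr_in tr 1).
Local Notation In := (tr_in tr).
Local Notation Out := (tr_out tr).
Local Notation Ix := (tr_ix tr).
Local Notation tl := (@tr_l _ _ _ _ _ tr).
Local Notation rr := (@tr_r _ _ _ _ _ tr).

(** On these modules the relations of a Morita context hold, so that V = AeV is
    recovered from its corner eV. *)
Record truncatable (V : lmodType A) : Prop := Truncatable {
  trD : forall s s' (x : V), In (s + s') *: x = In s *: x + In s' *: x;
  trM : forall s s' (x : V), In (s * s') *: x = In s *: (In s' *: x);
  tr_res : forall x : V, \sum_c tl c *: (e *: (rr c *: x)) = x;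
  tr_corner : forall a (x : V), e *: (a *: (e *: x)) = In (Out a) *: x;
  tr_comm : forall c (x : V), e *: (iA c *: x) = iA c *: (e *: x) }.

Section Module.
Variables (V : lmodType A) (gV : truncatable V).

Lemma tr_ee (x : V) : e *: (e *: x) = e *: x.
Proof. by rewrite -(trM gV) mulr1. Qed.

Lemma tr_eIn s (x : V) : e *: (In s *: x) = In s *: x.
Proof. by rewrite -(trM gV) mul1r. Qed.

Lemma tr_Ine s (x : V) : In s *: (e *: x) = In s *: x.
Proof. by rewrite -(trM gV) mulr1. Qed.

Lemma tr_scal c (x : V) : In (iS c) *: x = iA c *: (e *: x).
Proof.
have -> : iS c = Out (iA c) by rewrite -[iA c]mul1r tr_out_scal tr_out1 mul1r.
by rewrite -(tr_corner gV) (tr_comm gV) tr_ee.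
Qed.

(** The corner eV, as a module over S. *)
Record corner (g : truncatable V) := Corner {
  corner_val : V;
  _ : e *: corner_val == corner_val }.

End Module.

Section Corner.
Variables (V : lmodType A) (gV : truncatable V).
Local Notation C := (corner gV).

HB.instance Definition _ := [isSub for @corner_val V gV].
HB.instance Definition _ := [Choice of C by <:].

Fact corner_zmod_closed : zmod_closed (fun x : V => e *: x == x).
Proof.
split=> [|x y /eqP hx /eqP hy]; first by rewrite unfold_in scaler0.
by rewrite unfold_in scalerBr hx hy.
Qed.

HB.instance Definition _ := GRing.SubChoice_isSubZmodule.Build V
  (fun x : V => e *: x == x) C corner_zmod_closed.

Lemma cornerD (u v : C) : val (u + v) = val u + val v.
Proof. exact: raddfD. Qed.

Lemma cornerB (u v : C) : val (u - v) = val u - val v.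
Proof. exact: raddfB. Qed.

Lemma corner0 : val (0 : C) = 0.
Proof. exact: raddf0. Qed.

Lemma cornerP (u : C) : e *: val u = val u.
Proof. exact/eqP/(valP u). Qed.

Fact to_corner_subproof (x : V) : e *: (e *: x) == e *: x.
Proof. by rewrite tr_ee. Qed.

Definition to_corner (x : V) : C := Corner gV (to_corner_subproof x).

Lemma to_cornerE x : val (to_corner x) = e *: x.
Proof. exact: SubK. Qed.

Definition corner_scale (s : S) (u : C) : C := to_corner (In s *: val u).

Lemma corner_scaleE s u : val (corner_scale s u) = In s *: val u.
Proof. by rewrite to_cornerE tr_eIn. Qed.

Fact corner_scaleA s s' u : corner_scale s (corner_scale s' u) = corner_scale (s * s') u.
Proof. by apply: val_inj; rewrite !corner_scaleE (trM gV). Qed.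

Fact corner_scale1 : left_id 1 corner_scale.
Proof. by move=> u; apply: val_inj; rewrite corner_scaleE cornerP. Qed.

Fact corner_scaleDr : right_distributive corner_scale +%R.
Proof.
by move=> s u v; apply: val_inj; rewrite cornerD !corner_scaleE cornerD scalerDr.
Qed.

Fact corner_scaleDl u : {morph corner_scale^~ u : s s' / s + s'}.
Proof.
by move=> s s'; apply: val_inj; rewrite cornerD !corner_scaleE (trD gV).
Qed.

HB.instance Definition _ := GRing.Zmodule_isLmodule.Build S C
  corner_scaleA corner_scale1 corner_scaleDr corner_scaleDl.

Lemma cornerZ s (u : C) : val (s *: u) = In s *: val u.
Proof. exact: corner_scaleE. Qed.

End Corner.

(** Since V = AeV, a map between corners that commutes with S extends to the
    whole modules. *)
Lemma corner_full (V V' : lmodType A) (gV : truncatable V) (gV' : truncatable V')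
    (f : {linear corner gV -> corner gV'}) :
  exists g : {linear V -> V'}, forall u, g (val u) = val (f u).
Proof.
pose g (x : V) : V' := \sum_c tl c *: val (f (to_corner gV (rr c *: x))).
have tcD : zmod_morphism (to_corner gV).
  by move=> x y; apply: val_inj; rewrite cornerB !to_cornerE scalerBr.
have ga : zmod_morphism g.
  move=> x y; rewrite -sumrB; apply: eq_bigr => c _.
  by rewrite scalerBr tcD linearB cornerB scalerBr.
have tcsum (J : finType) (F : J -> V) :
    to_corner gV (\sum_j F j) = \sum_j to_corner gV (F j).
  apply: (big_morph (to_corner gV)) => [x y|].
    by apply: val_inj; rewrite cornerD !to_cornerE scalerDr.
  by apply: val_inj; rewrite to_cornerE scaler0 corner0.
have valsum (J : finType) (F : J -> corner gV') : val (\sum_j F j) = \sum_j val (F j).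
  by apply: (big_morph val) => [x y|]; rewrite ?cornerD ?corner0.
have tcA a (u : V) : to_corner gV (a *: (e *: u)) = Out a *: to_corner gV u.
  by apply: val_inj; rewrite cornerZ !to_cornerE (tr_corner gV) tr_Ine.
have gs : scalable g.
  move=> a x; rewrite /g.
  transitivity (\sum_c \sum_d tl c *: (e *: (rr c * a * tl d *: val (f (to_corner gV (rr d *: x)))))).
    apply: eq_bigr => c _; rewrite -{1}(tr_res gV x) !scaler_sumr tcsum linear_sum valsum.
    rewrite scaler_sumr; apply: eq_bigr => d _; congr (_ *: _).
    rewrite 2!scalerA tcA linearZ cornerZ -(tr_corner gV').
    by rewrite cornerP.
  rewrite exchange_big scaler_sumr; apply: eq_bigr => d _.
  set y := val _; rewrite [RHS]scalerA -[RHS](tr_res gV').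
  by apply: eq_bigr => c _; rewrite (scalerA (rr c)) mulrA.
have gD : {morph g : x y / x + y} by move=> x y; apply: (addIr (- g y)); rewrite -ga !addrK.
exists (lin_of (linear_split gD gs)) => u; rewrite /= /g -[RHS](tr_res gV').
apply: eq_bigr => c _; congr (_ *: _).
rewrite -[in RHS](cornerP (f u)) (tr_corner gV') -cornerZ -linearZ_LR; congr (val (f _)).
by apply: val_inj; rewrite to_cornerE cornerZ -[in LHS](cornerP u) (tr_corner gV).
Qed.

Lemma corner_faithful (V V' : lmodType A) (gV : truncatable V) (g h : {linear V -> V'}) :
  (forall u : corner gV, g (val u) = h (val u)) -> g =1 h.
Proof.
move=> gh x; rewrite -(tr_res gV x) !linear_sum; apply: eq_bigr => c _.
by rewrite (linearZ_LR g) (linearZ_LR h) -(to_cornerE gV) gh.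
Qed.

End Truncation.

(** * Induction from the corner *)

Section Induction.
Variables (k : Type) (A S : pzRingType) (iA : k -> A) (iS : k -> S).
Variable tr : truncation iA iS.

Local Notation e := (tr_in tr 1).
Local Notation In := (tr_in tr).
Local Notation Out := (tr_out tr).
Local Notation Ix := (tr_ix tr).
Local Notation tl := (@tr_l _ _ _ _ _ tr).
Local Notation rr := (@tr_r _ _ _ _ _ tr).

Section Mat.
Variable X : lmodType S.
Implicit Types f g : {ffun Ix -> X}.

(** a |-> (tr_out (tr_r d * a * tr_l c))_(d, c) is multiplicative and additive,
    but sends 1 to an idempotent matrix only: its fixed vectors form the A-module
    whose corner is X. *)
Definition tr_mat (a : A) f : {ffun Ix -> X} :=
  [ffun d => \sum_c Out (rr d * a * tl c) *: f c].

Lemma tr_matM a b f : tr_mat a (tr_mat b f) = tr_mat (a * b) f.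
Proof.
apply/ffunP => d; rewrite !ffunE.
under eq_bigr => c _ do rewrite ffunE scaler_sumr.
rewrite exchange_big; apply: eq_bigr => c _ /=.
under eq_bigr => i _ do rewrite scalerA -mulrA.
rewrite -scaler_suml; congr (_ *: _).
under eq_bigr => i _ do rewrite mulrA -(mulrA _ b).
by rewrite tr_out_res !mulrA.
Qed.

Lemma tr_matDr a f g : tr_mat a (f + g) = tr_mat a f + tr_mat a g.
Proof.
apply/ffunP => d; rewrite !ffunE -big_split; apply: eq_bigr => c _.
by rewrite !ffunE scalerDr.
Qed.

Lemma tr_matBr a f g : tr_mat a (f - g) = tr_mat a f - tr_mat a g.
Proof. by apply: (addIr (tr_mat a g)); rewrite -tr_matDr !subrK. Qed.

Lemma tr_matDl a b f : tr_mat (a + b) f = tr_mat a f + tr_mat b f.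
Proof.
apply/ffunP => d; rewrite !ffunE -big_split; apply: eq_bigr => c _.
by rewrite mulrDr mulrDl tr_outD scalerDl.
Qed.

Record induced := Induced {
  induced_val : {ffun Ix -> X};
  _ : tr_mat 1 induced_val == induced_val }.

HB.instance Definition _ := [isSub for induced_val].
HB.instance Definition _ := [Choice of induced by <:].

Fact induced_zmod_closed : zmod_closed (fun f => tr_mat 1 f == f).
Proof.
split=> [|f g /eqP hf /eqP hg]; last by rewrite unfold_in tr_matBr hf hg.
by rewrite unfold_in; have := tr_matBr 1 0 0; rewrite !subrr => ->.
Qed.

HB.instance Definition _ := GRing.SubChoice_isSubZmodule.Build {ffun Ix -> X}
  (fun f => tr_mat 1 f == f) induced induced_zmod_closed.

Lemma inducedP (u : induced) : tr_mat 1 (val u) = val u.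
Proof. exact/eqP/(valP u). Qed.

Fact to_induced_subproof a f : tr_mat 1 (tr_mat a f) == tr_mat a f.
Proof. by rewrite tr_matM mul1r. Qed.

Definition to_induced a f : induced := Induced (to_induced_subproof a f).

Definition induced_scale (a : A) (u : induced) : induced := to_induced a (val u).

Lemma induced_scaleE a u : val (induced_scale a u) = tr_mat a (val u).
Proof. by []. Qed.

Lemma inducedD (u v : induced) : val (u + v) = val u + val v.
Proof. exact: raddfD. Qed.

Lemma induced0 : val (0 : induced) = 0.
Proof. exact: raddf0. Qed.

Fact induced_scaleA a b u : induced_scale a (induced_scale b u) = induced_scale (a * b) u.
Proof. by apply: val_inj; rewrite !induced_scaleE tr_matM. Qed.

Fact induced_scale1 : left_id 1 induced_scale.
Proof. by move=> u; apply: val_inj; rewrite induced_scaleE inducedP. Qed.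

Fact induced_scaleDr : right_distributive induced_scale +%R.
Proof.
by move=> a u v; apply: val_inj; rewrite inducedD !induced_scaleE inducedD tr_matDr.
Qed.

Fact induced_scaleDl u : {morph induced_scale^~ u : a b / a + b}.
Proof. by move=> a b; apply: val_inj; rewrite inducedD !induced_scaleE tr_matDl. Qed.

HB.instance Definition _ := GRing.Zmodule_isLmodule.Build A induced
  induced_scaleA induced_scale1 induced_scaleDr induced_scaleDl.

Lemma inducedZ a (u : induced) : val (a *: u) = tr_mat a (val u).
Proof. by []. Qed.

Lemma inducedE (u : induced) d : val u d = \sum_c Out (rr d * tl c) *: val u c.
Proof.
rewrite -[in LHS](inducedP u) ffunE; apply: eq_bigr => c _.
by rewrite mulr1.
Qed.

(** The component of an element in its corner *)
Definition induced_out (u : induced) : X := \sum_c Out (tl c) *: val u c.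

Lemma tr_mat_In a s b f d : tr_mat (a * In s * b) f d =
  Out (rr d * a) *: (s *: \sum_c Out (b * tl c) *: f c).
Proof.
rewrite ffunE !scaler_sumr; apply: eq_bigr => c _.
by rewrite !mulrA -(mulrA _ b) tr_out_in !scalerA.
Qed.

Lemma tr_InE s (u : induced) d : val (In s *: u) d = Out (rr d) *: (s *: induced_out u).
Proof.
rewrite inducedZ -[In s]mulr1 -[In s]mul1r tr_mat_In mulr1.
by under eq_bigr => c _ do rewrite mul1r.
Qed.

Lemma sum_out_lr : \sum_c Out (tl c) * Out (rr c) = 1.
Proof.
rewrite -(tr_out1 tr) -[1 in RHS]mulr1 -tr_out_res.
by apply: eq_bigr => c _; rewrite mul1r mulr1.
Qed.

Lemma induced_out_In s (u : induced) : induced_out (In s *: u) = s *: induced_out u.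
Proof.
rewrite {1}/induced_out; under eq_bigr => c _ do rewrite tr_InE scalerA.
by rewrite -scaler_suml sum_out_lr scale1r.
Qed.

Lemma induced_outD (u v : induced) : induced_out (u + v) = induced_out u + induced_out v.
Proof.
rewrite /induced_out -big_split; apply: eq_bigr => c _.
by rewrite inducedD !ffunE scalerDr.
Qed.

End Mat.
End Induction.

(** * Extensions and truncation *)

Lemma ext_prj_inc (A : pzRingType) (M N : lmodType A) (E : extension M N) y :
  ext_prj E (ext_inc E y) = 0.
Proof. by apply/ext_exact; exists y. Qed.

Section CornerExtensions.
Variables (k : Type) (A S : pzRingType) (iA : k -> A) (iS : k -> S).
Variable tr : truncation iA iS.

Local Notation e := (tr_in tr 1).
Local Notation In := (tr_in tr).
Local Notation Out := (tr_out tr).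
Local Notation Ix := (tr_ix tr).
Local Notation tl := (@tr_l _ _ _ _ _ tr).
Local Notation rr := (@tr_r _ _ _ _ _ tr).

(** An identification of M' with the corner of M *)
Record corner_iso (M : lmodType A) (M' : lmodType S) := CornerIso {
  ci_in : M' -> M;
  ci_out : M -> M';
  ci_inD : {morph ci_in : x y / x + y};
  ci_inZ : forall s x, ci_in (s *: x) = In s *: ci_in x;
  ci_inK : cancel ci_in ci_out;
  ci_outK : forall x, ci_in (ci_out x) = e *: x }.

Section CornerIsoTheory.
Variables (M : lmodType A) (M' : lmodType S) (ci : corner_iso M M').
Hypothesis gM : truncatable tr M.

Lemma ci_in_inj : injective (ci_in ci).
Proof. exact: can_inj (ci_inK ci). Qed.

Lemma ci_e x : e *: ci_in ci x = ci_in ci x.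
Proof. by rewrite -ci_inZ scale1r. Qed.

Lemma ci_in0 : ci_in ci 0 = 0.
Proof. by apply: (addIr (ci_in ci 0)); rewrite -ci_inD !add0r. Qed.

Lemma ci_in_sum (J : finType) (F : J -> M') : ci_in ci (\sum_j F j) = \sum_j ci_in ci (F j).
Proof. exact: (big_morph _ (ci_inD ci) ci_in0). Qed.

Lemma ci_outD : {morph ci_out ci : x y / x + y}.
Proof. by move=> x y; apply: ci_in_inj; rewrite ci_inD !ci_outK scalerDr. Qed.

Lemma ci_out0 : ci_out ci 0 = 0.
Proof. by apply: (addIr (ci_out ci 0)); rewrite -ci_outD !add0r. Qed.

Lemma ci_out_e a x : ci_out ci (a *: (e *: x)) = Out a *: ci_out ci x.
Proof. by apply: ci_in_inj; rewrite ci_inZ !ci_outK (tr_corner gM) (tr_Ine gM). Qed.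

Lemma ci_out_in a y : ci_out ci (a *: ci_in ci y) = Out a *: y.
Proof. by rewrite -ci_e ci_out_e ci_inK. Qed.

Lemma ci_out_corner s (u : corner gM) : ci_out ci (val (s *: u)) = s *: ci_out ci (val u).
Proof. by apply: ci_in_inj; rewrite cornerZ ci_inZ !ci_outK (tr_eIn gM) (tr_Ine gM). Qed.

End CornerIsoTheory.

Lemma corner_restrict (V V' : lmodType A) (gV : truncatable tr V) (gV' : truncatable tr V')
    (f : {linear V -> V'}) :
  exists f' : {linear corner gV -> corner gV'}, forall u, val (f' u) = f (val u).
Proof.
pose f' (u : corner gV) := to_corner gV' (f (val u)).
have fE u : val (f' u) = f (val u) by rewrite to_cornerE -linearZ_LR cornerP.
have fl : linear f'.
  move=> s u v; apply: val_inj.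
  by rewrite fE !cornerD !cornerZ !fE linearD linearZ_LR.
by exists (lin_of fl).
Qed.

Variables (M N : lmodType A) (M' N' : lmodType S).
Hypotheses (gM : truncatable tr M) (gN : truncatable tr N).
Variables (cM : corner_iso M M') (cN : corner_iso N N').

Section Corner.
Variables (E : extension M N) (gE : truncatable tr (ext_mid E)).

Definition corner_inc (y : N') : corner gE := to_corner gE (ext_inc E (ci_in cN y)).
Definition corner_prj (u : corner gE) : M' := ci_out cM (ext_prj E (val u)).

Lemma corner_incE y : val (corner_inc y) = ext_inc E (ci_in cN y).
Proof. by rewrite to_cornerE -linearZ_LR ci_e. Qed.

Lemma corner_prjE u : ci_in cM (corner_prj u) = ext_prj E (val u).
Proof. by rewrite ci_outK -linearZ_LR cornerP. Qed.

Fact corner_inc_linear : linear corner_inc.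
Proof.
move=> s y y'; apply: val_inj.
by rewrite cornerD cornerZ !corner_incE ci_inD ci_inZ linearD linearZ_LR.
Qed.

Fact corner_prj_linear : linear corner_prj.
Proof.
move=> s u u'; apply: (ci_in_inj (ci := cM)).
by rewrite ci_inD ci_inZ !corner_prjE cornerD cornerZ linearD linearZ_LR.
Qed.

Fact corner_ext_inj : injective (lin_of corner_inc_linear).
Proof.
move=> y y' /(congr1 val); rewrite !corner_incE.
by move/(@ext_inj _ _ _ E)/ci_in_inj.
Qed.

Fact corner_ext_surj x : exists u, lin_of corner_prj_linear u = x.
Proof.
have [z hz] := ext_surj E (ci_in cM x).
exists (to_corner gE z); apply: (ci_in_inj (ci := cM)).
by rewrite corner_prjE to_cornerE linearZ_LR hz ci_e.
Qed.

Fact corner_ext_exact u :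
  lin_of corner_prj_linear u = 0 <-> exists y, lin_of corner_inc_linear y = u.
Proof.
split=> [h|[y <-]]; last first.
  apply: (ci_in_inj (ci := cM)); rewrite corner_prjE corner_incE ci_in0.
  by apply/ext_exact; exists (ci_in cN y).
have /ext_exact[y hy] : ext_prj E (val u) = 0 by rewrite -corner_prjE (h : corner_prj u = 0) ci_in0.
exists (ci_out cN y); apply: val_inj.
by rewrite corner_incE ci_outK linearZ_LR hy cornerP.
Qed.

Definition corner_ext : extension M' N' :=
  Extension corner_ext_inj corner_ext_surj corner_ext_exact.

End Corner.

(** A morphism of extensions is determined by its restriction to the corners, and
    every morphism between the corners extends. *)
Lemma corner_ext_eqv E E' (gE : truncatable tr (ext_mid E)) (gE' : truncatable tr (ext_mid E')) :
  ext_eqv E E' <-> ext_eqv (corner_ext gE) (corner_ext gE').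
Proof.
split=> [[f [fi fp]]|[f [fi fp]]].
  have [f' fE] := corner_restrict gE gE' f.
  exists f'; split=> [y|u]; last first.
    by apply: (ci_in_inj (ci := cM)); rewrite !corner_prjE fE fp.
  by apply: val_inj; rewrite fE !corner_incE fi.
have [g hg] := corner_full f.
exists g; split=> [y|x].
  move: y; apply: (@corner_faithful _ _ _ _ _ tr _ _ gN (g \o ext_inc E) (ext_inc E')) => u /=.
  rewrite -[X in ext_inc E X](cornerP u) -[X in ext_inc E' X](cornerP u).
  rewrite -(ci_outK cN) -(corner_incE gE) hg -(corner_incE gE').
  by rewrite -[RHS]/(val (ext_inc (corner_ext gE') _)) -fi.
move: x; apply: (@corner_faithful _ _ _ _ _ tr _ _ gE (ext_prj E' \o g) (ext_prj E)) => u /=.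
by rewrite hg -!corner_prjE; congr (ci_in _ _); apply: fp.
Qed.

Lemma corner_ext_scale a E E' (gE : truncatable tr (ext_mid E))
    (gE' : truncatable tr (ext_mid E')) :
  ext_scale iA a E E' -> ext_scale iS a (corner_ext gE) (corner_ext gE').
Proof.
move=> [f [fi fp]]; have [f' fE] := corner_restrict gE gE' f.
exists f'; split=> [y|u]; last first.
  by apply: (ci_in_inj (ci := cM)); rewrite !corner_prjE fE fp.
by apply: val_inj; rewrite fE !corner_incE fi ci_inZ (tr_scal gN) ci_e.
Qed.

Lemma corner_ext_add E1 E2 E (g1 : truncatable tr (ext_mid E1))
    (g2 : truncatable tr (ext_mid E2)) (g : truncatable tr (ext_mid E)) :
  ext_add E1 E2 E -> ext_add (corner_ext g1) (corner_ext g2) (corner_ext g).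
Proof.
move=> [f [fl fi fp]].
pose F (u : corner g1 * corner g2) := to_corner g (f (val u.1, val u.2)).
exists F.
have pullE (u : corner g1 * corner g2) : @ext_pull _ _ _ (corner_ext g1) (corner_ext g2) u ->
    @ext_pull _ _ _ E1 E2 (val u.1, val u.2).
  by move=> h; rewrite /ext_pull /= -!corner_prjE; congr (ci_in _ _).
have pull0 : @ext_pull _ _ _ E1 E2 0 by rewrite /ext_pull !linear0.
have f0 : f 0 = 0.
  have := fl 1 0 0 pull0 pull0; rewrite !scale1r addr0 => h.
  by apply: (addIr (f 0)); rewrite add0r -h.
have fZ a x : @ext_pull _ _ _ E1 E2 x -> f (a *: x) = a *: f x.
  by move=> px; rewrite -[LHS](congr1 f (addr0 _)) fl // f0 addr0.
have fE u : @ext_pull _ _ _ (corner_ext g1) (corner_ext g2) u ->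
    val (F u) = f (val u.1, val u.2).
  move/pullE => pu; rewrite to_cornerE -fZ //; congr f.
  by rewrite /GRing.scale /= /scale_pair; congr pair; apply: cornerP.
split=> [s u v pu pv|y1 y2|u pu].
- apply: val_inj; rewrite cornerD cornerZ !fE //; last first.
    rewrite /ext_pull -[(s *: u + v).1]/(s *: u.1 + v.1) -[(s *: u + v).2]/(s *: u.2 + v.2).
    rewrite !linearP.
    by congr (_ *: _ + _); [apply: pu | apply: pv].
  rewrite -fl; try exact: pullE.
  congr f; rewrite -[(s *: u + v).1]/(s *: u.1 + v.1) -[(s *: u + v).2]/(s *: u.2 + v.2).
  by rewrite !cornerD !cornerZ.
- apply: val_inj; rewrite fE; last first.
    by rewrite /ext_pull !ext_prj_inc.
  rewrite -[(_, _).1]/(corner_inc g1 y1) -[(_, _).2]/(corner_inc g2 y2) !corner_incE fi.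
  by rewrite -ci_inD -corner_incE.
- by apply: (ci_in_inj (ci := cM)); rewrite !corner_prjE fE // fp //; apply: pullE.
Qed.

(** A section on the corner extends to M, where it is still a section because
    morphisms are determined on corners. *)
Lemma corner_ext_split E (gE : truncatable tr (ext_mid E)) :
  ext_split (corner_ext gE) -> ext_split E.
Proof.
move=> [s hs].
pose f (u : corner gM) := s (ci_out cM (val u)).
have fl : linear f.
  by move=> a u v; rewrite /f cornerD ci_outD ci_out_corner linearP.
have [g hg] := corner_full (lin_of fl); exists g.
apply: (@corner_faithful _ _ _ _ _ tr _ _ gM (ext_prj E \o g) idfun) => u /=.
by rewrite hg -corner_prjE -[corner_prj _]/(ext_prj (corner_ext gE) _) hs ci_outK cornerP.
Qed.

(** Essential surjectivity: the extension X of M' by N' is, up to equivalence,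
    the corner of an extension of M by N with middle term [induced X]. *)
Section InducedExtension.
Variable X : extension M' N'.
Local Notation IX := (induced tr (ext_mid X)).

Definition induced_inc (y : N) : IX :=
  to_induced 1 [ffun c => ext_inc X (ci_out cN (rr c *: y))].

Definition induced_prj (u : IX) : M :=
  \sum_c tl c *: ci_in cM (ext_prj X (val u c)).

(** The coordinates of an element of a truncatable module transform under A by
    the matrices [tr_mat]. *)
Lemma coord_mat a (P : lmodType A) (P' : lmodType S) (c : corner_iso P P')
    (gP : truncatable tr P) d (y : P) :
  ci_out c (rr d *: (a *: y)) = \sum_i Out (rr d * a * tl i) *: ci_out c (rr i *: y).
Proof.
rewrite -{1}(tr_res gP y) !scaler_sumr (big_morph _ (ci_outD c) (ci_out0 c)).
apply: eq_bigr => i _; rewrite 2!scalerA ci_out_e //.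
Qed.

Lemma sum_ci_in (P : lmodType A) (P' : lmodType S) (c : corner_iso P P')
    (gP : truncatable tr P) a (F : Ix -> P') :
  \sum_d tl d *: ci_in c (\sum_i Out (rr d * a * tl i) *: F i) =
  a *: \sum_i tl i *: ci_in c (F i).
Proof.
under eq_bigr => d _ do rewrite ci_in_sum scaler_sumr.
rewrite exchange_big scaler_sumr; apply: eq_bigr => i _ /=.
rewrite scalerA -[RHS](tr_res gP); apply: eq_bigr => d _; congr (_ *: _).
by rewrite ci_inZ -(tr_corner gP) ci_e (scalerA (rr d)) mulrA.
Qed.

Lemma induced_incE y d : val (induced_inc y) d = ext_inc X (ci_out cN (rr d *: y)).
Proof.
rewrite -[y in RHS]scale1r coord_mat // linear_sum ffunE; apply: eq_bigr => i _.
by rewrite ffunE linearZ_LR.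
Qed.

Fact induced_inc_linear : linear induced_inc.
Proof.
move=> a y y'; apply: val_inj; apply/ffunP => d.
rewrite inducedD inducedZ [RHS]ffunE [X in _ = X + _]ffunE !induced_incE scalerDr ci_outD linearD.
congr (_ + _); rewrite coord_mat // linear_sum; apply: eq_bigr => i _.
by rewrite induced_incE linearZ_LR.
Qed.

Fact induced_prj_linear : linear induced_prj.
Proof.
move=> a u v; rewrite /induced_prj -(sum_ci_in cM gM).
under eq_bigr => d _ do
  rewrite inducedD inducedZ ffunE linearD ci_inD scalerDr.
rewrite big_split; congr (_ + _); apply: eq_bigr => d _; congr (_ *: ci_in _ _).
by rewrite ffunE linear_sum; apply: eq_bigr => i _; rewrite linearZ_LR.
Qed.

Lemma ci_out_prj (u : IX) d : ci_out cM (rr d *: induced_prj u) = ext_prj X (val u d).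
Proof.
apply: (ci_in_inj (ci := cM)); rewrite ci_outK scaler_sumr scaler_sumr.
rewrite inducedE linear_sum ci_in_sum; apply: eq_bigr => c _.
by rewrite linearZ_LR ci_inZ -(tr_corner gM) ci_e (scalerA (rr d)).
Qed.

Fact induced_ext_inj : injective (lin_of induced_inc_linear).
Proof.
suff inj0 y : induced_inc y = 0 -> y = 0.
  move=> y y' h; apply/eqP; rewrite -subr_eq0; apply/eqP/inj0.
  by rewrite -[induced_inc _]/(lin_of induced_inc_linear _) linearB h subrr.
move=> h; rewrite -(tr_res gN y) big1 // => c _.
rewrite -(ci_outK cN) (_ : ci_out cN _ = 0) ?ci_in0 ?scaler0 //.
apply: (@ext_inj _ _ _ X); rewrite linear0 -induced_incE h induced0.
by rewrite ffunE.
Qed.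

Fact induced_ext_surj x : exists u, lin_of induced_prj_linear u = x.
Proof.
have /fin_all_exists[z hz] c : exists z, ext_prj X z = ci_out cM (rr c *: x).
  exact: ext_surj.
exists (to_induced 1 [ffun c => z c]).
rewrite /= /induced_prj -[RHS](tr_res gM); apply: eq_bigr => d _; congr (_ *: _).
rewrite -(ci_outK cM) -[x in RHS]scale1r coord_mat //; congr (ci_in _ _).
by rewrite ffunE linear_sum; apply: eq_bigr => c _; rewrite linearZ_LR ffunE hz.
Qed.

Fact induced_ext_exact u :
  lin_of induced_prj_linear u = 0 <-> exists y, lin_of induced_inc_linear y = u.
Proof.
split=> [h|[y <-]]; last first.
  rewrite /= /induced_prj big1 // => c _.
  by rewrite induced_incE ext_prj_inc ci_in0 scaler0.
have /fin_all_exists[n hn] c : exists n, ext_inc X n = val u c.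
  by apply/ext_exact; rewrite -ci_out_prj (h : induced_prj u = 0) scaler0 ci_out0.
exists (\sum_c tl c *: ci_in cN (n c)); apply: val_inj; apply/ffunP => d.
rewrite [LHS]induced_incE inducedE.
rewrite scaler_sumr (big_morph _ (ci_outD cN) (ci_out0 cN)) linear_sum.
by apply: eq_bigr => c _; rewrite scalerA ci_out_in // linearZ_LR hn.
Qed.

Definition induced_ext : extension M N :=
  Extension induced_ext_inj induced_ext_surj induced_ext_exact.

Lemma induced_extK (g : truncatable tr (ext_mid induced_ext)) :
  ext_eqv (corner_ext g) X.
Proof.
pose f (u : corner g) : ext_mid X := induced_out (val u).
have fl : linear f.
  by move=> s u v; rewrite /f cornerD cornerZ induced_outD induced_out_In.
exists (lin_of fl); split=> [y|u].
  change (f (corner_inc g y) = ext_inc X y); rewrite /f corner_incE /induced_out.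
  under eq_bigr => c _ do rewrite induced_incE ci_out_in // linearZ_LR scalerA.
  by rewrite -scaler_suml sum_out_lr scale1r.
change (ext_prj X (f u) = corner_prj u).
apply: (ci_in_inj (ci := cM)); rewrite [RHS]corner_prjE -[in RHS]cornerP linearZ_LR.
rewrite scaler_sumr linear_sum ci_in_sum; apply: eq_bigr => c _.
by rewrite linearZ_LR ci_inZ -(tr_corner gM) ci_e.
Qed.

End InducedExtension.
End CornerExtensions.

(** * Matrix entries of the elements of the Schur algebra *)

Section PlacePermutations.
Variables (X : eqType) (d : nat).

Lemma perm_eq_word (f g : 'I_d -> X) :
  perm_eq [seq f a | a <- enum 'I_d] [seq g a | a <- enum 'I_d] ->
  exists s : 'S_d, forall a, f a = g (s a).
Proof.
move=> h; have e (F : 'I_d -> X) : [seq F a | a <- enum 'I_d] = [tuple F a | a < d] :> seq X.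
  by rewrite -val_ord_tuple.
move: h; rewrite !e => /tuple_permP[s hs]; exists s => a.
have := congr1 (fun t => nth (f a) t a) hs.
by rewrite -!tnth_nth !tnth_mktuple.
Qed.

Lemma perm_eq_wact (g : 'I_d -> X) (s : 'S_d) :
  perm_eq [seq g (s a) | a <- enum 'I_d] [seq g a | a <- enum 'I_d].
Proof.
rewrite (map_comp g s); apply: perm_map; apply: uniq_perm.
- by rewrite map_inj_uniq ?enum_uniq //; apply: perm_inj.
- exact: enum_uniq.
move=> a; rewrite mem_enum; apply/mapP; exists (s^-1%g a); first by rewrite mem_enum.
by rewrite permKV.
Qed.

End PlacePermutations.

Section SchurEntries.
Variables (k : fieldType) (m d : nat).
Local Notation S := (schur k m d).
Local Notation I := (mword m d).
Implicit Types (s : S) (r t p q : I) (g : 'S_d).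

Definition sent s r t : k := schur_val s (enum_rank r) (enum_rank t).

Lemma sent_ext s s' : (forall r t, sent s r t = sent s' r t) -> s = s'.
Proof.
move=> h; apply: val_inj; apply/matrixP => i j.
by have := h (enum_val i) (enum_val j); rewrite /sent !enum_valK.
Qed.

Lemma sent_act s r t g : sent s (mwact r g) (mwact t g) = sent s r t.
Proof. by have /schur_invP := valP s; apply. Qed.

Lemma sentD s s' r t : sent (s + s') r t = sent s r t + sent s' r t.
Proof. by rewrite /sent [LHS]mxE. Qed.

Lemma sentB s s' r t : sent (s - s') r t = sent s r t - sent s' r t.
Proof. by rewrite /sent !mxE. Qed.

Lemma sent0 r t : sent 0 r t = 0.
Proof. by rewrite /sent [LHS]mxE. Qed.

Lemma sentZ c s r t : sent (c *: s) r t = c * sent s r t.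
Proof. by rewrite /sent [LHS]mxE. Qed.

Lemma sent_sum (J : finType) (P : pred J) (F : J -> S) r t :
  sent (\sum_(j | P j) F j) r t = \sum_(j | P j) sent (F j) r t.
Proof. by apply: (big_morph (fun s => sent s r t)) => [x y|]; rewrite ?sentD ?sent0. Qed.

Lemma sent1 r t : sent 1 r t = (r == t)%:R.
Proof. by rewrite /sent [LHS]mxE (inj_eq enum_rank_inj). Qed.

Lemma sentM s s' r t : sent (s * s') r t = \sum_q sent s r q * sent s' q t.
Proof.
rewrite /sent [LHS]mxE (reindex _ (onW_bij _ (@enum_rank_bij I))).
by apply: eq_bigr.
Qed.

Lemma schur_scalE c s : schur_scal m d c * s = c *: s.
Proof.
apply: sent_ext => r t; rewrite sentM sentZ (bigD1 r) //= big1 ?addr0.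
  by rewrite /sent mxE eqxx.
move=> q qr; rewrite {1}/sent mxE (inj_eq enum_rank_inj) eq_sym (negbTE qr).
by rewrite mul0r.
Qed.

Lemma schur_scalC c s : s * schur_scal m d c = c *: s.
Proof.
apply: sent_ext => r t; rewrite sentM sentZ (bigD1 t) //= big1 ?addr0.
  by rewrite {2}/sent mxE eqxx mulrC.
move=> q qr; rewrite {2}/sent mxE (inj_eq enum_rank_inj) (negbTE qr).
by rewrite mulr0.
Qed.

(** The orbits of pairs of words, which index the Schur basis *)
Definition orb2 (x y : I * I) : bool :=
  [exists g, (y.1 == mwact x.1 g) && (y.2 == mwact x.2 g)].

Lemma orb2P x y : reflect (exists g, y = (mwact x.1 g, mwact x.2 g)) (orb2 x y).
Proof.
apply: (iffP existsP) => -[g]; last by move->; exists g; rewrite !eqxx.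
by case: y => y1 y2 /= /andP[/eqP -> /eqP ->]; exists g.
Qed.

Lemma mwactE r g a : mwact r g a = r (g a).
Proof. exact: ffunE. Qed.

Lemma mwactM r g h : mwact r (g * h)%g = mwact (mwact r h) g.
Proof. by apply/ffunP => a; rewrite !ffunE permM. Qed.

Lemma mwact1 r : mwact r 1%g = r.
Proof. by apply/ffunP => a; rewrite ffunE perm1. Qed.

Lemma orb2_equiv : equivalence_rel orb2.
Proof.
have refl x : orb2 x x by apply/orb2P; exists 1%g; rewrite !mwact1 -surjective_pairing.
have sym x y : orb2 x y -> orb2 y x.
  move=> /orb2P[g ->]; apply/orb2P; exists g^-1%g.
  by rewrite -!mwactM mulVg !mwact1 -surjective_pairing.
have tr y x z : orb2 x y -> orb2 y z -> orb2 x z.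
  move=> /orb2P[g ->] /orb2P[h ->]; apply/orb2P; exists (h * g)%g.
  by rewrite !mwactM.
move=> x y z; split=> // xy; apply/idP/idP; first exact/tr/sym.
exact: tr.
Qed.

Lemma orb2_refl x : orb2 x x.
Proof. by have [->] := orb2_equiv x x x. Qed.

Lemma orb2_sym x y : orb2 x y = orb2 y x.
Proof.
apply/idP/idP => h; first by have [_ /(_ h) <-] := orb2_equiv x y x; rewrite orb2_refl.
by have [_ /(_ h) <-] := orb2_equiv y x y; rewrite orb2_refl.
Qed.

Lemma sent_xi r t p q : sent (schur_xi k r t) p q = (orb2 (r, t) (p, q))%:R.
Proof. by rewrite /sent mxE !enum_rankK. Qed.

Lemma sent_orb2 s r t p q : orb2 (r, t) (p, q) -> sent s p q = sent s r t.
Proof. by move=> /orb2P[g [-> ->]]; rewrite sent_act. Qed.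

Definition orb2_rep (x : I * I) : I * I := odflt x [pick y | orb2 x y].

Lemma orb2_repP x : orb2 x (orb2_rep x).
Proof.
rewrite /orb2_rep; case: pickP => //= h.
by have := h x; rewrite orb2_refl.
Qed.

Lemma orb2_rep_eq x y : orb2 x y -> orb2_rep x = orb2_rep y.
Proof.
move=> xy; have h : orb2 x =1 orb2 y by move=> z; have [_ ->] := orb2_equiv x y z.
rewrite /orb2_rep (eq_pick h); case: pickP => //= h'.
by have := h' y; rewrite orb2_refl.
Qed.

Lemma schur_xi_orb2 r t p q : orb2 (r, t) (p, q) -> schur_xi k r t = schur_xi k p q.
Proof.
move=> o; apply: sent_ext => r' t'; rewrite !sent_xi.
by have [_ ->] := orb2_equiv (r, t) (p, q) (r', t').
Qed.

Lemma schur_expand s :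
  s = \sum_(x | orb2_rep x == x) sent s x.1 x.2 *: schur_xi k x.1 x.2.
Proof.
apply: sent_ext => r t; rewrite sent_sum.
have h0 := orb2_repP (r, t).
have hs : orb2 (orb2_rep (r, t)) (r, t) by rewrite orb2_sym.
rewrite (bigD1 (orb2_rep (r, t))) /=; last by rewrite -(orb2_rep_eq h0).
rewrite sentZ sent_xi -surjective_pairing hs mulr1 big1 ?addr0.
  by apply: sent_orb2; rewrite -surjective_pairing.
move=> x /andP[/eqP xr xn]; rewrite sentZ sent_xi -surjective_pairing.
case: (boolP (orb2 x (r, t))) => [o|]; last by rewrite mulr0.
by case/eqP: xn; rewrite -xr (orb2_rep_eq o).
Qed.

Definition mwmin (r t : I) : I := [ffun a => if (r a <= t a)%N then r a else t a].
Definition wt_sum (r : I) : nat := (\sum_a r a)%N.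

Lemma content_perm r t : content r = content t -> exists g, r = mwact t g.
Proof.
move=> /ffunP h.
have [|g hg] := @perm_eq_word _ _ r t; last first.
  by exists g; apply/ffunP => a; rewrite ffunE hg.
apply/allP => x _ /=; apply/eqP.
have := h x; rewrite !ffunE !cardsE => e.
have cE (f : I) : count_mem x [seq f a | a <- enum 'I_d] = #|[pred a | f a == x]|.
  by rewrite count_map cardE size_filter enumT.
by rewrite !cE.
Qed.

Lemma content_act r g : content (mwact r g) = content r.
Proof.
apply/ffunP => x; rewrite !ffunE -(card_preimset [set a | r a == x] (@perm_inj _ g)).
by apply: eq_card => a; rewrite !inE ffunE.
Qed.

Lemma wt_sum_act r g : wt_sum (mwact r g) = wt_sum r.
Proof.
rewrite /wt_sum [RHS](reindex_inj (@perm_inj _ g)).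
by apply: eq_bigr => a _; rewrite ffunE.
Qed.

Lemma wt_sum_content r t : content r = content t -> wt_sum r = wt_sum t.
Proof. by move=> /content_perm[g ->]; rewrite wt_sum_act. Qed.

Lemma sent_xi_diag r p q :
  sent (schur_xi k r r) p q = ((p == q) && (content p == content r))%:R.
Proof.
rewrite sent_xi; congr (nat_of_bool _)%:R; apply/orb2P/andP => [[g [-> ->]]|[/eqP <- /eqP h]].
  by rewrite content_act.
by have [g hg] := content_perm h; exists g; rewrite -hg.
Qed.

Lemma sent_xi_diagl r s p q :
  sent (schur_xi k r r * s) p q = (content p == content r)%:R * sent s p q.
Proof.
rewrite sentM (bigD1 p) //= big1 ?addr0 ?sent_xi_diag ?eqxx // => x xp.
by rewrite sent_xi_diag eq_sym (negbTE xp) mul0r.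
Qed.

Lemma sent_xi_diagr r s p q :
  sent (s * schur_xi k r r) p q = sent s p q * (content q == content r)%:R.
Proof.
rewrite sentM (bigD1 q) //= big1 ?addr0 ?sent_xi_diag ?eqxx // => x xp.
by rewrite sent_xi_diag (negbTE xp) mulr0.
Qed.

End SchurEntries.

(** * The weight algebra modulo higher weights *)

(** Up to 0, the two-sided ideal generated by the weight idempotents xi_{t,t}
    with the weight of t not below la; it annihilates every module with all
    weights below la. *)
Inductive above (k : fieldType) m d (la : weight m) : schur k m d -> Prop :=
| above_gen y t y' : ~ dominated (content t) la -> above la (y * schur_xi k t t * y')
| above_add x y : above la x -> above la y -> above la (x + y)
| above_scale c x : above la x -> above la (c *: x).

Section Triangularity.
Variables (k : fieldType) (m d : nat) (la : weight m) (r0 : mword m d).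
Hypothesis r0_la : content r0 = la.
Local Notation S := (schur k m d).
Local Notation I := (mword m d).
Local Notation xi := (schur_xi k).
Implicit Types (s : S) (r t p q i j l : I).

Lemma wt_le_eq r t : (forall a, (r a <= t a)%N) -> (wt_sum t <= wt_sum r)%N -> r = t.
Proof.
move=> le s; have e : wt_sum r = wt_sum t.
  by apply/eqP; rewrite eqn_leq s andbT; apply: leq_sum.
apply/ffunP => a; apply/val_inj/eqP; rewrite eqn_leq le /=.
have hl : (\sum_(b | b != a) r b <= \sum_(b | b != a) t b)%N by apply: leq_sum.
move/eqP: e; rewrite /wt_sum (bigD1 a) //= [X in _ == X](bigD1 a) //= => /eqP e.
by rewrite -(leq_add2r (\sum_(b | b != a) t b)) -e leq_add2l.
Qed.

Lemma mwmin_lel r t a : (mwmin r t a <= r a)%N.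
Proof. by rewrite ffunE; case: (leqP (r a)) => // /ltnW. Qed.

Lemma mwmin_ler r t a : (mwmin r t a <= t a)%N.
Proof. by rewrite ffunE; case: (leqP (r a)). Qed.

Lemma le_mwmin r t p : (forall a, (p a <= r a)%N) -> (forall a, (p a <= t a)%N) ->
  forall a, (p a <= mwmin r t a)%N.
Proof. by move=> h1 h2 a; rewrite ffunE; case: ifP. Qed.

Lemma mwmin_act i j (g : 'S_d) : mwmin (mwact i g) (mwact j g) = mwact (mwmin i j) g.
Proof. by apply/ffunP => a; rewrite !ffunE. Qed.

(** The pair (i, j) is recovered, up to place permutation, from its two halves
    (i, min) and (min, j). *)
Lemma orb2_mwmin i j p q t : t = mwmin p q ->
  orb2 (i, mwmin i j) (p, t) -> orb2 (mwmin i j, j) (t, q) -> orb2 (i, j) (p, q).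
Proof.
set l := mwmin i j => et /orb2P[g [ep tg]] /orb2P[h [th eq]].
pose u := (g^-1 * h)%g; pose j' := mwact j u.
have ug r : mwact (mwact r u) g = mwact r h by rewrite -mwactM mulKVg.
have lu : mwact l u = l by apply: (@mwact_inj _ _ g); rewrite ug -th tg.
have lmin : mwmin i j' = l.
  apply: (@mwact_inj _ _ g); by rewrite -mwmin_act ug -ep -eq -tg et.
suff [w hw] : exists w : 'S_d, forall a, (i a, j' a) = (i (w a), j (w a)).
  apply/orb2P; exists (g * w)%g => /=; rewrite ep eq !mwactM -ug -/j'.
  by congr pair; congr mwact; apply/ffunP => a; rewrite [RHS]ffunE; case: (hw a).
apply: (@perm_eq_word _ _ (fun a => (i a, j' a)) (fun a => (i a, j a))).
pose B := filter (fun a : 'I_d => j a < i a)%N (enum 'I_d).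
pose C := filter (predC (fun a : 'I_d => j a < i a)%N) (enum 'I_d).
have BC (F : 'I_d -> 'I_m * 'I_m) : perm_eq [seq F a | a <- enum 'I_d]
    ([seq F a | a <- B] ++ [seq F a | a <- C]).
  by rewrite -map_cat; apply: perm_map; rewrite perm_sym perm_filterC.
have onB a : a \in B -> j' a = j a.
  rewrite mem_filter => /andP[ji _]; have lja : l a = j a by rewrite ffunE leqNgt ji.
  move/ffunP/(_ a): lmin; rewrite ffunE lja; case: leqP => // _ e.
  by rewrite e ltnn in ji.
have onC a : a \in C -> i a = l a.
  by rewrite mem_filter /= -leqNgt => /andP[ij _]; rewrite ffunE ij.
have eqC (f : I) : [seq (i a, f a) | a <- C] = [seq (l a, f a) | a <- C].
  by apply/eq_in_map => a aC; rewrite (onC _ aC).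
suff hC : perm_eq [seq (l a, j' a) | a <- C] [seq (l a, j a) | a <- C].
  rewrite (perm_trans (BC _)) // perm_sym (perm_trans (BC _)) // perm_sym !eqC.
  rewrite (_ : [seq (i a, j' a) | a <- B] = [seq (i a, j a) | a <- B]) ?perm_cat2l //.
  by apply/eq_in_map => a aB; rewrite (onB _ aB).
have eB : [seq (l a, j' a) | a <- B] = [seq (l a, j a) | a <- B].
  by apply/eq_in_map => a aB; rewrite (onB _ aB).
rewrite -(perm_cat2l [seq (l a, j a) | a <- B]) -{1}eB.
have BC1 := BC (fun a => (l a, j' a)); rewrite perm_sym in BC1.
apply: (perm_trans BC1); apply: perm_trans (BC (fun a => (l a, j a))).
have := perm_eq_wact (fun a => (l a, j a)) u.
rewrite (_ : [seq (l (u a), j (u a)) | a <- enum 'I_d] = [seq (l a, j' a) | a <- enum 'I_d]) //.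
have lE a : l (u a) = l a by rewrite -[in RHS]lu [RHS]ffunE.
by apply: eq_map => a; rewrite lE [mwact j u a]ffunE.
Qed.

(** Lowering letters of a word moves its content up in the dominance order. *)
Lemma content_lt r t : (forall a, (r a <= t a)%N) -> r != t -> ~ dominated (content r) (content t).
Proof.
move=> le ne dom; have /existsP[a neq] : [exists a, r a != t a].
  apply: contraR ne; rewrite negb_exists => /forallP h.
  by apply/eqP/ffunP => a; have := h a; rewrite negbK => /eqP.
have sumE (f : I) n : (\sum_(x < m | x < n) content f x)%N = #|[set b | f b < n]%N|.
  rewrite -sum1_card (partition_big f (fun x : 'I_m => x < n)%N) /=; last by move=> b; rewrite inE.
  apply: eq_bigr => x xn; rewrite ffunE -sum1_card; apply: eq_bigl => b.
  by rewrite !inE; case: eqP => [->|]; rewrite ?xn ?andbF.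
have := dom (t a); rewrite !sumE leqNgt => /negP; apply.
apply: proper_card; apply/properP; split.
  by apply/subsetP => b; rewrite !inE; apply: leq_ltn_trans.
by exists a; rewrite !inE ?ltnn // ltn_neqAle le andbT.
Qed.

(** [above] together with 0, which belongs to it only when some weight is not
    below la *)
Definition above_mod s := s = 0 \/ above la s.

Lemma above_mod_add s s' : above_mod s -> above_mod s' -> above_mod (s + s').
Proof.
move=> [->|h] [->|h']; rewrite ?addr0 ?add0r; try by [left|right].
by right; apply: above_add.
Qed.

Lemma above_mod_scale c s : above_mod s -> above_mod (c *: s).
Proof. by case=> [->|h]; [left; rewrite scaler0|right; apply: above_scale]. Qed.

Let e0 := xi r0 r0.

(** Modulo the weights not below la, the weight algebra of la is spanned by its
    identity. The words i, j of weight la factor through l = min(i, j), and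
    xi_{i,l} xi_{l,j} is xi_{i,j} plus basis elements xi_{p,q} with larger
    min(p, q). *)
Lemma schur_xi_above n i j : content i = la -> content j = la ->
  (d * m < n + wt_sum (mwmin i j))%N -> exists c, above_mod (xi i j - c *: e0).
Proof.
elim: n i j => [|n IHn] i j ci cj hn.
  suff : (wt_sum (mwmin i j) <= d * m)%N by rewrite leqNgt -[X in (_ < X)%N]add0n hn.
  rewrite -[d in (d * m)%N]card_ord -sum_nat_const; apply: leq_sum => a _.
  exact/ltnW/ltn_ord.
pose l := mwmin i j.
have [li|li] := eqVneq l i.
  have ij : i = j.
    apply: wt_le_eq; last by rewrite (wt_sum_content (_ : content i = content j)) // ci cj.
    by move=> a; rewrite -li mwmin_ler.
  exists 1; left; rewrite scale1r -ij /e0; apply/eqP; rewrite subr_eq0; apply/eqP.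
  apply: schur_xi_orb2; apply/orb2P.
  have [g ->] : exists g, r0 = mwact i g by apply: content_perm; rewrite r0_la ci.
  by exists g.
have lNla : ~ dominated (content l) la.
  by rewrite -ci; apply: content_lt => // a; apply: mwmin_lel.
pose P := xi i l * xi l j.
have aP : above la P.
  have {1}-> : P = xi i l * xi l l * xi l j.
    rewrite /P -[X in _ = X]mulrA; congr (_ * _); apply: sent_ext => p q.
    rewrite sent_xi_diagl sent_xi; case: orb2P => [[g [-> _]]|_]; last by rewrite mulr0.
    by rewrite content_act eqxx mul1r.
  exact: above_gen.
pose g := P - xi i j.
have gP p q : sent g p q != 0 -> [/\ content p = la, content q = la &
    (wt_sum l < wt_sum (mwmin p q))%N].
  have mid t : orb2 (i, l) (p, t) -> orb2 (l, j) (t, q) -> [/\ content p = la, content q = la,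
      wt_sum t = wt_sum l & forall a, (t a <= p a)%N && (t a <= q a)%N].
    move=> /orb2P[h [ep et]] /orb2P[h' [et' eq]]; rewrite /= in ep et et' eq.
    split=> [|||a]; first by rewrite ep content_act.
    - by rewrite eq content_act.
    - by rewrite et wt_sum_act.
    apply/andP; split; first by rewrite et ep !mwactE mwmin_lel.
    by rewrite et' eq !mwactE mwmin_ler.
  have entP p' q' : sent P p' q' = \sum_t (orb2 (i, l) (p', t) && orb2 (l, j) (t, q'))%:R.
    by rewrite sentM; apply: eq_bigr => t _; rewrite !sent_xi -natrM mulnb.
  rewrite sentB; case: (boolP (orb2 (i, j) (p, q))) => [o|no].
    rewrite !(sent_orb2 _ o) sent_xi orb2_refl.
    rewrite entP (bigD1 l) //= !orb2_refl big1 ?addr0 ?subrr ?eqxx //.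
    move=> t tl; case: andP => // -[/orb2P[h [/= ei et]] /orb2P[h' [/= et' ej]]].
    case/eqP: tl; apply: wt_le_eq; last by rewrite et wt_sum_act.
    apply: le_mwmin => a; first by rewrite ei et !mwactE mwmin_lel.
    by rewrite ej et' !mwactE mwmin_ler.
  rewrite sent_xi (negbTE no) subr0 entP.
  case: (pickP (fun t => orb2 (i, l) (p, t) && orb2 (l, j) (t, q))) => [t /andP[o1 o2] _|h]; last first.
    by rewrite big1 ?eqxx // => t _; rewrite h.
  have [cp cq <- tle] := mid t o1 o2; split=> //; rewrite ltn_neqAle andbC.
  have tlemin a : (t a <= mwmin p q a)%N by apply: le_mwmin => b; have /andP[] := tle b.
  rewrite leq_sum //=; apply: contra no => /eqP e.
  by apply: orb2_mwmin o1 o2; apply: wt_le_eq; rewrite // e.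
have /fin_all_exists[c hc] (x : I * I) : exists c, sent g x.1 x.2 != 0 -> above_mod (xi x.1 x.2 - c *: e0).
  case: (boolP (sent g x.1 x.2 != 0)) => [gx|_]; last by exists 0.
  have [cp cq lt] := gP _ _ gx; have [|c hc] := IHn x.1 x.2 cp cq; last by exists c.
  by apply: leq_trans hn _; rewrite addSnnS leq_add2l.
exists (- \sum_(x | orb2_rep x == x) sent g x.1 x.2 * c x).
have -> : xi i j = P - g by rewrite /g opprB addrC subrK.
rewrite scaleNr opprK -addrA; apply: above_mod_add; first by right.
rewrite addrC scaler_suml [X in _ - X](schur_expand g) -sumrB.
apply: (big_ind above_mod) => [||x _]; [by left|exact: above_mod_add|].
have [->|gx] := eqVneq (sent g x.1 x.2) 0; first by left; rewrite mul0r !scale0r subrr.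
rewrite -scalerA -scalerBr; apply: above_mod_scale.
by rewrite -opprB -scaleN1r; apply/above_mod_scale/hc.
Qed.

Lemma schur_above_supp s :
  (forall p q, sent s p q != 0 -> content p = la /\ content q = la) ->
  exists c, above_mod (s - c *: e0).
Proof.
move=> supp.
have /fin_all_exists[c hc] (x : I * I) : exists c, sent s x.1 x.2 != 0 -> above_mod (xi x.1 x.2 - c *: e0).
  case: (boolP (sent s x.1 x.2 != 0)) => [sx|_]; last by exists 0.
  have [cp cq] := supp _ _ sx.
  have [|c hc] := @schur_xi_above (d * m).+1 x.1 x.2 cp cq; last by exists c.
  by rewrite addSn ltnS leq_addr.
exists (\sum_(x | orb2_rep x == x) sent s x.1 x.2 * c x).
rewrite scaler_suml [X in X - _](schur_expand s) -sumrB.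
apply: (big_ind above_mod) => [||x _]; [by left|exact: above_mod_add|].
have [->|sx] := eqVneq (sent s x.1 x.2) 0; first by left; rewrite mul0r !scale0r subrr.
by rewrite -scalerA -scalerBr; apply/above_mod_scale/hc.
Qed.

Lemma schur_weight_scalar s : exists c, above_mod (e0 * s * e0 - c *: e0).
Proof.
apply: schur_above_supp => p q; rewrite sent_xi_diagr sent_xi_diagl r0_la.
by case: (content p =P la); case: (content q =P la); rewrite ?mul0r ?mulr0 ?eqxx.
Qed.

End Triangularity.

(** * Highest weight modules *)

Section HighestWeight.
Variables (k : fieldType) (m d : nat).
Local Notation S := (schur k m d).
Local Notation xi := (schur_xi k).
Local Notation sc := (@schur_scal k m d).

(** A highest weight vector of a simple module, with the coordinate along it. *)
Record highest_weight (V : lmodType S) (la : weight m) := HighestWeight {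
  hw_word : mword m d;
  hw_vec : V;
  hw_fun : V -> k;
  hw_content : content hw_word = la;
  hw_nz : hw_vec != 0;
  hw_funE : forall x, xi hw_word hw_word *: x = sc (hw_fun x) *: hw_vec;
  hw_fixed : xi hw_word hw_word *: hw_vec = hw_vec;
  hw_sep : forall x, (forall s, hw_fun (s *: x) = 0) -> x = 0;
  hw_gen : forall x, exists s, x = s *: hw_vec;
  hw_above : forall s (x : V), above la s -> s *: x = 0 }.

Lemma sc_eq0 (V : lmodType S) c (v : V) : v != 0 -> sc c *: v = 0 -> c = 0.
Proof.
move=> v0 h; apply/eqP/contraT => c0; case/eqP: v0.
by rewrite -[v]scale1r -(rmorph1 sc) -(mulVf c0) rmorphM -scalerA h scaler0.
Qed.

Lemma schur_scal_comm c (s : S) : sc c * s = s * sc c.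
Proof. by rewrite schur_scalE schur_scalC. Qed.

Lemma xi_diag_idem (r : mword m d) : xi r r * xi r r = xi r r.
Proof.
apply: sent_ext => p q; rewrite sent_xi_diagl sent_xi_diag.
by case: (content p == _); rewrite ?mul1r // andbF mul0r.
Qed.

Lemma irr_above (V : lmodType S) la : is_irr V la ->
  forall s (x : V), above la s -> s *: x = 0.
Proof.
move=> [_ _ wt] s x a; elim: a x => [y t y' nd|y y' _ hy _ hy'|c y _ hy] x.
- rewrite -!scalerA; suff -> : xi t t *: (y' *: x) = 0 by rewrite scaler0.
  apply: Classical_Prop.NNPP => ne; apply/nd/wt; exists t; split=> //.
  by exists (y' *: x).
- by rewrite scalerDl hy hy' addr0.
- by rewrite -schur_scalE -scalerA hy scaler0.
Qed.

(** By [schur_weight_scalar] the weight algebra of la acts by scalars on the la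
    weight space, which is therefore a line. *)
Lemma irr_highest_weight (V : lmodType S) la : is_irr V la -> inhabited (highest_weight V la).
Proof.
move=> irr; have ab := irr_above irr.
case: irr => -[_ simp] [r0 [cr [w w0]]] _.
set e := xi r0 r0 in w0; pose v := e *: w; have v0 : v != 0 by apply/eqP.
have ev : e *: v = v by rewrite scalerA xi_diag_idem.
clearbody v.
have gen x : exists s, x = s *: v.
  have [||/(_ v)|] := simp (fun x => exists s, x = s *: v).
  - by exists 0; rewrite scale0r.
  - by move=> a _ _ [s ->] [s' ->]; exists (a * s + s'); rewrite scalerDl scalerA.
  - by move=> h; case/eqP: v0; apply: h; exists 1; rewrite scale1r.
  - exact.
have fx x : exists c, e *: x = sc c *: v.
  have [s ->] := gen x; have [c hc] := schur_weight_scalar cr s; exists c.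
  rewrite -{1}ev !scalerA -/e; apply/eqP; rewrite -subr_eq0.
  have -> : sc c *: v = (c *: e) *: v by rewrite -schur_scalE -scalerA ev.
  rewrite -scalerBl; case: hc => [->|/ab ->//]; by rewrite scale0r.
pose f x := proj1_sig (constructive_indefinite_description _ (fx x)).
have fE x : e *: x = sc (f x) *: v by rewrite /f; case: constructive_indefinite_description.
have fsep x : (forall s, f (s *: x) = 0) -> x = 0.
  have [||h|h] := simp (fun x => forall s, f (s *: x) = 0).
  - move=> s; apply: (sc_eq0 v0); rewrite -fE !scaler0 //.
  - move=> a x1 x2 h1 h2 s; apply: (sc_eq0 v0).
    by rewrite -fE !scalerDr scalerA !fE h1 h2 rmorph0 !scale0r addr0.
  - exact: h.
  - have := fE v; rewrite ev -[X in f X]scale1r h rmorph0 scale0r => e0.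
    by rewrite e0 eqxx in v0.
by constructor; apply: (@HighestWeight V la r0 v f).
Qed.

Section Theory.
Variables (V : lmodType S) (la : weight m) (h : highest_weight V la).
Local Notation f := (hw_fun h).
Local Notation v := (hw_vec h).
Local Notation e := (xi (hw_word h) (hw_word h)).

Lemma hw_eq c x : e *: x = sc c *: v -> f x = c.
Proof.
rewrite hw_funE => /eqP; rewrite -subr_eq0 -scalerBl -rmorphB => /eqP.
by move/(sc_eq0 (hw_nz h))/eqP; rewrite subr_eq0 => /eqP.
Qed.

Lemma hw_fun1 : f v = 1.
Proof. by apply: hw_eq; rewrite hw_fixed rmorph1 scale1r. Qed.

Lemma hw_funD x y : f (x + y) = f x + f y.
Proof. by apply: hw_eq; rewrite scalerDr !hw_funE rmorphD scalerDl. Qed.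

Lemma hw_funZ c x : f (sc c *: x) = c * f x.
Proof.
by apply: hw_eq; rewrite scalerA -schur_scal_comm -scalerA hw_funE scalerA rmorphM.
Qed.

Lemma hw_fun0 : f 0 = 0.
Proof. by apply: hw_eq; rewrite scaler0 rmorph0 scale0r. Qed.

Lemma hw_fun_sum (J : finType) (F : J -> V) : f (\sum_j F j) = \sum_j f (F j).
Proof. exact: (big_morph f hw_funD hw_fun0). Qed.

Lemma hw_chi s : above_mod la (e * s * e - f (s *: v) *: e).
Proof.
have [c hc] := schur_weight_scalar (hw_content h) s.
suff <- : c = f (s *: v) by [].
apply/esym/hw_eq; rewrite -{1}hw_fixed !scalerA; apply/eqP; rewrite -subr_eq0.
rewrite -{2}hw_fixed scalerA schur_scalE -scalerBl.
by case: hc => [->|/(hw_above h) ->//]; rewrite scale0r.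
Qed.

(** S acts on a simple module densely enough to contain a resolution of the
    identity through the highest weight line: extend a family of functionals
    f(b_a -) with dual vectors until they form a basis. The functionals come from
    linearly independent elements of S, so this stops. *)
Lemma irr_resolution : exists n (l b : 'I_n -> S),
  forall x : V, \sum_c l c *: (e *: (b c *: x)) = x.
Proof.
pose Q n := exists (b : 'I_n -> S) (w : 'I_n -> V), forall a c, f (b a *: w c) = (a == c)%:R.
have bound n : Q n -> (n <= #|mword m d| * #|mword m d|)%N.
  move=> [b [w hw]].
  pose B : 'M[k]_(n, #|mword m d| * #|mword m d|) := \matrix_a mxvec (schur_val (b a)).
  suff : row_free B by move/eqP => <-; apply: rank_leq_col.
  rewrite -kermx_eq0; apply/eqP/row_matrixP => i; rewrite row0.
  set u := row i _; have uB : u *m B = 0.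
    by apply: sub_kermxP; rewrite row_sub.
  have bu : \sum_a u 0 a *: b a = 0.
    have e1 : mxvec (val (\sum_a u 0 a *: b a)) = u *m B.
      rewrite raddf_sum raddf_sum mulmx_sum_row; apply: eq_bigr => a _.
      by rewrite rowK -linearZ.
    by apply: val_inj; apply/(can_inj mxvecK); rewrite e1 uB [\val 0]raddf0 [mxvec 0]raddf0.
  apply/rowP => c; rewrite [RHS]mxE.
  have : f ((\sum_a u 0 a *: b a) *: w c) = u 0 c.
    rewrite scaler_suml hw_fun_sum (bigD1 c) //= big1 ?addr0.
      by rewrite -schur_scalE -scalerA hw_funZ hw eqxx mulr1.
    by move=> a ac; rewrite -schur_scalE -scalerA hw_funZ hw (negbTE ac) mulr0.
  by rewrite bu scale0r hw_fun0 => <-.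
have ex : exists n, Q n /\ ~ Q n.+1.
  apply: Classical_Prop.NNPP => no.
  have all n : Q n.
    elim: n => [|n IH]; last by apply: Classical_Prop.NNPP => nQ; apply: no; exists n.
    by exists (fun=> 0), (fun=> 0) => -[].
  by have := bound _ (all (#|mword m d| * #|mword m d|).+1); rewrite ltnn.
have [n [[b [w hw]] nQ]] := ex.
have res x : \sum_a sc (f (b a *: x)) *: w a = x.
  apply/esym/eqP; rewrite -subr_eq0; apply/eqP.
  set y := x - _; apply: (@hw_sep _ _ h) => s.
  have by0 a : f (b a *: y) = 0.
    apply: (addIr (f (b a *: \sum_c sc (f (b c *: x)) *: w c))).
    rewrite -hw_funD -scalerDr subrK add0r scaler_sumr hw_fun_sum (bigD1 a) //= big1 ?addr0.
      by rewrite scalerA -schur_scal_comm -scalerA hw_funZ hw eqxx mulr1.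
    move=> c ca; rewrite scalerA -schur_scal_comm -scalerA hw_funZ hw.
    by rewrite eq_sym (negbTE ca) mulr0.
  apply/eqP; apply: contra_notT nQ => fs.
  pose b' : S := sc (f (s *: y))^-1 * (s - \sum_a sc (f (s *: w a)) * b a).
  have fb' z : f (b' *: z) = (f (s *: y))^-1 *
      (f (s *: z) - \sum_a f (s *: w a) * f (b a *: z)).
    rewrite -scalerA hw_funZ; congr (_ * _).
    apply: (addIr (f ((\sum_a sc (f (s *: w a)) * b a) *: z))).
    rewrite -hw_funD -scalerDl subrK [in RHS]scaler_suml [in RHS]hw_fun_sum.
    rewrite [X in _ + X](eq_bigr (fun a => f (s *: w a) * f (b a *: z))) ?subrK // => a _.
    by rewrite -scalerA hw_funZ.
  pose ext T (F : 'I_n -> T) (z : T) (a : 'I_n.+1) := oapp F z (unlift ord0 a).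
  exists (ext _ b b'), (ext _ w y) => a c; rewrite /ext.
  case: unliftP => [a'|] ->; case: unliftP => [c'|] -> /=.
  - by rewrite hw (inj_eq lift_inj).
  - by rewrite by0.
  - rewrite fb' (bigD1 c') //= hw eqxx mulr1 big1 ?addr0 ?subrr ?mulr0 //.
    by move=> c'' ne; rewrite hw (negbTE ne) mulr0.
  - rewrite fb' big1 ?subr0 ?(mulVf fs) ?eqxx //.
    by move=> c' _; rewrite by0 mulr0.
have /fin_all_exists[l hl] a : exists l, w a = l *: v by apply: hw_gen.
exists n, l, b => x; rewrite -[RHS]res; apply: eq_bigr => a _.
by rewrite hw_funE hl !scalerA schur_scal_comm.
Qed.

End Theory.
End HighestWeight.

Lemma dominated_anti m (al be : weight m) : dominated al be -> dominated be al -> al = be.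
Proof.
move=> h1 h2; have h t : (\sum_(i < m | i < t) al i = \sum_(i < m | i < t) be i)%N.
  by apply/eqP; rewrite eqn_leq h1 h2.
apply/ffunP => i.
have sumS (f : weight m) : (\sum_(x < m | (x < i.+1)%N) f x = f i + \sum_(x < m | (x < i)%N) f x)%N.
  rewrite (bigD1 i) //=; congr (_ + _)%N; apply: eq_bigl => x.
  by rewrite ltnS [RHS]ltn_neqAle andbC.
by apply/eqP; rewrite -(eqn_add2r (\sum_(x < m | (x < i)%N) al x)%N) -sumS h sumS h.
Qed.

(** If la is not below mu, a resolution of the identity of V through its highest
    weight line acts by zero on W, which has no weight la. Otherwise V and W are
    exchanged, and z is replaced by 1 - z. *)
Lemma irr_separate (k : fieldType) m d (V W : lmodType (schur k m d)) la mu
    (hV : highest_weight V la) (hW : highest_weight W mu) : la <> mu ->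
  exists z, (forall x : V, z *: x = x) /\ (forall y : W, z *: y = 0).
Proof.
have sep (V' W' : lmodType (schur k m d)) la' mu' (h : highest_weight V' la')
    (h' : highest_weight W' mu') : ~ dominated la' mu' ->
    exists z, (forall x : V', z *: x = x) /\ (forall y : W', z *: y = 0).
  move=> nd; have [n [l [b res]]] := irr_resolution h.
  exists (\sum_c l c * (schur_xi k (hw_word h) (hw_word h) * b c)); split=> [x|y].
    rewrite scaler_suml -[RHS]res; apply: eq_bigr => c _.
    by rewrite !scalerA mulrA.
  rewrite scaler_suml big1 // => c _; apply: (hw_above h'); rewrite mulrA.
  by apply: above_gen; rewrite (hw_content h).
move=> ne; have [lm|nlm] := Classical_Prop.classic (dominated la mu); last exact: sep nlm.
have [|z [z1 z0]] := sep _ _ _ _ hW hV; first by move=> ml; apply/ne/dominated_anti.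
exists (1 - z); split=> [x|y]; first by rewrite scalerBl z0 scale1r subr0.
by rewrite scalerBl z1 scale1r subrr.
Qed.

(** * Factorization of the elements of degree at least 2 *)

Section Factorization.
Variables (n m d : nat).
Local Notation W := (word n m d).
Implicit Types (u v w : W) (s t : 'S_d).

Definition lis_e (x : letter n m) : bool := zis_e x.1.1.

Lemma letter_mul_col (x y z : letter n m) : letter_mul x y = Some z -> x.2 = y.1.2.
Proof. by rewrite /letter_mul; case: eqP. Qed.

(** If the column index of u x determines the letters u x and v x, a pair in the
    orbits of u and v is composable only if a single permutation moves (u, v) to
    it. So the product of the orbit sums of u and v is a multiple of that of w,
    by the index of the stabilizer of (u, v) in that of w. *)
Lemma eta_mul_sep u v w : wmul u v w -> admissible u -> admissible v -> admissible w ->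
  (forall x y, (u x).2 = (u y).2 -> u x = u y /\ v x = v y) ->
  cfact u = 1%N -> cfact v = 1%N ->
  (#|fibperm w predT| = #|fibperm (fun x => (u x, v x)) predT| * cfact w)%N ->
  eta u * eta v = eta w *~ tens_sgn u v.
Proof.
move=> uvw au av aw sep cu cv cw.
have /andP[/tens_invP iu _] := TZc_eta au; have /andP[/tens_invP iv _] := TZc_eta av.
have /andP[/tens_invP iw _] := TZc_eta aw.
have /andP[/tens_invP iuv _] := TZcM (TZc_eta au) (TZc_eta av).
have eta1 z : cfact z = 1%N -> eta z z = 1.
  by move=> h; rewrite etaE same_orbit_refl sgn_dbl h.
pose g s := (wact u s, wact v s).
have key w' u' v' : wmul u' v' w' -> eta u u' != 0 -> eta v v' != 0 ->
    exists s, (u', v') = g s /\ w' = wact w s.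
  move=> uvw'; rewrite !etaE.
  case: same_orbitP => [[s us]|]; last by rewrite eqxx.
  case: same_orbitP => [[s' vs] _ _|]; last by rewrite eqxx.
  have vE : v' = wact v s.
    apply/ffunP => x; rewrite vs !ffunE.
    have e : (u (s x)).2 = (u (s' x)).2.
      have := letter_mul_col (wmulP _ _ _ uvw' x); rewrite us vs !ffunE => ->.
      exact/esym/letter_mul_col/(wmulP _ _ _ uvw).
    by have [_] := sep _ _ e.
  exists s; rewrite us vE; split=> //; apply: wmul_fun uvw' _.
  by rewrite us vE wmul_act.
pose F (p : W * W) : int :=
  (wmul p.1 p.2 w)%:R * (tens_sgn p.1 p.2 * eta u p.1 * eta v p.2).
have FE : (eta u * eta v) w = \sum_p F p.
  rewrite [LHS]ffunE -(pair_bigA _ (fun u v => F (u, v))) /=.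
  apply: eq_bigr => u' _; rewrite big_mkcond; apply: eq_bigr => v' _.
  by rewrite /F /=; case: wmul; rewrite ?mul1r ?mul0r.
have wfix s : s \in fibperm w predT -> wact w s = w.
  by move=> /fibpermP h; apply/ffunP => x; rewrite ffunE; have [->] := h x.
have Fg s : s \in fibperm w predT -> F (g s) = tens_sgn u v.
  move=> sw; rewrite /F /= -{1}(wfix s sw) wmul_act uvw mul1r iu iv !eta1 // !mulr1.
  rewrite (tens_sgn_act s uvw) place_sgn_even ?mul1r // => x ox.
  apply/eqP; apply: contraT => sx; have /fibpermP/(_ x)[e _] := sw.
  by have /forallP/(_ (s x))/forallP/(_ x) := aw; rewrite sx e eqxx ox.
have atw : (eta u * eta v) w = (eta w *~ tens_sgn u v) w.
  pose K := fibperm (fun x => (u x, v x)) predT.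
  have Kw : K \subset fibperm w predT.
    apply: fibpermS => // x y [ux vx].
    by have := wmulP _ _ _ uvw x; rewrite ux vx (wmulP _ _ _ uvw y) => -[].
  have E : \sum_(s in fibperm w predT) F (g s) = #|K|%:R * \sum_p F p.
    rewrite (partition_big g xpredT) //= mulr_sumr; apply: eq_bigr => p _.
    rewrite (eq_bigr (fun=> F p)) => [|s /andP[_ /eqP ->] //].
    rewrite sumr_const -[LHS]mulr_natl.
    have [->|Fp] := eqVneq (F p) 0; first by rewrite !mulr0.
    congr (_%:R * _).
    have [s0 [ps0 ws0]] : exists s, p = g s /\ w = wact w s.
      case: p Fp => u' v'; rewrite /F /= => Fp; apply: key.
      - by move: Fp; case: wmul; rewrite ?mul0r ?eqxx.
      - by apply: contraNneq Fp => ->; rewrite mulr0 mul0r mulr0.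
      - by apply: contraNneq Fp => ->; rewrite !mulr0.
    have s0w : s0 \in fibperm w predT.
      by apply/fibpermP => x; rewrite {2}ws0 ffunE.
    rewrite -(card_lcoset K s0); apply: eq_card => s.
    rewrite mem_lcoset; apply/andP/idP => [[sw /eqP]|tK].
      rewrite ps0 => -[/ffunP us /ffunP vs]; apply/fibpermP => x; split=> //.
      rewrite permM; have := us (s0^-1%g x); have := vs (s0^-1%g x).
      by rewrite !ffunE permKV => -> ->.
    have sE : s = (s0 * (s0^-1 * s))%g by rewrite mulKVg.
    split; first by rewrite sE groupM // (subsetP Kw).
    have /fibpermP tf := tK; apply/eqP; rewrite sE ps0 /g !wactM.
    by congr (wact _ s0, wact _ s0); apply/ffunP => x; rewrite -wactM ffunE; have [[]] := tf x.
  have Kpos : #|K|%:R != 0 :> int by rewrite pnatr_eq0 -lt0n cardG_gt0.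
  apply: (mulfI Kpos); rewrite FE -E (eq_bigr _ Fg) sumr_const cw.
  rewrite tens_mulrzE etaE same_orbit_refl sgn_dbl mul1r -[LHS]mulr_natl natrM.
  by rewrite mulrA.
apply/ffunP => w'; case: (boolP (same_orbit w w')) => [/same_orbitP[s ->]|no].
  by rewrite iuv atw !tens_mulrzE iw mulrA.
rewrite tens_mulrzE etaE (negbTE no) mul0r ffunE big1 // => u' _; rewrite big1 // => v' uvw'.
have [->|nu] := eqVneq (eta u u') 0; first by rewrite mulr0 mul0r.
have [->|nv] := eqVneq (eta v v') 0; first by rewrite mulr0.
have [s [_ ws]] := key _ _ _ uvw' nu nv.
by case/same_orbitP: no; exists s.
Qed.

End Factorization.

Section FactorWord.
Variables (n m d : nat).
Local Notation W := (word n m d).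
Implicit Types (u v w : W) (s t : 'S_d).

(** When m >= d the column indices of the left factor can be chosen so as to
    distinguish all positions, except those that carry equal letters e_j. With
    this choice the stabilizer index of [eta_mul_sep] is the factor cfact w. *)
Lemma eta_factor w (b1 b2 : 'I_d -> zz n) : (d <= m)%N -> admissible w ->
  (forall x, zz_mul (b1 x) (b2 x) = Some (w x).1.1) ->
  (forall x, lis_e (w x) -> b1 x = (w x).1.1 /\ b2 x = (w x).1.1) ->
  exists u v c, [/\ eta u * eta v = eta w *~ c, c * c = 1, admissible u /\ admissible v,
    forall x, (u x).1.1 = b1 x & forall x, (v x).1.1 = b2 x].
Proof.
move=> dm aw bw be.
pose g x := if lis_e (w x) then odflt x [pick y | w y == w x] else x.
have gE x y : g x = g y -> x = y \/ w x = w y /\ lis_e (w x).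
  have wg z : w (g z) = w z.
    by rewrite /g; case: ifP => // _; case: pickP => //= z' /eqP.
  move=> gxy; have wxy : w x = w y by rewrite -wg gxy wg.
  case: (boolP (lis_e (w x))) => ex; first by right.
  by left; move: gxy; rewrite /g -wxy (negbTE ex).
have gE' x y : w x = w y -> lis_e (w x) -> g x = g y.
  move=> wxy ex; rewrite /g -wxy ex.
  by case: pickP => //= /(_ x); rewrite eqxx.
pose t x := widen_ord dm (g x).
have tE x y : t x = t y -> x = y \/ w x = w y /\ lis_e (w x).
  by move=> /(congr1 val)/= h; apply/gE/val_inj.
pose u : W := [ffun x => (b1 x, (w x).1.2, t x)].
pose v : W := [ffun x => (b2 x, t x, (w x).2)].
have uvw : wmul u v w.
  apply/wmulP => x; rewrite !ffunE /letter_mul /= eqxx bw.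
  by case: (w x) => -[].
have sep x y : t x = t y -> u x = u y /\ v x = v y.
  move=> txy; have := tE _ _ txy; case=> [->|[wxy ex]] //; rewrite !ffunE txy.
  have [e1 e2] := be _ ex; have [|e3 e4] := be y; first by rewrite -wxy.
  by rewrite e1 e2 e3 e4 wxy.
have eve x : lis_e (w x) -> ~~ lodd (u x) /\ ~~ lodd (v x).
  move=> ex; have [e1 e2] := be _ ex; rewrite /lodd !ffunE /= e1 e2.
  by move: ex; rewrite /lis_e; case: (w x).1.1.
have noc x : lis_e (w x) -> ~~ lis_c (u x) /\ ~~ lis_c (v x).
  move=> ex; have [e1 e2] := be _ ex; rewrite /lis_c !ffunE /= e1 e2.
  by move: ex; rewrite /lis_e; case: (w x).1.1.
have au : admissible u.
  apply/forallP => x; apply/forallP => y; apply/implyP => /andP[ne /eqP uxy].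
  have : t x = t y by have := congr1 snd uxy; rewrite !ffunE.
  by case/tE => [e|[_ /eve[]//]]; rewrite e eqxx in ne.
have av : admissible v.
  apply/forallP => x; apply/forallP => y; apply/implyP => /andP[ne /eqP vxy].
  have : t x = t y by have := congr1 (fun z => z.1.2) vxy; rewrite !ffunE.
  by case/tE => [e|[_ /eve[]//]]; rewrite e eqxx in ne.
have cu : cfact u = 1%N.
  rewrite cfactE; apply/eqP; rewrite -trivg_card1; apply/eqP/trivgP/subsetP => s.
  move=> /fibpermP h; rewrite inE; apply/eqP/permP => x; rewrite perm1.
  have [us nc] := h x; have : t (s x) = t x by have := congr1 snd us; rewrite !ffunE.
  by case/tE => [//|[wx]]; rewrite wx => /noc[/nc].
have cv : cfact v = 1%N.
  rewrite cfactE; apply/eqP; rewrite -trivg_card1; apply/eqP/trivgP/subsetP => s.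
  move=> /fibpermP h; rewrite inE; apply/eqP/permP => x; rewrite perm1.
  have [us nc] := h x; have : t (s x) = t x by have := congr1 (fun z => z.1.2) us; rewrite !ffunE.
  by case/tE => [//|[wx]]; rewrite wx => /noc[_ /nc].
exists u, v, (tens_sgn u v); split; last 4 first.
- exact: tens_sgn_sqr.
- by [].
- by move=> x; rewrite ffunE.
- by move=> x; rewrite ffunE.
apply: eta_mul_sep => //.
  by move=> x y h; apply: sep; move: h; rewrite !ffunE.
have -> : fibperm (fun x => (u x, v x)) predT = fibperm w (@lis_e n m).
  apply/setP => s; apply/fibpermP/fibpermP => h x; have [h1 h2] := h x; split=> //.
  - by case: h1 => e1 e2; have := wmulP _ _ _ uvw x; rewrite -e1 -e2 (wmulP _ _ _ uvw) => -[].
  - case: h1 => e1 _ ne; have : t (s x) = t x by have := congr1 snd e1; rewrite !ffunE.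
    by case/tE => [//|[wx]]; rewrite wx (negbTE ne).
  - case: (boolP (lis_e (w x))) => [ex|/h2->//].
    have : t (s x) = t x by rewrite /t; congr widen_ord; apply: gE'; rewrite h1.
    by case/sep => -> ->.
rewrite cfactE -card_fibperm_split => [|x]; last by rewrite /lis_e /lis_c; case: x => -[[]].
congr #|pred_of_set _|; apply/setP => s; apply/fibpermP/fibpermP => h x; have [h1 h2] := h x.
  split=> // ne; apply/eqP; apply: contraT => sx.
  have /forallP/(_ (s x))/forallP/(_ x) := aw; rewrite sx h1 eqxx /=.
  by move: ne; rewrite /lodd /= /lis_e /lis_c; case: (w x) => -[[]].
by split.
Qed.

Lemma adj_exists (j : 'I_n) : (1 < n)%N -> exists i : 'I_n, adj j i.
Proof.
move=> n1; have [j0|j0] := posnP j.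
  by exists (Ordinal n1); rewrite /adj j0.
have hj : (j.-1 < n)%N by apply: leq_ltn_trans (leq_pred _) (ltn_ord j).
by exists (Ordinal hj); rewrite /adj /= prednK // eqxx orbT.
Qed.

Lemma adjC (i j : 'I_n) : adj i j = adj j i.
Proof. by rewrite /adj orbC. Qed.

(** Words of degree at least 2 split into factors of positive degree: a letter c_j
    is a product of two arrows, and an arrow can be put in a different factor than
    another letter of positive degree. *)
Lemma eta_decomp w : (1 < n)%N -> (d <= m)%N -> admissible w -> (1 < word_deg w)%N ->
  exists u v c, [/\ eta u * eta v = eta w *~ c, c * c = 1, admissible u /\ admissible v,
    (0 < word_deg u)%N & (0 < word_deg v)%N].
Proof.
move=> n1 dm aw dw.
have [a ha] : exists a, ~~ lis_e (w a).
  apply/existsP; apply: contraLR dw; rewrite negb_exists -leqNgt => /forallP h.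
  rewrite /word_deg big1 // => x _; have := h x; rewrite negbK /lis_e.
  by case: (w x).1.1.
have deg_gt0 (v : W) x : (0 < zdeg (v x).1.1)%N -> (0 < word_deg v)%N.
  by move=> h; rewrite /word_deg (bigD1 x) //= ltn_addr.
pose tgt x : zz n := Ze (ztgt (w x).1.1).
have mul1z (b : zz n) : zz_mul (Ze (ztgt b)) b = Some b by rewrite /zz_mul /= eqxx.
have mulz1 (b : zz n) : zz_mul b (Ze (zsrc b)) = Some b.
  by rewrite /zz_mul /= eqxx; case: b.
have elim_e (b : zz n) : zis_e b -> Ze (ztgt b) = b by case: b.
have [c1 [c2 [cm cd1 cd2]]] : exists c1 c2 : zz n, [/\ zz_mul c1 c2 = Some (w a).1.1,
    (0 < zdeg c1)%N & (0 < zdeg c2)%N \/ exists2 x, x != a & (0 < zdeg (w x).1.1)%N].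
  case E : (w a).1.1 => [j|j|i j ij]; first by rewrite /lis_e E in ha.
    have [i ji] := adj_exists j n1; have ij : adj i j by rewrite adjC.
    by exists (Za ji), (Za ij); split=> //; rewrite ?/zz_mul /= ?eqxx //; left.
  exists (Za ij), (Ze j); split=> //.
  right; move: dw; rewrite /word_deg (bigD1 a) //= E /= ltnS lt0n sum_nat_eq0.
  by rewrite negb_forall => /existsP[x]; rewrite negb_imply => /andP[xa]; rewrite -lt0n; exists x.
pose b1 x := if x == a then c1 else tgt x.
pose b2 x := if x == a then c2 else (w x).1.1.
have [|x ex|u [v [c [e c2' auv hu hv]]]] := @eta_factor w b1 b2 dm aw.
- by move=> x; rewrite /b1 /b2; case: eqP => [->|_]; last exact: mul1z.
- rewrite /b1 /b2; case: eqP => [xa|_]; first by rewrite -xa ex in ha.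
  by rewrite /tgt elim_e.
exists u, v, c; split=> //; first by apply: (deg_gt0 u a); rewrite hu /b1 eqxx.
case: cd2 => [h|[x xa h]]; first by apply: (deg_gt0 v a); rewrite hv /b2 eqxx.
by apply: (deg_gt0 v x); rewrite hv /b2 (negbTE xa).
Qed.

End FactorWord.

(** * Sources and targets *)

Section Vertices.
Variables (n m d : nat).
Local Notation W := (word n m d).
Implicit Types (u v w : W) (s t : 'S_d).

Definition src_count w (j : 'I_n) := #|[set x | zsrc (w x).1.1 == j]|.
Definition tgt_count w (j : 'I_n) := #|[set x | ztgt (w x).1.1 == j]|.

Lemma src_count_act w s j : src_count (wact w s) j = src_count w j.
Proof.
rewrite /src_count -[RHS](card_preimset _ (@perm_inj _ s)).
by apply: eq_card => x; rewrite !inE ffunE.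
Qed.

Lemma tgt_count_act w s j : tgt_count (wact w s) j = tgt_count w j.
Proof.
rewrite /tgt_count -[RHS](card_preimset _ (@perm_inj _ s)).
by apply: eq_card => x; rewrite !inE ffunE.
Qed.

(** Letters multiply to zero unless the source of the first is the target of the
    second, and place permutations preserve the counts of vertices. *)
Lemma eta_mul_neq0 u v : eta u * eta v != 0 -> src_count u =1 tgt_count v.
Proof.
move=> nz j; apply/eqP; apply: contraTT nz => ne; rewrite negbK; apply/eqP/ffunP => w.
rewrite !ffunE big1 // => u' _; rewrite big1 // => v' uvw.
rewrite !etaE; case: same_orbitP => [[s us]|_]; last by rewrite mulr0 mul0r.
case: same_orbitP => [[t vt]|_]; last by rewrite mulr0.
case/eqP: ne; rewrite -(src_count_act u s) -(tgt_count_act v t) -us -vt.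
apply: eq_card => x; rewrite !inE; congr (_ == _).
have := wmulP _ _ _ uvw x; rewrite /letter_mul; case: ifP => // _.
by rewrite /zz_mul; case: (zsrc _ =P ztgt _) => [->|].
Qed.

End Vertices.

Section TZK.
Variables (k : fieldType) (n m d : nat).
Local Notation W := (word n m d).
Local Notation TK := (tzschur k n m d).
Local Notation I := (rep_word n m d).
Implicit Types (u v w : W) (x y : TK) (o : I).

Lemma rep_adm o : admissible (val o).
Proof. by have /andP[] := rep_wordP o. Qed.

Lemma tz_etaM w w' : admissible w -> admissible w' ->
  tz_eta k w * tz_eta k w' = tz_base k (eta w * eta w').
Proof. by move=> aw aw'; rewrite tz_baseM //; apply: TZc_eta. Qed.

Lemma tz_baseZ (z : tens n m d) (c : int) : TZc z -> tz_base k (z *~ c) = c%:~R *: tz_base k z.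
Proof.
move=> hz; have := @tz_base_sum k n m d 'I_1 (fun=> c) (fun=> z) (fun=> hz).
by rewrite !big_ord1.
Qed.

Lemma tz_scalE c x : tz_scal n m d c * x = c *: x.
Proof. by rewrite /tz_scal [LHS]tz_mulZl; congr (_ *: _); apply: mul1r. Qed.

Lemma tz_scalC c x : x * tz_scal n m d c = c *: x.
Proof. by rewrite /tz_scal [LHS]tz_mulZr; congr (_ *: _); apply: mulr1. Qed.

Lemma tz_act_expand (V : lmodType TK) x (v : V) :
  x *: v = \sum_o @tz_scal k n m d (x o) *: (tz_eta k (val o) *: v).
Proof.
rewrite {1}(tz_expand x) scaler_suml; apply: eq_bigr => o _.
by rewrite scalerA tz_scalE.
Qed.

Lemma tz_eta_decomp w : (1 < n)%N -> (d <= m)%N -> admissible w -> (1 < word_deg w)%N ->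
  exists u v c, [/\ tz_eta k w = tz_scal n m d c * (tz_eta k u * tz_eta k v),
    admissible u, admissible v, (0 < word_deg u)%N & (0 < word_deg v)%N].
Proof.
move=> n1 dm aw dw; have [u [v [c [e cc [au av] du dv]]]] := eta_decomp n1 dm aw dw.
exists u, v, c%:~R; split=> //; rewrite tz_etaM // e tz_baseZ; last exact: TZc_eta.
by rewrite tz_scalE scalerA -intrM cc scale1r.
Qed.

Lemma cfact_one w : [forall x, letter_one (w x)] -> cfact w = 1%N.
Proof.
move=> h; have /andP[_ /forallP/(_ w)] := TZc1 n m d.
by rewrite ffunE h dvdz1 absz_nat => /eqP.
Qed.

Lemma tz_one_expand : 1 = \sum_(o : I | [forall x, letter_one (val o x)]) tz_eta k (val o) :> TK.
Proof.
rewrite [LHS]tz_expand [RHS]big_mkcond; apply: eq_bigr => o _.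
rewrite [_ o]ffunE /tzcoef ffunE; case: (boolP [forall x, _]) => h; last first.
  by rewrite div0z scale0r.
by rewrite cfact_one // divzz scale1r.
Qed.

End TZK.

(** * Coefficients in degree 0 *)

Section DegreeZero.
Variables (k : fieldType) (n m d : nat).
Local Notation W := (word n m d).
Local Notation TK := (tzschur k n m d).
Local Notation I := (rep_word n m d).
Implicit Types (u v w : W) (x y : TK) (o : I) (b : {ffun 'I_d -> 'I_n}) (r s t : mword m d).

Definition ew b r s : W := [ffun i => (Ze (b i), r i, s i)].

Lemma ew_odd b r s i : lodd (ew b r s i) = false.
Proof. by rewrite ffunE. Qed.

Lemma ew_adm b r s : admissible (ew b r s).
Proof.
by apply/forallP => i; apply/forallP => j; rewrite ew_odd implybT.
Qed.

Lemma ew_cfact b r s : cfact (ew b r s) = 1%N.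
Proof.
rewrite cfactE; apply/eqP; rewrite -trivg_card1; apply/eqP/trivgP/subsetP => g.
move=> /fibpermP h; rewrite inE; apply/eqP/permP => x; rewrite perm1.
by have [_] := h x; apply; rewrite ffunE.
Qed.

Lemma wact_ew b r s (g : 'S_d) : wact (ew b r s) g = ew [ffun i => b (g i)] (mwact r g) (mwact s g).
Proof. by apply/ffunP => i; rewrite !ffunE. Qed.

Lemma ew_winv b r s : winv (ew b r s) = 0%N.
Proof.
by apply/eqP; rewrite cards_eq0; apply/eqP/setP => kl; rewrite !inE ew_odd /= andbF.
Qed.

Lemma ewP w : (forall i, lis_e (w i)) -> exists b r s, w = ew b r s.
Proof.
move=> h; exists [ffun i => ztgt (w i).1.1], [ffun i => (w i).1.2], [ffun i => (w i).2].
by apply/ffunP => i; rewrite !ffunE; have := h i; rewrite /lis_e; case: (w i) => -[[]].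
Qed.

Lemma same_orbit_sym w w' : same_orbit w w' = same_orbit w' w.
Proof.
by apply/same_orbitP/same_orbitP => -[g ->]; exists g^-1%g; rewrite wactK.
Qed.

Lemma eta_ew w b r s : eta w (ew b r s) = (same_orbit w (ew b r s))%:R.
Proof.
rewrite etaE; case: ifP => //; rewrite same_orbit_sym => /same_orbitP[g ->].
by rewrite cfact_act ew_cfact wact_ew !ew_winv mul1r.
Qed.

(** The coefficients of x at the pure tensors of matrix units with values e_j *)
Definition ev x b r s : k := \sum_o x o * (same_orbit (val o) (ew b r s))%:R.

Lemma evD x y b r s : ev (x + y) b r s = ev x b r s + ev y b r s.
Proof. by rewrite /ev -big_split; apply: eq_bigr => o _; rewrite ffunE mulrDl. Qed.

Lemma evZ c x b r s : ev (c *: x) b r s = c * ev x b r s.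
Proof. by rewrite /ev mulr_sumr; apply: eq_bigr => o _; rewrite ffunE mulrA. Qed.

Lemma ev0 b r s : ev 0 b r s = 0.
Proof. by rewrite /ev big1 // => o _; rewrite ffunE mul0r. Qed.

Lemma ev_sum (J : finType) (P : pred J) (F : J -> TK) b r s :
  ev (\sum_(j | P j) F j) b r s = \sum_(j | P j) ev (F j) b r s.
Proof. by apply: (big_morph (fun x => ev x b r s)) => [x y|]; rewrite ?evD ?ev0. Qed.

Lemma evB x y b r s : ev (x - y) b r s = ev x b r s - ev y b r s.
Proof. by rewrite evD -scaleN1r evZ mulN1r. Qed.

Lemma ev_base z b r s : TZc z -> ev (tz_base k z) b r s = (z (ew b r s))%:~R.
Proof.
move=> hz; rewrite [in RHS](TZ_expand_rep hz) sum_ffunE rmorph_sum; apply: eq_bigr => o _ /=.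
by rewrite ffunE tens_mulrzE eta_ew rmorphM /= mulrC natz; case: same_orbit.
Qed.

Lemma ev_eta w b r s : admissible w -> ev (tz_eta k w) b r s = (same_orbit w (ew b r s))%:R.
Proof. by move=> aw; rewrite ev_base ?eta_ew; [case: same_orbit | apply: TZc_eta]. Qed.

(** A product of two letters is some e_j only if both are that e_j, so that the
    degree 0 coefficients multiply like matrices. *)
Lemma ev_etaM w w' b r s : admissible w -> admissible w' ->
  ev (tz_eta k w * tz_eta k w') b r s = \sum_t ev (tz_eta k w) b r t * ev (tz_eta k w') b t s.
Proof.
move=> aw aw'; rewrite tz_etaM // ev_base; last by apply: TZcM; apply: TZc_eta.
have letter_mul_e (x y : letter n m) j (p q : 'I_m) : letter_mul x y = Some (Ze j, p, q) ->
    x = (Ze j, p, x.2) /\ y = (Ze j, x.2, q).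
  case: x y => -[bx rx] sx [[by_ ry] sy]; rewrite /letter_mul /zz_mul /=.
  case: (sx =P ry) => // ->.
  by case: bx => [?|?|???]; case: by_ => [?|?|???] //=; case: eqP => //= ?;
    try (case: eqP => //= _); case=> *; subst.
have sgn1 t : tens_sgn (ew b r t) (ew b t s) = 1.
  rewrite /tens_sgn sgn_pairsE -[RHS](expr0 (-1)) -[0%N]/(nat_of_bool false).
  by rewrite -(xpairs0 d); congr (_ ^+ nat_of_bool _); apply: eq_xpairs => i j _; rewrite ew_odd.
have wm t : wmul (ew b r t) (ew b t s) (ew b r s).
  by apply/wmulP => i; rewrite !ffunE /letter_mul /zz_mul /= !eqxx.
rewrite ffunE rmorph_sum /=.
transitivity (\sum_(u | u \in codom (fun t => ew b r t))
    \sum_(v | wmul u v (ew b r s)) (tens_sgn u v * eta w u * eta w' v)%:~R : k).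
  rewrite [RHS]big_mkcond; apply: eq_bigr => u _; rewrite rmorph_sum.
  case: ifP => // uc; rewrite big1 // => v /wmulP uv; case/negP: uc.
  apply/codomP; exists [ffun i => (u i).2]; apply/ffunP => i; rewrite !ffunE.
  by have := uv i; rewrite ffunE => /letter_mul_e[].
rewrite -big_uniq /=; last first.
  rewrite /codom /image_mem map_inj_uniq ?enum_uniq // => t t' /ffunP h; apply/ffunP => i.
  by have := congr1 snd (h i); rewrite !ffunE.
rewrite big_image; apply: eq_bigr => t _ /=.
rewrite (big_pred1 (ew b t s)).
  by rewrite !ev_eta // sgn1 mul1r !eta_ew intrM; do 2!case: same_orbit.
move=> v /=; apply/idP/eqP => [/wmulP uv|->]; last exact: wm.
apply/ffunP => i; have := uv i; rewrite !ffunE => /letter_mul_e[_ ->].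
by [].
Qed.

Lemma ev_mulZZ a c x y b r s : ev (a *: x * (c *: y)) b r s = a * c * ev (x * y) b r s.
Proof.
rewrite [_ * _ in LHS]tz_mulZl evZ [tz_mul _ _ in LHS]tz_mulZr evZ mulrA.
by [].
Qed.

Lemma evM x y b r s : ev (x * y) b r s = \sum_t ev x b r t * ev y b t s.
Proof.
rewrite {1}(tz_expand x) {1}(tz_expand y) mulr_suml ev_sum.
under eq_bigr => o _ do rewrite mulr_sumr ev_sum.
rewrite [x in RHS](tz_expand x).
under [RHS]eq_bigr => t _ do rewrite ev_sum mulr_suml.
rewrite [RHS]exchange_big; apply: eq_bigr => o _ /=.
rewrite [y in RHS](tz_expand y).
under [RHS]eq_bigr => t _ do rewrite ev_sum mulr_sumr.
rewrite [RHS]exchange_big; apply: eq_bigr => o' _ /=.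
apply: etrans (ev_mulZZ _ _ _ _ _ _ _) _; rewrite ev_etaM ?rep_adm // mulr_sumr.
by apply: eq_bigr => t _; rewrite !evZ -!mulrA; congr (_ * _); rewrite mulrCA.
Qed.

Lemma ev1 b r s : ev 1 b r s = (r == s)%:R.
Proof.
rewrite ev_base ?TZc1 // ffunE.
rewrite (_ : [forall i, _] = (r == s)); first by case: eqP.
apply/forallP/eqP => [h|-> i]; last by rewrite ffunE /letter_one /= eqxx.
by apply/ffunP => i; have := h i; rewrite ffunE /letter_one /= => /eqP.
Qed.

Lemma ew_rep b r s : exists o, same_orbit (val o) (ew b r s).
Proof.
have [g hg] := exists_rep (ew_adm b r s).
by exists (Sub (wact (ew b r s) g) hg); rewrite SubK same_orbit_sym; apply/same_orbitP; exists g.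
Qed.

Lemma ev_rep x o b r s : same_orbit (val o) (ew b r s) -> ev x b r s = x o.
Proof.
move=> so; rewrite /ev (bigD1 o) //= so mulr1 big1 ?addr0 // => o' ne.
case: (boolP (same_orbit _ _)) => [h|_]; last by rewrite mulr0.
case/eqP: ne; apply/val_inj/esym/(rep_uniq (rep_wordP o) (rep_wordP o')).
have [g eg] := same_orbitP _ _ so; have [g' eg'] := same_orbitP _ _ h.
by apply/same_orbitP; exists (g'^-1 * g)%g; rewrite wactM -eg eg' wactK.
Qed.

End DegreeZero.

(** * Blocks of positions *)

Section Blocks.
Variables (n m d : nat) (dd : 'I_n -> nat).
Hypothesis sum_dd : (\sum_j dd j)%N = d.
Local Notation P := {j : 'I_n & 'I_(dd j)}.

Fact card_blocks : #|{: P}| = d.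
Proof.
rewrite card_tagged sumnE big_map big_enum -sum_dd.
by apply: eq_bigr => j _; rewrite card_ord.
Qed.

(** The positions 1, ..., d, cut into consecutive blocks of sizes dd j *)
Definition blk (x : 'I_d) : P := enum_val (cast_ord (esym card_blocks) x).
Definition pos (u : P) : 'I_d := cast_ord card_blocks (enum_rank u).

Lemma blkK : cancel blk pos.
Proof. by move=> x; rewrite /pos /blk enum_valK cast_ordKV. Qed.

Lemma posK : cancel pos blk.
Proof. by move=> u; rewrite /pos /blk cast_ordK enum_rankK. Qed.

Definition posj j (a : 'I_(dd j)) : 'I_d := pos (Tagged (fun j => 'I_(dd j)) a).

Lemma posj_inj j : injective (@posj j).
Proof.
move=> a a' /(can_inj posK) h.
by have := @eq_Tagged _ _ (Tagged (fun j => 'I_(dd j)) a) a'; rewrite -h eqxx => /esym/eqP.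
Qed.

(** The standard word of vertices: the vertex j fills the block j. *)
Definition b0 : {ffun 'I_d -> 'I_n} := [ffun x => tag (blk x)].

Lemma b0_posj j a : b0 (@posj j a) = j.
Proof. by rewrite ffunE posK. Qed.

Lemma posj_ex x : exists a, x = @posj (b0 x) a.
Proof.
rewrite ffunE; exists (tagged (blk x)); rewrite -[LHS]blkK /posj.
by case: (blk x).
Qed.

Definition catw (r : forall j, mword m (dd j)) : mword m d :=
  [ffun x => r (tag (blk x)) (tagged (blk x))].
Definition restr j (r : mword m d) : mword m (dd j) := [ffun a => r (posj a)].

Lemma restr_cat r j : restr j (catw r) = r j.
Proof. by apply/ffunP => a; rewrite !ffunE posK. Qed.

Lemma cat_restr r : catw (fun j => restr j r) = r.
Proof.
apply/ffunP => x; rewrite !ffunE; congr (r _); rewrite -[RHS]blkK /posj.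
by case: (blk x).
Qed.

Lemma econcatP r q (w : word n m d) : codom w = econcat r q <-> w = ew b0 (catw r) (catw q).
Proof.
have blkE : [seq blk x | x <- enum 'I_d] = enum {: P}.
  have sz : size [seq blk x | x <- enum 'I_d] = size (enum {: P}).
    by rewrite size_map -!cardE card_ord card_blocks.
  case E : (enum {: P}) => [|u0 s0]; first by move: sz; rewrite E => /size0nil.
  rewrite -E.
  apply: (@eq_from_nth _ u0) => // i; rewrite size_map size_enum_ord => id.
  rewrite (nth_map (Ordinal id)) ?size_enum_ord // -[i in nth _ (enum 'I_d) i]/(val (Ordinal id)).
  by rewrite nth_ord_enum /blk (enum_val_nth u0).
have cE : codom (ew b0 (catw r) (catw q)) = econcat r q.
  rewrite /econcat.
  have -> : codom (ew b0 (catw r) (catw q)) =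
      [seq (Ze (tag u), r (tag u) (tagged u), q (tag u) (tagged u)) | u <- enum {: P}].
    by rewrite -blkE -map_comp codomE; apply: eq_map => x; rewrite /= !ffunE.
  rewrite enumT unlock /= /tag_enum map_flatten; congr flatten.
  rewrite -map_comp -enumT; apply: eq_map => j /=.
  by rewrite -map_comp -enumT; apply: eq_map => a.
split=> [h|-> //]; apply: (can_inj fgraphK); apply: val_inj.
by rewrite /= -!codom_ffun h cE.
Qed.

Lemma block_perm (g : 'S_d) : (forall x, b0 (g x) = b0 x) ->
  exists h : forall j, 'S_(dd j), forall r j, restr j (mwact r g) = mwact (restr j r) (h j).
Proof.
move=> hg.
have H j : exists h : 'S_(dd j), forall r, restr j (mwact r g) = mwact (restr j r) h.
  have /fin_all_exists[f hf] (a : 'I_(dd j)) : exists a' : 'I_(dd j), g (posj a) = posj a'.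
    by have := posj_ex (g (posj a)); rewrite hg b0_posj.
  have finj : injective f.
    by move=> a a' /(congr1 (@posj j)); rewrite -!hf => /perm_inj/posj_inj.
  by exists (perm finj) => r; apply/ffunP => a; rewrite !ffunE permE hf.
by have [h hh] := fin_all_exists H; exists h => r j; apply: hh.
Qed.

Lemma block_perm_glue (h : forall j, 'S_(dd j)) :
  exists g : 'S_d, (forall x, b0 (g x) = b0 x) /\
    forall r j, restr j (mwact r g) = mwact (restr j r) (h j).
Proof.
pose f x := posj (h (tag (blk x)) (tagged (blk x))).
have fpos j a : f (@posj j a) = posj (h j a) by rewrite /f posK.
have finj : injective f.
  move=> x x'; have [a ea] := posj_ex x; have [a' ea'] := posj_ex x'.
  move: a a' ea ea'; have e : f x = f x' -> b0 x = b0 x'.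
    by move/(congr1 b0); rewrite !b0_posj !ffunE.
  move=> a a' ea ea' ff; move: a ea a' ea'; rewrite (e ff); move: (b0 x') => j a ea a' ea'.
  by move: ff; rewrite ea ea' !fpos => /posj_inj/perm_inj ->.
exists (perm finj); split=> [x|r j]; first by rewrite permE b0_posj ffunE.
by apply/ffunP => a; rewrite !ffunE permE fpos.
Qed.

(** A word of length d is a family of words on the blocks. *)
Lemma sum_prod_restr (k : comPzRingType) (F : forall j, mword m (dd j) -> k) :
  \sum_(q : mword m d) \prod_j F j (restr j q) = \prod_j \sum_q F j q.
Proof.
pose P_ j : {ffun mword m (dd j) -> k} := [ffun q => F j q].
transitivity (\sum_(t : fprod (fun j => mword m (dd j))) \prod_(j in 'I_n) P_ j (t j)).
  pose h (q : mword m d) : fprod (fun j => mword m (dd j)) := fprod_of_fun (fun j => restr j q).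
  rewrite [RHS](reindex h) /=; last first.
    exists (fun t => catw (fun j => t j)) => [q _|t _].
      rewrite -[RHS]cat_restr; congr catw.
      by apply: functional_extensionality_dep => j; rewrite fprodE.
    by apply/fprodP => j; rewrite fprodE restr_cat.
  by apply: eq_bigr => q _; apply: eq_bigr => j _; rewrite fprodE ffunE.
pose T_ (j : 'I_n) : finType := mword m (dd j).
rewrite big_fprod; apply: etrans (esym (bigA_distr_big_dep (fun j => tagged_with T_ j)
  (fun j u => untag 0 (P_ j) u))) _.
apply: eq_bigr => j _.
have E : \sum_(q : T_ j) P_ j q = \sum_(u in tagged_with T_ j) untag 0 (P_ j) u.
  have := @big_tag k 0 +%R 'I_n T_ (fun j (q : T_ j) => P_ j q) j.
  by [].
by apply: etrans (esym E) _; apply: eq_bigr => q _; rewrite ffunE.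
Qed.

End Blocks.

(** * The degree 0 part as a tensor product of Schur algebras *)

Section Theta.
Variables (k : fieldType) (n m d : nat) (dd : 'I_n -> nat).
Hypothesis sum_dd : (\sum_j dd j)%N = d.
Local Notation TK := (tzschur k n m d).
Local Notation fam := (forall j, schur k m (dd j)).
Local Notation b0 := (b0 sum_dd).
Local Notation restr := (restr sum_dd).
Local Notation catw := (catw sum_dd).
Implicit Types (s : fam) (r t q : mword m d) (X Y : TK).

(** The matrix, on the words of length d, of the outer tensor product of the
    elements s j of the Schur algebras of the blocks *)
Definition Theta s r t : k := \prod_j sent (s j) (restr j r) (restr j t).

Lemma ThetaM s s' r t : \sum_q Theta s r q * Theta s' q t = Theta (fun j => s j * s' j) r t.
Proof.
under eq_bigr => q _ do rewrite /Theta -big_split.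
rewrite (sum_prod_restr sum_dd (fun j p => sent (s j) (restr j r) p * sent (s' j) p (restr j t))).
by apply: eq_bigr => j _; rewrite sentM.
Qed.

Lemma restr_inj r t : (forall j, restr j r = restr j t) -> r = t.
Proof.
move=> h; rewrite -(cat_restr sum_dd r) -(cat_restr sum_dd t); congr catw.
exact: functional_extensionality_dep.
Qed.

Lemma Theta1 r t : Theta (fun=> 1) r t = (r == t)%:R.
Proof.
rewrite /Theta; under eq_bigr => j _ do rewrite sent1.
have [->|ne] := eqVneq r t; first by rewrite big1 // => j _; rewrite eqxx.
have /existsP[j nj] : [exists j, restr j r != restr j t].
  apply: contraR ne; rewrite negb_exists => /forallP h; apply/eqP/restr_inj => j.
  by have := h j; rewrite negbK => /eqP.
by rewrite (bigD1 j) //= (negbTE nj) mul0r.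
Qed.

Lemma Theta_act s (g : 'S_d) r t : (forall x, b0 (g x) = b0 x) ->
  Theta s (mwact r g) (mwact t g) = Theta s r t.
Proof.
move=> /block_perm-/(_ m)[h hE]; apply: eq_bigr => j _.
by rewrite !hE sent_act.
Qed.

Lemma Theta_xi (r0 q0 : forall j, mword m (dd j)) r t :
  Theta (fun j => schur_xi k (r0 j) (q0 j)) r t =
  (same_orbit (ew b0 (catw r0) (catw q0)) (ew b0 r t))%:R.
Proof.
rewrite /Theta; under eq_bigr => j _ do rewrite sent_xi.
have -> : (same_orbit (ew b0 (catw r0) (catw q0)) (ew b0 r t)) =
    [forall j, orb2 (r0 j, q0 j) (restr j r, restr j t)].
  apply/same_orbitP/forallP => [[g]|h].
    rewrite wact_ew => /ffunP hg.
    have gb x : b0 (g x) = b0 x by have := hg x; rewrite !ffunE => -[].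
    have -> : r = mwact (catw r0) g by apply/ffunP => x; have := hg x; rewrite !ffunE => -[].
    have -> : t = mwact (catw q0) g by apply/ffunP => x; have := hg x; rewrite !ffunE => -[].
    have [h hE] := block_perm m gb.
    by move=> j; apply/orb2P; exists (h j); rewrite !hE !restr_cat.
  have /fin_all_exists[f hf] j : exists g : 'S_(dd j),
      (restr j r, restr j t) = (mwact (r0 j) g, mwact (q0 j) g).
    exact: (orb2P _ _ (h j)).
  have [g [gb gE]] := block_perm_glue m sum_dd f.
  exists g; rewrite wact_ew; congr ew; first by apply/ffunP => x; rewrite [RHS]ffunE gb.
    by apply: restr_inj => j; rewrite gE restr_cat; case: (hf j).
  by apply: restr_inj => j; rewrite gE restr_cat; case: (hf j).
case: (boolP [forall j, _]) => [/forallP h|]; first by rewrite big1 // => j _; rewrite h.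
by rewrite negb_forall => /existsP[j nj]; rewrite (bigD1 j) //= (negbTE nj) mul0r.
Qed.

(** The coefficient at o is read off any rearrangement of o whose word of vertices
    is standard; [Theta s] is invariant under the permutations that relate two
    such rearrangements. *)
Definition theta_coef s (o : rep_word n m d) : k :=
  if [pick g : 'S_d | [forall i, (wact (val o) g i).1.1 == Ze (b0 i)]] is Some g
  then Theta s [ffun i => (wact (val o) g i).1.2] [ffun i => (wact (val o) g i).2]
  else 0.

(** The element of degree 0 with block matrix [Theta s] *)
Definition theta s : TK := [ffun o : rep_word n m d => theta_coef s o : k^o].

(** The component of the degree 0 part of X in the summand of composition dd *)
Definition Phi X r t : k := ev X b0 r t.

Lemma Phi_theta s r t : Phi (theta s) r t = Theta s r t.
Proof.
have [o ho] := ew_rep b0 r t; rewrite /Phi (ev_rep _ ho) ffunE /theta_coef.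
have [g eg] := same_orbitP _ _ ho.
have oE : val o = wact (ew b0 r t) g^-1%g by rewrite eg wactK.
case: pickP => [g' /forallP hg'|/(_ g)/forallP[] i]; last by rewrite -eg ffunE.
rewrite oE -wactM wact_ew; set g2 := (g' * g^-1)%g.
have gb x : b0 (g2 x) = b0 x.
  have := hg' x; rewrite oE -wactM wact_ew ffunE /= ffunE => /eqP[] //.
rewrite -(Theta_act s r t gb); congr Theta; by apply/ffunP => i; rewrite !ffunE.
Qed.

Lemma ev_theta_off s (b : {ffun 'I_d -> 'I_n}) r t :
  (forall g : 'S_d, exists i, b (g i) != b0 i) -> ev (theta s) b r t = 0.
Proof.
move=> hb; have [o ho] := ew_rep b r t; rewrite (ev_rep _ ho) ffunE /theta_coef.
case: pickP => // g /forallP hg; have [g' eg] := same_orbitP _ _ ho.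
have oE : val o = wact (ew b r t) g'^-1%g by rewrite eg wactK.
have [i /eqP[]] := hb (g * g'^-1)%g.
by have := hg i; rewrite oE -wactM wact_ew ffunE /= ffunE => /eqP[].
Qed.

Lemma Phi_D X Y r t : Phi (X + Y) r t = Phi X r t + Phi Y r t. Proof. exact: evD. Qed.
Lemma Phi_B X Y r t : Phi (X - Y) r t = Phi X r t - Phi Y r t. Proof. exact: evB. Qed.
Lemma Phi_Z c X r t : Phi (c *: X) r t = c * Phi X r t. Proof. exact: evZ. Qed.
Lemma Phi_M X Y r t : Phi (X * Y) r t = \sum_q Phi X r q * Phi Y q t. Proof. exact: evM. Qed.
Lemma Phi_1 r t : Phi 1 r t = (r == t)%:R. Proof. exact: ev1. Qed.

End Theta.

(** * Modules over a summand of the degree 0 part *)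

Section Families.
Variables (k : fieldType) (n m : nat) (dd : 'I_n -> nat).
Local Notation fam := (forall j, schur k m (dd j)).

Definition upd (T : 'I_n -> Type) (s : forall j, T j) j (a : T j) : forall j, T j :=
  @dfwith _ _ s j a.

Lemma upd_in (T : 'I_n -> Type) (s : forall j, T j) j (a : T j) : upd s a j = a.
Proof. exact: dfwith_in. Qed.

Lemma upd_out (T : 'I_n -> Type) (s : forall j, T j) j (a : T j) i : i != j -> upd s a i = s i.
Proof. by move=> ij; rewrite /upd dfwith_out // eq_sym. Qed.

Lemma upd_same (T : 'I_n -> Type) (s : forall j, T j) j : upd s (s j) = s.
Proof.
apply: functional_extensionality_dep => i; have [->|ij] := eqVneq i j; first exact: upd_in.
exact: upd_out.
Qed.

Lemma upd_upd (T : 'I_n -> Type) (s : forall j, T j) j (a b : T j) : upd (upd s a) b = upd s b.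
Proof.
apply: functional_extensionality_dep => i; have [->|ij] := eqVneq i j; first by rewrite !upd_in.
by rewrite !upd_out.
Qed.

(** Multilinear statements about families of elements of Schur algebras need only
    be checked on families of basis elements. *)
Lemma fam_ind (Q : fam -> Prop) :
  (forall r q : forall j, mword m (dd j), Q (fun j => schur_xi k (r j) (q j))) ->
  (forall s j, Q (@upd (fun j => schur k m (dd j)) s j 0)) ->
  (forall s j c (a b : schur k m (dd j)),
     Q (@upd (fun j => schur k m (dd j)) s j a) -> Q (@upd (fun j => schur k m (dd j)) s j b) ->
     Q (@upd (fun j => schur k m (dd j)) s j (c *: a + b))) ->
  forall s, Q s.
Proof.
move=> Qxi Q0 QD.
have main (l : seq 'I_n) : forall s : fam,
    (forall j, j \notin l -> exists x, s j = schur_xi k x.1 x.2) -> Q s.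
  elim: l => [|j l IH] s hs.
    have /fin_all_exists[x hx] j : exists x, s j = schur_xi k x.1 x.2 by apply: hs.
    have -> : s = fun j => schur_xi k (x j).1 (x j).2 by apply: functional_extensionality_dep.
    exact: (Qxi (fun j => (x j).1) (fun j => (x j).2)).
  rewrite -(upd_same s j) [s j]schur_expand.
  elim/big_rec: _ => [|x y _ Qy]; first exact: Q0.
  apply: QD => //; apply: IH => i il; have [->|ij] := eqVneq i j.
    by exists x; rewrite upd_in.
  by rewrite upd_out //; apply: hs; rewrite inE negb_or ij.
by move=> s; apply: (main (enum 'I_n)) => j; rewrite mem_enum.
Qed.

End Families.

Section BlockModules.
Variables (k : fieldType) (n m d : nat) (dd : 'I_n -> nat).
Hypothesis sum_dd : (\sum_j dd j)%N = d.
Local Notation TK := (tzschur k n m d).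
Local Notation fam := (forall j, schur k m (dd j)).
Local Notation b0 := (b0 sum_dd).
Local Notation restr := (restr sum_dd).
Local Notation catw := (catw sum_dd).
Local Notation theta := (theta sum_dd).
Implicit Types (s : fam) (r t q : mword m d) (X Y : TK) (w : word n m d).

Definition e_count w (j : 'I_n) : nat := #|[set a | (w a).1.1 == Ze j]|.

Lemma b0_count j : #|[set a | b0 a == j]| = dd j.
Proof.
rewrite -[RHS]card_ord -(card_imset _ (@posj_inj _ _ _ sum_dd j)).
apply: eq_card => x; rewrite !inE; apply/eqP/imsetP => [<-|[a _ ->]]; last exact: b0_posj.
by have [a ea] := posj_ex sum_dd x; exists a.
Qed.

(** As the dd j add up to d, such a word has no letters other than the e_j. *)
Lemma e_countP w : (forall j, e_count w j = dd j) -> exists r t, same_orbit w (ew b0 r t).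
Proof.
move=> h.
have we a : lis_e (w a).
  have : #|[set a | lis_e (w a)]| = d.
    apply: etrans sum_dd; rewrite -(eq_bigr _ (fun j _ => h j)) -sum1_card.
    rewrite (partition_big (fun a => ztgt (w a).1.1) xpredT) //=; apply: eq_bigr => j _.
    rewrite /e_count -sum1_card; apply: eq_bigl => x; rewrite !inE /lis_e.
    by case: (w x).1.1 => //= i; rewrite andbC.
  move=> e; have /subset_cardP/(_ (subsetT _)) := etrans e (esym (etrans (cardsT _) (card_ord d))).
  by move/(_ a); rewrite !inE.
have [b [r [t wE]]] := ewP we.
have [|g hg] := @perm_eq_word _ _ b0 b.
  apply/allP => j _ /=; apply/eqP.
  have cE (f : {ffun 'I_d -> 'I_n}) : count_mem j [seq f a | a <- enum 'I_d] = #|[set a | f a == j]|.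
    by rewrite count_map cardsE cardE size_filter enumT.
  rewrite !cE b0_count -h; apply: eq_card => a; rewrite !inE wE ffunE /=.
  by apply/eqP/eqP => [[]|->].
exists (mwact r g), (mwact t g); apply/same_orbitP; exists g; rewrite wE wact_ew.
by congr ew; apply/ffunP => a; rewrite [RHS]ffunE hg.
Qed.

(** The modules over the image of [Phi]: elements of positive degree act by zero,
    and the idempotent of the composition dd acts as the identity. *)
Definition block_module (V : lmodType TK) : Prop :=
  forall X, (forall r t, Phi sum_dd X r t = 0) -> forall v : V, X *: v = 0.

Lemma block_moduleP (V : lmodType TK) :
  (forall w, admissible w -> (exists j, e_count w j != dd j) -> forall v : V, tz_eta k w *: v = 0) ->
  block_module V.
Proof.
move=> h X X0 v; rewrite tz_act_expand big1 // => o _.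
have [/existsP hj|] := boolP [exists j, e_count (val o) j != dd j].
  by rewrite h ?scaler0 //; apply: rep_adm.
rewrite negb_exists => /forallP hj.
have [|r [t hrt]] := @e_countP (val o); first by move=> j; have := hj j; rewrite negbK => /eqP.
by have := X0 r t; rewrite /tz_scal /Phi (ev_rep _ hrt) => ->; rewrite scale0r scale0r.
Qed.

Section Theory.
Variables (V : lmodType TK) (bV : block_module V).

Lemma block_eq X Y (v : V) : (forall r t, Phi sum_dd X r t = Phi sum_dd Y r t) -> X *: v = Y *: v.
Proof.
move=> h; apply/eqP; rewrite -subr_eq0 -scalerBl bV // => r t.
by rewrite Phi_B h subrr.
Qed.

Lemma theta_theta s s' (v : V) : theta s *: (theta s' *: v) = theta (fun j => s j * s' j) *: v.
Proof.
rewrite scalerA; apply: block_eq => r t; rewrite Phi_M Phi_theta -ThetaM.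
by apply: eq_bigr => q _; rewrite !Phi_theta.
Qed.

Lemma theta1 (v : V) : theta (fun=> 1) *: v = v.
Proof.
rewrite -[RHS]scale1r; apply: block_eq => r t.
by rewrite Phi_theta Theta1 Phi_1.
Qed.

End Theory.

Lemma Theta_upd s j (a : schur k m (dd j)) r t :
  Theta sum_dd (@upd _ (fun j => schur k m (dd j)) s j a) r t =
  sent a (restr j r) (restr j t) * \prod_(i | i != j) sent (s i) (restr i r) (restr i t).
Proof.
rewrite /Theta (bigD1 j) //= upd_in; congr (_ * _).
by apply: eq_bigr => i ij; rewrite upd_out.
Qed.

(** The image of [Phi] is spanned by the matrices [Theta s]. *)
Lemma Phi_ind (Q : TK -> Prop) :
  (forall X Y, (forall r t, Phi sum_dd X r t = Phi sum_dd Y r t) -> Q X -> Q Y) ->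
  (forall c X Y, Q X -> Q Y -> Q (c *: X + Y)) -> (forall s, Q (theta s)) ->
  forall X, Q X.
Proof.
move=> Qeq Qlin Qt X.
have Q0 : Q 0.
  have := Qlin (-1) _ _ (Qt (fun=> 0)) (Qt (fun=> 0)).
  by rewrite scaleN1r addNr.
rewrite (tz_expand X); elim/big_rec: _ => // o Y _ QY; apply: Qlin => //.
case: (boolP [forall j, e_count (val o) j == dd j]) => [/forallP h|nh].
  have [r [t ho]] := e_countP (fun j => eqP (h j)).
  apply: Qeq (Qt (fun j => schur_xi k (restr j r) (restr j t))) => r' t'.
  rewrite Phi_theta Theta_xi !cat_restr /Phi ev_eta ?rep_adm //.
  congr (nat_of_bool _)%:R; have [g eg] := same_orbitP _ _ ho.
  by rewrite eg; apply/idP/idP => /same_orbitP[g' ->]; apply/same_orbitP;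
    [exists (g' * g)%g; rewrite wactM | exists (g' * g^-1)%g; rewrite wactM wactK].
apply: Qeq Q0 => r t; rewrite /Phi ev0 ev_eta ?rep_adm //.
case: same_orbitP => // -[g eg]; case/negP: nh; apply/forallP => j; apply/eqP.
rewrite -b0_count /e_count -[RHS](card_preimset _ (@perm_inj _ g^-1%g)).
apply: eq_card => a; rewrite !inE.
by have := congr1 (fun w => (w (g^-1%g a)).1.1) eg; rewrite !ffunE permKV /= => <-; apply/eqP/eqP => [[]|->].
Qed.

End BlockModules.

(** * Outer tensor products *)

Section RestrictScalars.
Variables (k : nzRingType) (R : pzRingType).

(** V as a module over k, through f *)
Definition kmod (f : {rmorphism k -> R}) (V : lmodType R) : Type := V.

Variables (f : {rmorphism k -> R}) (V : lmodType R).

HB.instance Definition _ := GRing.Zmodule.copy (kmod f V) V.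

Definition kscale (a : k) (x : kmod f V) : kmod f V := f a *: (x : V).

Fact kscaleA a b (x : kmod f V) : kscale a (kscale b x) = kscale (a * b) x.
Proof. by rewrite /kscale scalerA rmorphM. Qed.

Fact kscale1 : left_id 1 kscale.
Proof. by move=> x; rewrite /kscale rmorph1 scale1r. Qed.

Fact kscaleDr : right_distributive kscale +%R.
Proof. by move=> a x y; apply: scalerDr. Qed.

Fact kscaleDl (x : kmod f V) : {morph kscale^~ x : a b / a + b}.
Proof. by move=> a b; rewrite /kscale rmorphD scalerDl. Qed.

HB.instance Definition _ := GRing.Zmodule_isLmodule.Build k (kmod f V)
  kscaleA kscale1 kscaleDr kscaleDl.

End RestrictScalars.

Section Box.
Variables (k : fieldType) (n m d : nat) (dd : 'I_n -> nat).
Hypothesis sum_dd : (\sum_j dd j)%N = d.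
Local Notation TK := (tzschur k n m d).
Local Notation fam := (forall j, schur k m (dd j)).
Local Notation theta := (theta sum_dd).
Local Notation tsc := (@tz_scal k n m d).
Variable L : forall j, lmodType (schur k m (dd j)).
Variable V : lmodType TK.
Variable t : (forall j, L j) -> V.
Hypothesis t_tensor : is_tensor t.
Hypothesis t_eta : forall (r q : forall j, mword m (dd j)) (w : word n m d),
  codom w = econcat r q ->
  forall v, tz_eta k w *: t v = t (fun j => schur_xi k (r j) (q j) *: v j).
Hypothesis t_off : forall w : word n m d, admissible w ->
  (exists j, #|[set a | (w a).1.1 == Ze j]| != dd j) -> forall x : V, tz_eta k w *: x = 0.
Implicit Types (s : fam) (X Y : TK) (v : forall j, L j).

Local Notation updL v j x := (@upd n (fun j => GRing.Lmodule.sort (L j)) v j x).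
Local Notation updS s j x := (@upd n (fun j => schur k m (dd j)) s j x).

Lemma box_block : block_module sum_dd V.
Proof. exact: block_moduleP. Qed.

Lemma t_lin j a v v1 v2 : (forall i, i != j -> v1 i = v i /\ v2 i = v i) ->
  v j = schur_scal m (dd j) a *: v1 j + v2 j -> t v = tsc a *: t v1 + t v2.
Proof. by have [tm _] := t_tensor; apply: tm. Qed.

Lemma tD v j (x y : L j) : t (updL v j (x + y)) = t (updL v j x) + t (updL v j y).
Proof.
rewrite (@t_lin j 1 _ (updL v j x) (updL v j y)) ?rmorph1 ?scale1r //.
  by move=> i ij; rewrite !upd_out.
by rewrite !upd_in ?rmorph1 ?scale1r.
Qed.

Lemma t_upd0 v j : t (updL v j 0) = 0.
Proof. by apply: (addIr (t (updL v j 0))); rewrite -tD !add0r. Qed.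

Lemma t_zero v j : v j = 0 -> t v = 0.
Proof. by move=> vj; rewrite -(upd_same v j) vj t_upd0. Qed.

Lemma tZ v j a (x : L j) : t (updL v j (schur_scal m (dd j) a *: x)) = tsc a *: t (updL v j x).
Proof.
rewrite (@t_lin j a _ (updL v j x) (updL v j 0)) ?t_upd0 ?addr0 //.
  by move=> i ij; rewrite !upd_out.
by rewrite !upd_in ?addr0.
Qed.

Lemma upd_act s v j (a : schur k m (dd j)) :
  (fun i => updS s j a i *: v i) = updL (fun i => s i *: v i) j (a *: v j).
Proof.
apply: functional_extensionality_dep => i; have [->|ij] := eqVneq i j; first by rewrite !upd_in.
by rewrite !upd_out.
Qed.

(** Both sides are multilinear in s, and for families of Schur basis elements
    [theta] is a basis element eta_w. *)
Lemma box_theta s v : theta s *: t v = t (fun j => s j *: v j).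
Proof.
elim/fam_ind: s v => [r q|s j|s j c a b ha hb] v.
- rewrite -(@t_eta r q (ew (b0 sum_dd) (catw sum_dd r) (catw sum_dd q))); last exact/econcatP.
  apply: (block_eq box_block) => r' q'; rewrite Phi_theta Theta_xi /Phi ev_eta //.
  exact: ew_adm.
- rewrite upd_act scale0r t_upd0; apply: box_block => r q.
  by rewrite Phi_theta Theta_upd sent0 mul0r.
rewrite upd_act scalerDl -schur_scalE -scalerA tD tZ -!upd_act -ha -hb.
rewrite scalerA -scalerDl; apply: (block_eq box_block) => r q.
rewrite Phi_D tz_scalE Phi_Z !Phi_theta !Theta_upd schur_scalE sentD sentZ.
by rewrite mulrDl mulrA.
Qed.

(** By the universal property, k-linear maps on the tensor product are determined
    by the pure tensors. *)
Lemma box_unique (W : lmodType k) (g g' : V -> W) :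
  (forall a x y, g (tsc a *: x + y) = a *: g x + g y) ->
  (forall a x y, g' (tsc a *: x + y) = a *: g' x + g' y) ->
  (forall v, g (t v) = g' (t v)) -> forall x, g x = g' x.
Proof.
move=> gl gl' gg; have [tm tu] := t_tensor.
have fm : multilinear (fun a w => a *: w) (g \o t).
  move=> j a v v1 v2 h hj /=; rewrite -gl; congr g.
  exact: (tm j a v v1 v2).
have [g0 [_ _ uniq]] := tu W _ fm.
by move=> x; rewrite (uniq g gl (fun=> erefl)) -(uniq g' gl' (fun v => esym (gg v))).
Qed.

Lemma tsc_comm a X : tsc a * X = X * tsc a.
Proof. by rewrite tz_scalE tz_scalC. Qed.

Lemma box_eq X Y : (forall v, X *: t v = Y *: t v) -> forall x : V, X *: x = Y *: x.
Proof.
have lin Z a (x y : V) : Z *: (tsc a *: x + y) = tsc a *: (Z *: x) + Z *: y.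
  by rewrite scalerDr !scalerA tsc_comm.
move=> h; pose W := kmod (@tz_scal k n m d) V.
exact: (@box_unique W (fun x => X *: x) (fun x => Y *: x) (lin X) (lin Y) h).
Qed.

Section Corner.
Variables (j : 'I_n) (xis : fam) (v0 : forall j, L j) (phi : forall i, L i -> k).
Hypothesis phi_lin : forall i c (x y : L i), i != j ->
  phi (schur_scal m (dd i) c *: x + y) = c * phi x + phi y.
Hypothesis xisE : forall i (x : L i), i != j -> xis i *: x = schur_scal m (dd i) (phi x) *: v0 i.
Hypothesis phi_v0 : forall i, i != j -> phi (v0 i) = 1.

(** The factor j, embedded along the vectors v0 i of the other factors *)
Definition box_in (u : L j) : V := t (updL v0 j u).

Lemma box_inD : {morph box_in : x y / x + y}. Proof. exact: tD. Qed.

Lemma box_in_theta s u : (forall i, i != j -> s i *: v0 i = v0 i) ->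
  theta s *: box_in u = box_in (s j *: u).
Proof.
move=> h; rewrite box_theta; congr t; apply: functional_extensionality_dep => i.
by have [->|ij] := eqVneq i j; [rewrite !upd_in | rewrite !upd_out ?h].
Qed.

(** The retraction contracts every factor i other than j with the functional phi
    of i; the universal property turns this into a map on V. *)
Lemma box_corner : exists g : V -> L j,
  (forall u, g (box_in u) = u) /\ (forall x, box_in (g x) = theta (updS xis j 1) *: x).
Proof.
have [tm tu] := t_tensor.
pose f v : kmod (@schur_scal k m (dd j)) (L j) :=
  schur_scal m (dd j) (\prod_(i | i != j) phi (v i)) *: v j.
have fm : multilinear (fun a w => a *: w) f.
  move=> i a v v1 v2 h hi; rewrite /f.
  have [ij|ij] := eqVneq i j.
    subst i; rewrite hi.
    have -> : \prod_(i | i != j) phi (v1 i) = \prod_(i | i != j) phi (v i).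
      by apply: eq_bigr => i ij; have [->] := h i ij.
    have -> : \prod_(i | i != j) phi (v2 i) = \prod_(i | i != j) phi (v i).
      by apply: eq_bigr => i ij; have [_ ->] := h i ij.
    by rewrite scalerDr scalerA -schur_scal_comm -scalerA.
  have ji : j != i by rewrite eq_sym.
  have [-> ->] := h j ji.
  transitivity (schur_scal m (dd j) (a * \prod_(i | i != j) phi (v1 i) +
      \prod_(i | i != j) phi (v2 i)) *: v j); last by rewrite rmorphD rmorphM scalerDl -scalerA.
  congr (schur_scal _ _ _ *: _); rewrite (bigD1 i) //= hi phi_lin // mulrDl.
  rewrite [X in _ = a * X + _](bigD1 i) //= [X in _ = _ + X](bigD1 i) //= mulrA.
  congr (_ * _ * _ + _ * _); apply: eq_bigr => l /andP[_ li];
    by have [e1 e2] := h l li; rewrite ?e1 ?e2.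
have [g [gl gt _]] := tu _ f fm.
exists g; split=> [u|x].
  rewrite gt /f upd_in big1 ?rmorph1 ?scale1r // => i ij.
  by rewrite upd_out ?phi_v0.
pose W := kmod (@tz_scal k n m d) V.
apply: (@box_unique W (fun x => box_in (g x)) (fun x => theta (updS xis j 1) *: x)) => [a y z|a y z|v].
- by rewrite gl box_inD; congr (_ + _); apply: tZ.
- by rewrite scalerDr scalerA -tsc_comm -scalerA.
rewrite gt box_theta /f /box_in tZ.
have main (l : seq 'I_n) (w : forall i, L i) : uniq l -> (forall i, i \in l -> i != j) ->
    t (fun i => if i \in l then xis i *: w i else w i) =
    tsc (\prod_(i <- l) phi (w i)) *: t (fun i => if i \in l then v0 i else w i).
  elim: l w => [|i l IH] w /=; first by rewrite big_nil rmorph1 scale1r.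
  move=> /andP[il ul] lj.
  have hl i' : i' \in l -> i' != j by move=> h; apply: lj; rewrite inE h orbT.
  have ij : i != j by apply: lj; rewrite inE eqxx.
  have e1 : (fun i' => if i' \in i :: l then xis i' *: w i' else w i') =
      updL (fun i' => if i' \in l then xis i' *: updL w i (v0 i) i' else updL w i (v0 i) i') i
        (schur_scal m (dd i) (phi (w i)) *: v0 i).
    apply: functional_extensionality_dep => i'; rewrite inE.
    have [->|ne] := eqVneq i' i; first by rewrite upd_in /= xisE.
    by rewrite /= !upd_out.
  rewrite e1 tZ big_cons rmorphM -scalerA; congr (_ *: _).
  have -> : \prod_(i' <- l) phi (w i') = \prod_(i' <- l) phi (updL w i (v0 i) i').
    rewrite !big_seq; apply: eq_bigr => i' hi'; rewrite upd_out //.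
    by apply: contraNneq il => <-.
  have e2 : updL (fun i' => if i' \in l then xis i' *: updL w i (v0 i) i' else updL w i (v0 i) i') i (v0 i)
      = (fun i' => if i' \in l then xis i' *: updL w i (v0 i) i' else updL w i (v0 i) i').
    apply: functional_extensionality_dep => i'; have [->|ne] := eqVneq i' i; last by rewrite upd_out.
    by rewrite upd_in (negbTE il) upd_in.
  rewrite e2 IH //; congr (_ *: t _); apply: functional_extensionality_dep => i'; rewrite inE.
  have [->|ne] := eqVneq i' i; first by rewrite (negbTE il) upd_in.
  by rewrite /= upd_out.
pose l := [seq i <- enum 'I_n | i != j].
have lE i : (i \in l) = (i != j) by rewrite mem_filter mem_enum andbT.
have lj i : i \in l -> i != j by rewrite lE.
have e := main l v (filter_uniq _ (enum_uniq _)) lj.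
rewrite big_filter big_enum_cond /= in e.
transitivity (t (fun i => if i \in l then xis i *: v i else v i)).
  rewrite e; congr (_ *: t _); apply: functional_extensionality_dep => i; rewrite lE.
  by have [->|ij] := eqVneq i j; [rewrite upd_in | rewrite upd_out].
congr t; apply: functional_extensionality_dep => i; rewrite lE.
by have [->|ij] := eqVneq i j; [rewrite upd_in scale1r | rewrite upd_out].
Qed.

End Corner.
End Box.

(** * Truncation in a tensor product of Schur algebras *)

Section BlockTruncation.
Variables (k : fieldType) (n m d : nat) (dd : 'I_n -> nat).
Hypothesis sum_dd : (\sum_j dd j)%N = d.
Local Notation TK := (tzschur k n m d).
Local Notation fam := (forall j, schur k m (dd j)).
Local Notation restr := (restr sum_dd).
Local Notation theta := (theta sum_dd).
Local Notation updS s j x := (@upd n (fun j => schur k m (dd j)) s j x).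

Variables (j : 'I_n) (xis : fam) (chi : forall i, schur k m (dd i) -> k).
Variables (N : nat) (l b : forall i, 'I_N -> schur k m (dd i)).
Let z : fam := fun i => \sum_c l i c * (xis i * b i c).

Hypothesis xis_j : xis j = 1.
Hypothesis xis_idem : forall i, xis i * xis i = xis i.
Hypothesis chi_lin : forall i c (x y : schur k m (dd i)), i != j ->
  chi (c *: x + y) = c * chi x + chi y.
Hypothesis chi_1 : forall i, i != j -> chi (1 : schur k m (dd i)) = 1.
Hypothesis chi_xis : forall i (x y : schur k m (dd i)), i != j ->
  chi (x * xis i * y) = chi x * chi y.
Hypothesis chi_z : forall i (x y : schur k m (dd i)), i != j -> chi (x * z i * y) = chi (x * y).
Hypothesis z_j : z j = 1.

Implicit Types (s : fam) (X Y : TK) (r t : mword m d).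

Lemma chi_sum i (J : finType) (P : pred J) (F : J -> schur k m (dd i)) : i != j ->
  chi (\sum_(x | P x) F x) = \sum_(x | P x) chi (F x).
Proof.
move=> ij; have chi0 : chi (0 : schur k m (dd i)) = 0.
  by apply: (addIr (chi (0 : schur k m (dd i)))); have := chi_lin 1 0 0 ij; rewrite scaler0 addr0 mul1r add0r => <-.
apply: (big_morph _ _ chi0) => x y.
by have := chi_lin 1 x y ij; rewrite scale1r mul1r.
Qed.

(** Coefficients expressing [chi] as a linear form in the matrix entries *)
Definition kappa i (p q : mword m (dd i)) : k :=
  if orb2_rep (p, q) == (p, q) then chi (schur_xi k p q) else 0.

Lemma kappaE i (s : schur k m (dd i)) : i != j -> chi s = \sum_p \sum_q kappa p q * sent s p q.
Proof.
move=> ij; rewrite pair_bigA {1}(schur_expand s) chi_sum // [RHS](bigID (fun x => orb2_rep x == x)) /=.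
rewrite [X in _ = _ + X]big1 ?addr0 => [|x /negbTE nx]; last first.
  by rewrite /kappa -surjective_pairing nx mul0r.
apply: eq_bigr => x hx; rewrite /kappa -surjective_pairing hx mulrC.
have := chi_lin (sent s x.1 x.2) (schur_xi k x.1 x.2) 0 ij.
rewrite addr0 => ->; have := chi_lin (-1) (0 : schur k m (dd i)) 0 ij.
by rewrite scaler0 addr0 mulN1r addNr => ->; rewrite addr0.
Qed.

Definition tau_entry X (p q : mword m (dd j)) : k :=
  \sum_r \sum_t ((restr j r == p) && (restr j t == q))%:R *
    (\prod_(i | i != j) kappa (restr i r) (restr i t)) * Phi sum_dd X r t.

Lemma Phi_act X (g : 'S_d) r t : (forall x, b0 sum_dd (g x) = b0 sum_dd x) ->
  Phi sum_dd X (mwact r g) (mwact t g) = Phi sum_dd X r t.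
Proof.
move=> gb; rewrite /Phi; apply: eq_bigr => o _; congr (_ * (nat_of_bool _)%:R).
have -> : ew (b0 sum_dd) (mwact r g) (mwact t g) = wact (ew (b0 sum_dd) r t) g.
  by rewrite wact_ew; congr ew; apply/ffunP => x; rewrite [RHS]ffunE gb.
exact: same_orbit_act.
Qed.

Fact tau_inv X : schur_inv (\matrix_(x, y) tau_entry X (enum_val x) (enum_val y)).
Proof.
apply/schur_invP => h p q; rewrite !mxE !enum_rankK.
pose hs : forall i, 'S_(dd i) := @upd n (fun i => 'S_(dd i)) (fun=> 1%g) j h.
have [g [gb gE]] := block_perm_glue m sum_dd hs.
rewrite /tau_entry (reindex_inj (@mwact_inj _ _ g)); apply: eq_bigr => r _.
rewrite (reindex_inj (@mwact_inj _ _ g)); apply: eq_bigr => t _.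
rewrite Phi_act // !gE /hs !upd_in !(inj_eq (@mwact_inj _ _ h)).
congr (_ * _ * _); apply: eq_bigr => i ij.
by rewrite !gE /hs upd_out // !mwact1.
Qed.

(** The map that evaluates [chi] on the factors other than j. It is defined through
    matrix entries so as to make sense on all of A, not only on tensors. *)
Definition tau X : schur k m (dd j) := Defs.Schur (tau_inv X).

Lemma sent_tau X p q : sent (tau X) p q = tau_entry X p q.
Proof. by rewrite /sent mxE !enum_rankK. Qed.

Lemma tau_Phi X Y : (forall r t, Phi sum_dd X r t = Phi sum_dd Y r t) -> tau X = tau Y.
Proof.
move=> h; apply: sent_ext => p q; rewrite !sent_tau.
by apply: eq_bigr => r _; apply: eq_bigr => t _; rewrite h.
Qed.

Lemma tau_lin c X Y : tau (c *: X + Y) = c *: tau X + tau Y.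
Proof.
apply: sent_ext => p q; rewrite sentD sentZ !sent_tau /tau_entry mulr_sumr -big_split.
apply: eq_bigr => r _ /=; rewrite mulr_sumr -big_split; apply: eq_bigr => t _ /=.
by rewrite Phi_D Phi_Z mulrDr mulrCA.
Qed.

Lemma tau_theta s : tau (theta s) = (\prod_(i | i != j) chi (s i)) *: s j.
Proof.
apply: sent_ext => p q; rewrite sent_tau sentZ.
pose G i : mword m (dd i) -> mword m (dd i) -> k := @upd n
  (fun i => mword m (dd i) -> mword m (dd i) -> k) (fun i x y => kappa x y * sent (s i) x y) j
  (fun x y => ((x == p) && (y == q))%:R * sent (s j) x y) i.
transitivity (\sum_r \sum_t \prod_i G i (restr i r) (restr i t)).
  apply: eq_bigr => r _; apply: eq_bigr => t _.
  rewrite Phi_theta /Theta [X in _ * X = _](bigD1 j) //= [RHS](bigD1 j) //= {1}/G upd_in -!mulrA.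
  congr (_ * _); rewrite mulrCA; congr (_ * _).
  by rewrite -big_split; apply: eq_bigr => i ij; rewrite /G upd_out.
transitivity (\prod_i \sum_x \sum_y G i x y).
  rewrite -(sum_prod_restr sum_dd (fun i x => \sum_y G i x y)); apply: eq_bigr => r _.
  by rewrite -(sum_prod_restr sum_dd (fun i y => G i (restr i r) y)).
rewrite (bigD1 j) //= mulrC; congr (_ * _).
  by apply: eq_bigr => i ij; rewrite kappaE // /G upd_out.
rewrite (bigD1 p) //= [X in _ + X]big1 ?addr0 => [|x xp]; last first.
  by rewrite big1 // => y _; rewrite /G upd_in (negbTE xp) mul0r.
rewrite (bigD1 q) //= [X in _ + X]big1 ?addr0 => [|y yq]; last first.
  by rewrite /G upd_in (negbTE yq) andbF mul0r.
by rewrite /G upd_in !eqxx mul1r.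
Qed.

Lemma PhiM X X' Y Y' : (forall r t, Phi sum_dd X r t = Phi sum_dd X' r t) ->
  (forall r t, Phi sum_dd Y r t = Phi sum_dd Y' r t) -> forall r t, Phi sum_dd (X * Y) r t = Phi sum_dd (X' * Y') r t.
Proof. by move=> h h' r t; rewrite !Phi_M; apply: eq_bigr => q _; rewrite h h'. Qed.

Lemma Phi_thetaM s s' r t : Phi sum_dd (theta s * theta s') r t = Phi sum_dd (theta (fun i => s i * s' i)) r t.
Proof.
rewrite Phi_M Phi_theta -ThetaM; by apply: eq_bigr => q _; rewrite !Phi_theta.
Qed.

(** An identity that is bilinear in X and Y modulo the kernel of [Phi] holds if it
    holds on families. *)
Lemma tau_bilinear (F : TK -> TK -> schur k m (dd j)) (M : TK) :
  (forall c X X' Y, F (c *: X + X') Y = c *: F X Y + F X' Y) ->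
  (forall c X Y Y', F X (c *: Y + Y') = c *: F X Y + F X Y') ->
  (forall X X' Y Y', (forall r t, Phi sum_dd X r t = Phi sum_dd X' r t) ->
    (forall r t, Phi sum_dd Y r t = Phi sum_dd Y' r t) -> F X Y = F X' Y') ->
  (forall s s', tau (theta s * M * theta s') = F (theta s) (theta s')) ->
  forall X Y, tau (X * M * Y) = F X Y.
Proof.
move=> Fl Fr FP h X Y; move: X Y.
apply: (@Phi_ind k n m d dd sum_dd (fun X => forall Y, tau (X * M * Y) = F X Y))
  => [X X' e IH Y|c X X' IH IH' Y|s Y].
- rewrite -(FP X X' Y Y) // -IH; apply: tau_Phi; apply: PhiM => // r t.
  by apply: PhiM => // r' t'; rewrite e.
- rewrite Fl -IH -IH' -tau_lin !mulrDl; congr (tau (_ + _)).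
  by rewrite -!tz_scalE !mulrA.
apply: (@Phi_ind k n m d dd sum_dd (fun Y => tau (theta s * M * Y) = F (theta s) Y))
  => {Y} [Y Y' e IH|c Y Y' IH IH'|s'].
- by rewrite -(FP (theta s) (theta s) Y Y') // -IH; apply: tau_Phi; apply: PhiM => // r t; rewrite e.
- rewrite Fr -IH -IH' -tau_lin !mulrDr; congr (tau (_ + _)).
  by rewrite -!tz_scalE mulrA -tsc_comm !mulrA.
exact: h.
Qed.

Definition blk_in (u : schur k m (dd j)) : TK := theta (updS xis j u).
Let Z : TK := theta z.

Lemma tau_blk_in X u Y : tau (X * blk_in u * Y) = tau X * u * tau Y.
Proof.
apply: (tau_bilinear (F := fun X Y => tau X * u * tau Y)) => [c X1 X2 Y1|c X1 Y1 Y2|X1 X2 Y1 Y2 e e'|s s'].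
- by rewrite tau_lin mulrDl mulrDl -!schur_scalE !mulrA.
- by rewrite tau_lin mulrDr -!schur_scalE mulrA -schur_scal_comm !mulrA.
- by rewrite (tau_Phi e) (tau_Phi e').
rewrite (@tau_Phi _ (theta (fun i => s i * updS xis j u i * s' i))); last first.
  move=> r t; rewrite -Phi_thetaM; apply: PhiM => // r' t'; exact: Phi_thetaM.
rewrite !tau_theta upd_in.
have -> : \prod_(i | i != j) chi (s i * updS xis j u i * s' i) =
    (\prod_(i | i != j) chi (s i)) * (\prod_(i | i != j) chi (s' i)).
  by rewrite -big_split; apply: eq_bigr => i ij; rewrite upd_out // chi_xis.
rewrite -!schur_scalE rmorphM -!mulrA; congr (_ * _).
by rewrite !mulrA; congr (_ * _); rewrite -mulrA schur_scal_comm.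
Qed.

Lemma tau_Z X Y : tau (X * Z * Y) = tau (X * Y).
Proof.
apply: (tau_bilinear (F := fun X Y => tau (X * Y))) => [c X1 X2 Y1|c X1 Y1 Y2|X1 X2 Y1 Y2 e e'|s s'].
- by rewrite mulrDl -tau_lin -!tz_scalE mulrA.
- by rewrite mulrDr -tau_lin -!tz_scalE mulrA -tsc_comm mulrA.
- by apply: tau_Phi; apply: PhiM.
rewrite (@tau_Phi _ (theta (fun i => s i * z i * s' i))); last first.
  move=> r t; rewrite -Phi_thetaM; apply: PhiM => // r' t'; exact: Phi_thetaM.
rewrite (tau_Phi (Phi_thetaM s s')) !tau_theta z_j mulr1; congr (_ *: _).
by apply: eq_bigr => i ij; rewrite chi_z.
Qed.

Lemma tau1 : tau 1 = 1.
Proof.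
rewrite (@tau_Phi _ (theta (fun=> 1))) => [|r t]; last by rewrite Phi_1 Phi_theta Theta1.
by rewrite tau_theta big1 ?scale1r // => i ij; rewrite chi_1.
Qed.

Lemma tauD X Y : tau (X + Y) = tau X + tau Y.
Proof. by have := tau_lin 1 X Y; rewrite !scale1r. Qed.

Lemma tau_sum (J : finType) (F : J -> TK) : tau (\sum_c F c) = \sum_c tau (F c).
Proof.
have tau0 : tau 0 = 0 by apply: (addIr (tau 0)); rewrite -tauD !add0r.
exact: (big_morph tau tauD tau0).
Qed.

Local Notation Ix := {ffun 'I_n -> 'I_N}.
(** The element Z is the identity on outer tensor products, but on their extensions
    it is only unipotent, with the inverse 1 + (1 - Z). *)
Definition blk_l (c : Ix) : TK := theta (fun i => l i (c i)).
Definition blk_r (c : Ix) : TK := theta (fun i => b i (c i)) * (1 + (1 - Z)).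

Lemma updS_xis : updS xis j 1 = xis.
Proof. by rewrite -xis_j upd_same. Qed.

Lemma Phi_lr r t : Phi sum_dd (\sum_(c : Ix) blk_l c * (blk_in 1 * theta (fun i => b i (c i)))) r t = Phi sum_dd Z r t.
Proof.
rewrite /Phi ev_sum -/(Phi sum_dd Z r t) Phi_theta.
under eq_bigr => c _.
  rewrite -/(Phi sum_dd _ r t) (PhiM (fun _ _ => erefl) (Phi_thetaM _ _)) Phi_thetaM Phi_theta.
  rewrite updS_xis /Theta; over.
rewrite -(bigA_distr_bigA (fun i c => sent (l i c * (xis i * b i c)) (restr i r) (restr i t))).
by apply: eq_bigr => i _; rewrite sent_sum.
Qed.

Lemma tauB X Y : tau (X - Y) = tau X - tau Y.
Proof. by apply: (addIr (tau Y)); rewrite -tauD !subrK. Qed.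

Lemma tau_res X Y : \sum_c tau (X * blk_l c) * tau (blk_r c * Y) = tau (X * Y).
Proof.
have -> : tau (X * Y) = tau (X * Z * ((1 + (1 - Z)) * Y)).
  rewrite mulrDl mulrBl !mul1r mulrDr mulrBr tauD tauB !tau_Z.
  by rewrite mulrA tau_Z subrr addr0.
under eq_bigr => c _ do rewrite -[tau (X * _)]mulr1 -tau_blk_in /blk_r.
rewrite -tau_sum; apply: tau_Phi => r t.
transitivity (Phi sum_dd (X * (\sum_c blk_l c * (blk_in 1 * theta (fun i => b i (c i)))) *
    ((1 + (1 - Z)) * Y)) r t).
  by rewrite mulr_sumr mulr_suml; congr (Phi _ _ _ _); apply: eq_bigr => c _; rewrite !mulrA.
by apply: PhiM => // r' t'; apply: PhiM => // r2 t2; apply: Phi_lr.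
Qed.

Lemma tau_scal c X : tau (X * tz_scal n m d c) = tau X * schur_scal m (dd j) c.
Proof.
rewrite tz_scalC schur_scalC -[c *: X]addr0 tau_lin.
by have := tauB 0 0; rewrite !subrr => ->; rewrite addr0.
Qed.

(** Truncation at the highest weights of the simple modules in the factors other
    than j *)
Definition block_truncation : truncation (@tz_scal k n m d) (@schur_scal k m (dd j)) :=
  Truncation tauD tau1 tau_blk_in tau_res tau_scal.

Section Truncatable.
Variables (V : lmodType TK) (bV : block_module sum_dd V).
Hypothesis unip : forall v : V, (1 - Z) *: ((1 - Z) *: v) = 0.
Hypothesis corner_chi : forall i s (x : schur k m (dd i)) (v : V), i != j ->
  theta (updS s i (xis i * x * xis i - chi x *: xis i)) *: v = 0.

Lemma theta_upd_lin s i c (x y : schur k m (dd i)) (v : V) :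
  theta (updS s i (c *: x + y)) *: v =
  tz_scal n m d c *: (theta (updS s i x) *: v) + theta (updS s i y) *: v.
Proof.
rewrite scalerA -scalerDl; apply: (block_eq bV) => r t.
by rewrite Phi_D tz_scalE Phi_Z !Phi_theta !Theta_upd sentD sentZ mulrDl mulrA.
Qed.

(** In each factor i other than j, the corner at the weight idempotent acts through
    [chi]; the factors are treated one after the other. *)
Lemma blk_in_theta s (v : V) : blk_in 1 *: (theta s *: (blk_in 1 *: v)) =
  tz_scal n m d (\prod_(i | i != j) chi (s i)) *: (blk_in (s j) *: v).
Proof.
rewrite /blk_in !(theta_theta bV) updS_xis.
pose base : fam := updS xis j (s j); pose g : fam := fun i => xis i * s i * xis i.
have main (q : seq 'I_n) : uniq q -> (forall i, i \in q -> i != j) ->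
    theta (fun i => if i \in q then g i else base i) *: v =
    tz_scal n m d (\prod_(i <- q) chi (s i)) *: (theta base *: v).
  elim: q => [|i q IH] /=; first by rewrite big_nil rmorph1 scale1r.
  move=> /andP[iq uq] qj; have ij : i != j by apply: qj; rewrite inE eqxx.
  pose f : fam := fun i' => if i' \in q then g i' else base i'.
  have fi : f i = xis i by rewrite /f (negbTE iq) /base upd_out.
  have -> : (fun i' => if i' \in i :: q then g i' else base i') = updS f i (g i).
    apply: functional_extensionality_dep => i'; rewrite inE.
    by have [->|ne] := eqVneq i' i; [rewrite upd_in | rewrite upd_out].
  rewrite big_cons rmorphM -scalerA -IH //; last by move=> i' hi'; apply: qj; rewrite inE hi' orbT.
  rewrite -/f; have := corner_chi f (s i) v ij; have -> : f = updS f i (xis i) by rewrite -fi upd_same.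
  rewrite !upd_upd => h; rewrite -[RHS]addr0 -h -theta_upd_lin.
  by congr (theta (upd _ _) *: _); rewrite addrC subrK.
pose q := [seq i <- enum 'I_n | i != j].
have qE i : (i \in q) = (i != j) by rewrite mem_filter mem_enum andbT.
have qj i : i \in q -> i != j by rewrite qE.
have e := main q (filter_uniq _ (enum_uniq _)) qj.
rewrite big_filter big_enum_cond /= in e.
rewrite -e; congr (theta _ *: _); apply: functional_extensionality_dep => i; rewrite qE /g /base.
by have [->|ij] := eqVneq i j; rewrite ?upd_in ?xis_j ?mul1r ?mulr1 ?mulrA.
Qed.

Lemma block_truncatable : truncatable block_truncation V.
Proof.
split=> [u u' v|u u' v|v|a v|c v] /=.
- rewrite -scalerDl; apply: (block_eq bV) => r t.
  by rewrite Phi_D !Phi_theta !Theta_upd sentD mulrDl.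
- rewrite /blk_in (theta_theta bV); congr (theta _ *: _).
  apply: functional_extensionality_dep => i.
  by have [->|ij] := eqVneq i j; [rewrite !upd_in | rewrite !upd_out // xis_idem].
- transitivity (Z *: ((1 + (1 - Z)) *: v)).
    rewrite -(block_eq bV _ Phi_lr) scaler_suml; apply: eq_bigr => c _.
    by rewrite /blk_r !scalerA !mulrA.
  have h := unip v; set w := (1 - Z) *: v in h *.
  have Zw : Z *: w = w by apply/eqP; rewrite eq_sym -subr_eq0 -{1}[w]scale1r -scalerBl h.
  by rewrite scalerDl scale1r -/w scalerDr Zw /w scalerBl scale1r addrC subrK.
- move: v; apply: (@Phi_ind k n m d dd sum_dd
    (fun a => forall v : V, blk_in 1 *: (a *: (blk_in 1 *: v)) = blk_in (tau a) *: v))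
    => [X Y e IH v|c X Y IH IH' v|s v].
  + by rewrite -(tau_Phi e) -IH -(block_eq bV _ e).
  + rewrite tau_lin /blk_in theta_upd_lin -!/(blk_in _) -IH -IH'.
    rewrite scalerDl scalerDr -[c *: X]tz_scalE -scalerA; congr (_ + _).
    by rewrite scalerA -tsc_comm -scalerA.
  rewrite blk_in_theta tau_theta -[_ *: s j]addr0 /blk_in theta_upd_lin.
  rewrite -[LHS]addr0; congr (_ + _); apply/esym/bV => r t.
  by rewrite Phi_theta Theta_upd sent0 mul0r.
- by rewrite !scalerA tsc_comm.
Qed.

End Truncatable.

Lemma induced_block (X : lmodType (schur k m (dd j))) : block_module sum_dd (induced block_truncation X).
Proof.
move=> a ha u; apply: val_inj; rewrite inducedZ; apply/ffunP => c.
rewrite [LHS]ffunE [RHS]ffunE big1 // => c' _ /=.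
suff -> : tau (blk_r c * a * blk_l c') = 0 by rewrite scale0r.
have tau0 : tau 0 = 0 by apply: (addIr (tau 0)); rewrite -tauD !add0r.
rewrite -tau0; apply: tau_Phi => r t; rewrite Phi_M /Phi ev0 big1 // => q _.
rewrite -/(Phi sum_dd _ r q) Phi_M big1 ?mul0r // => p _.
by rewrite ha mulr0.
Qed.

End BlockTruncation.

(** * Truncation of outer tensor products and their extensions *)

Section Compatibility.
Variables (k : fieldType) (m e : nat).
Local Notation S := (schur k m e).

(** The part of the highest weight data of a simple module V that lives in the
    Schur algebra: the weight idempotent, the character chi by which its corner
    acts on the highest weight line, and the resolution of the identity. *)
Definition hw_compat (V : lmodType S) (la : weight m) (x : S) (chi : S -> k) N (l b : 'I_N -> S) :=
  exists h : highest_weight V la, [/\ x = schur_xi k (hw_word h) (hw_word h),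
    forall s, chi s = hw_fun h (s *: hw_vec h) &
    forall y : V, \sum_c l c *: (x *: (b c *: y)) = y].

Lemma irr_compat (V : lmodType S) la : is_irr V la ->
  exists N0, forall N, (N0 <= N)%N -> exists x chi (l b : 'I_N -> S), hw_compat V la x chi l b.
Proof.
move=> /irr_highest_weight[h]; have [N0 [l [b res]]] := irr_resolution h.
exists N0 => N /subnKC <-; pose pad (F : 'I_N0 -> S) (c : 'I_(N0 + (N - N0))) :=
  if split c is inl c' then F c' else 0.
exists (schur_xi k (hw_word h) (hw_word h)), (fun s => hw_fun h (s *: hw_vec h)), (pad l), (pad b).
exists h; split=> // y; rewrite big_split_ord /= [X in _ + X]big1 ?addr0 => [|c _].
  rewrite -[RHS]res; apply: eq_bigr => c _; rewrite /pad.
  by rewrite (unsplitK (inl c)).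
by rewrite /pad (unsplitK (inr c)) scale0r.
Qed.

Section Theory.
Variables (V : lmodType S) (la : weight m) (x : S) (chi : S -> k) (N : nat) (l b : 'I_N -> S).
Hypothesis hc : hw_compat V la x chi l b.
Local Notation z := (\sum_c l c * (x * b c)).

Lemma compat_idem : x * x = x.
Proof. by have [h [-> _ _]] := hc; apply: xi_diag_idem. Qed.

Lemma compat_lin c s s' : chi (c *: s + s') = c * chi s + chi s'.
Proof.
have [h [_ chiE _]] := hc; rewrite !chiE scalerDl hw_funD -schur_scalE -scalerA.
by rewrite hw_funZ.
Qed.

Lemma compat1 : chi 1 = 1.
Proof. by have [h [_ chiE _]] := hc; rewrite chiE scale1r hw_fun1. Qed.

Lemma compat_mul s s' : chi (s * x * s') = chi s * chi s'.
Proof.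
have [h [-> chiE _]] := hc; rewrite !chiE -!scalerA hw_funE scalerA -schur_scal_comm.
by rewrite -scalerA hw_funZ mulrC.
Qed.

Lemma compat_z (y : V) : z *: y = y.
Proof.
have [h [_ _ res]] := hc; rewrite scaler_suml -[RHS]res; apply: eq_bigr => c _.
by rewrite !scalerA !mulrA.
Qed.

Lemma compat_chi_z s s' : chi (s * z * s') = chi (s * s').
Proof. by have [h [_ chiE _]] := hc; rewrite !chiE -!scalerA compat_z. Qed.

Lemma compat_above s (y : V) : above la s -> s *: y = 0.
Proof. by have [h _] := hc; apply: hw_above. Qed.

Lemma compat_chi s : above_mod la (x * s * x - chi s *: x).
Proof. by have [h [-> -> _]] := hc; apply: hw_chi. Qed.

Lemma compat_vec : exists (v : V) (phi : V -> k), [/\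
  forall c y y', phi (schur_scal m e c *: y + y') = c * phi y + phi y',
  forall y, x *: y = schur_scal m e (phi y) *: v, phi v = 1 & x *: v = v].
Proof.
have [h [-> _ _]] := hc; exists (hw_vec h), (hw_fun h); split.
- by move=> c y y'; rewrite hw_funD hw_funZ.
- exact: hw_funE.
- exact: hw_fun1.
- exact: hw_fixed.
Qed.

End Theory.
End Compatibility.

Section BoxCorner.
Variables (k : fieldType) (n m d : nat) (dd : 'I_n -> nat).
Hypothesis sum_dd : (\sum_j dd j)%N = d.
Local Notation TK := (tzschur k n m d).
Local Notation fam := (forall j, schur k m (dd j)).
Local Notation theta := (theta sum_dd).
Local Notation updS s j x := (@upd n (fun j => schur k m (dd j)) s j x).
Variables (j : 'I_n) (la : 'I_n -> weight m).
Variables (xis : fam) (chi : forall i, schur k m (dd i) -> k).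
Variables (N : nat) (l b : forall i, 'I_N -> schur k m (dd i)).
Hypothesis xis_j : xis j = 1.
Hypothesis z_j : \sum_c l j c * (xis j * b j c) = 1.

(** The families of simple modules, up to the factor j, for which the truncation
    defined by the given data is an equivalence *)
Definition compat_fam (L : forall i, lmodType (schur k m (dd i))) :=
  forall i, i != j -> hw_compat (L i) (la i) (xis i) (@chi i) (@l i) (@b i).

Variable L0 : forall i, lmodType (schur k m (dd i)).
Hypothesis cL0 : compat_fam L0.

Fact fam_idem i : xis i * xis i = xis i.
Proof.
by have [->|ij] := eqVneq i j; [rewrite xis_j mul1r | apply: compat_idem (cL0 ij)].
Qed.

Definition fam_truncation :=
  block_truncation sum_dd xis_j
    (fun i c x y ij => compat_lin (cL0 ij) c x y) (fun i ij => compat1 (cL0 ij))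
    (fun i x y ij => compat_mul (cL0 ij) x y) (fun i x y ij => compat_chi_z (cL0 ij) x y) z_j.

Local Notation Z := (theta (fun i => \sum_c l i c * (xis i * b i c))).

Section Box.
Variables (L : forall i, lmodType (schur k m (dd i))) (V : lmodType TK).
Variable t : (forall j, L j) -> V.
Hypothesis cL : compat_fam L.
Hypothesis t_tensor : is_tensor t.
Hypothesis t_eta : forall (r q : forall j, mword m (dd j)) (w : word n m d),
  codom w = econcat r q ->
  forall v, tz_eta k w *: t v = t (fun j => schur_xi k (r j) (q j) *: v j).
Hypothesis t_off : forall w : word n m d, admissible w ->
  (exists j, #|[set a | (w a).1.1 == Ze j]| != dd j) -> forall x : V, tz_eta k w *: x = 0.

Local Notation bt := (box_theta sum_dd t_tensor t_eta t_off).

Lemma box_Z (x : V) : Z *: x = x.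
Proof.
rewrite -[RHS]scale1r; move: x; apply: (box_eq t_tensor) => v.
rewrite bt scale1r; congr t; apply: functional_extensionality_dep => i.
by have [->|ij] := eqVneq i j; [rewrite z_j scale1r | apply: compat_z (cL ij) _].
Qed.

Lemma box_above i s y (x : V) : i != j -> above (la i) y -> theta (updS s i y) *: x = 0.
Proof.
move=> ij a; rewrite -[RHS](scale0r x); move: x; apply: (box_eq t_tensor) => v.
rewrite bt scale0r (t_zero t_tensor (j := i)) //.
by rewrite upd_in; apply: compat_above (cL ij) _ _ a.
Qed.

Lemma box_corner_iso : inhabited (corner_iso fam_truncation V (L j)).
Proof.
have H i : exists vp : L i * (L i -> k), i != j -> [/\
    forall c y y', vp.2 (schur_scal m (dd i) c *: y + y') = c * vp.2 y + vp.2 y',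
    forall y, xis i *: y = schur_scal m (dd i) (vp.2 y) *: vp.1, vp.2 vp.1 = 1 & xis i *: vp.1 = vp.1].
  have [->|ij] := eqVneq i j; first by exists (0, fun=> 0) => /eqP.
  by have [v [phi h]] := compat_vec (cL ij); exists (v, phi).
have [vp hvp] := fin_all_exists H.
have [g [gK Kg]] := @box_corner k n m d dd sum_dd L V t t_tensor t_eta t_off j xis
  (fun i => (vp i).1) (fun i => (vp i).2) (fun i c x y ij => let: And4 h _ _ _ := hvp i ij in h c x y)
  (fun i x ij => let: And4 _ h _ _ := hvp i ij in h x) (fun i ij => let: And4 _ _ h _ := hvp i ij in h).
constructor; apply: (@CornerIso _ _ _ _ _ fam_truncation V (L j) (box_in t (fun i => (vp i).1)) g) => //.
- exact: box_inD.
- move=> s x /=; rewrite /blk_in box_in_theta ?upd_in // => i ij.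
  by rewrite upd_out //; have [_ _ _ ->] := hvp i ij.
Qed.

End Box.

Section Extensions.
Variables (V : lmodType TK) (bV : block_module sum_dd V).
Hypothesis V_Z : forall v : V, (1 - Z) *: ((1 - Z) *: v) = 0.
Hypothesis V_above : forall i s y (x : V), i != j -> above (la i) y -> theta (updS s i y) *: x = 0.

Lemma fam_truncatable : truncatable fam_truncation V.
Proof.
apply: block_truncatable => //; first exact: fam_idem.
move=> i s x v ij; have [->|a] := compat_chi (cL0 ij) x; last exact: V_above.
by apply: bV => r q; rewrite Phi_theta Theta_upd sent0 mul0r.
Qed.

End Extensions.

(** Extensions between truncatable modules of this kind are truncatable: the
    elements of [above] still act as zero, since they are generated by
    idempotents, and the resolution of the identity becomes unipotent. *)
Lemma ext_truncatable (M M' : lmodType TK) (E : extension M M') :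
  block_module sum_dd (ext_mid E) ->
  (forall x : M, Z *: x = x) -> (forall x : M', Z *: x = x) ->
  (forall i s y (x : M), i != j -> above (la i) y -> theta (updS s i y) *: x = 0) ->
  (forall i s y (x : M'), i != j -> above (la i) y -> theta (updS s i y) *: x = 0) ->
  truncatable fam_truncation (ext_mid E).
Proof.
move=> bE ZM ZM' aM aM'; apply: fam_truncatable => // [v|i s y x ij a].
  have [y hy] : exists y, ext_inc E y = (1 - Z) *: v.
    by apply/ext_exact; rewrite linearZ_LR scalerBl scale1r ZM subrr.
  by rewrite -hy -linearZ_LR scalerBl scale1r ZM' subrr linear0.
elim: a s x => [u r u' nd|u u' _ IH _ IH'|c u _ IH] s x; last 2 first.
- rewrite -[u]scale1r (theta_upd_lin bE) IH IH' scaler0 addr0 //.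
- rewrite -[c *: u]addr0 (theta_upd_lin bE) IH scaler0 add0r.
  by apply: bE => r q; rewrite Phi_theta Theta_upd sent0 mul0r.
pose one : fam := fun=> 1; pose x0 := schur_xi k r r.
have x0a : above (la i) x0 by rewrite -[x0]mul1r -[_ * _]mulr1; apply: above_gen.
have key (w : ext_mid E) : theta (updS one i x0) *: w = 0.
  have e2 : theta (updS one i x0) *: (theta (updS one i x0) *: w) = theta (updS one i x0) *: w.
    rewrite (theta_theta bE); congr (theta _ *: _); apply: functional_extensionality_dep => i'.
    by have [->|ne] := eqVneq i' i; [rewrite !upd_in /x0 xi_diag_idem | rewrite !upd_out // mulr1].
  have [y' hy] : exists y, ext_inc E y = theta (updS one i x0) *: w.
    by apply/ext_exact; rewrite linearZ_LR aM.
  by rewrite -e2 -hy -linearZ_LR aM' // linear0.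
have -> : theta (updS s i (u * x0 * u')) *: x =
    theta (updS s i u) *: (theta (updS one i x0) *: (theta (updS one i u') *: x)).
  rewrite !(theta_theta bE); congr (theta _ *: _); apply: functional_extensionality_dep => i'.
  by have [->|ne] := eqVneq i' i; [rewrite !upd_in ?mulrA | rewrite !upd_out // !mulr1].
by rewrite key scaler0.
Qed.

End BoxCorner.

(** * Graded extensions between different degrees *)

Section Gradings.
Variables (A : pzRingType) (hom : int -> A -> Prop).

Section Grading.
Variables (V : lmodType A) (g : grading hom V).

Lemma gr_opp r v : g r v -> g r (- v).
Proof. by move=> h; rewrite -sub0r; apply: gr_sub h; apply: gr_0. Qed.

Lemma gr_add r u v : g r u -> g r v -> g r (u + v).
Proof. by move=> hu hv; rewrite -[v]opprK; apply: gr_sub => //; apply: gr_opp. Qed.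

Lemma gr_sum r (J : eqType) (q : seq J) (F : J -> V) :
  (forall i, i \in q -> g r (F i)) -> g r (\sum_(i <- q) F i).
Proof.
elim: q => [|i q IH] h; first by rewrite big_nil; apply: gr_0.
rewrite big_cons; apply: gr_add; first by apply: h; rewrite inE eqxx.
by apply: IH => i' hi'; apply: h; rewrite inE hi' orbT.
Qed.

Lemma gr_disjoint r r' v : r != r' -> g r v -> g r' v -> v = 0.
Proof.
move=> ne h h'; pose f q := if q == r then v else if q == r' then - v else 0.
have fr : f r = v by rewrite /f eqxx.
rewrite -fr; apply: (@gr_dir _ _ _ g [:: r; r'] f).
- by rewrite /= inE ne.
- move=> q; rewrite /f; case: eqP => [->|_] //; case: eqP => [->|_]; last exact: gr_0.
  exact: gr_opp.
- by rewrite !big_cons big_nil fr /f eq_sym (negbTE ne) eqxx addr0 subrr.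
- by rewrite inE eqxx.
Qed.

End Grading.

(** A section of the projection, read off a complement of the submodule *)
Lemma ext_complement (M N : lmodType A) (E : extension M N) (U : ext_mid E -> Prop) :
  (forall a x y, U x -> U y -> U (a *: x + y)) -> (forall x, exists2 u, U u & ext_prj E u = x) ->
  (forall u, U u -> ext_prj E u = 0 -> u = 0) ->
  exists f : {linear M -> ext_mid E}, forall x, U (f x) /\ ext_prj E (f x) = x.
Proof.
move=> Ulin Usurj Uinj.
apply: (linear_of_graph (G := fun x u => U u /\ ext_prj E u = x)).
- by move=> x; have [u] := Usurj x; exists u.
- by move=> u [hu] /(Uinj _ hu).
by move=> a x x' u u' [hu <-] [hu' <-]; rewrite linearP; split=> //; apply: Ulin.
Qed.

Section Concentrated.
Variables (M N : gmod hom) (s : int) (E : gextension M N).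
Hypothesis M0 : forall x, gmod_gr M 0 x.
Hypothesis Ns : forall y, gmod_gr N s y.

Lemma M_off r x : r != 0 -> gmod_gr M r x -> x = 0.
Proof. by move=> r0 h; apply: (gr_disjoint r0 h (M0 x)). Qed.

Lemma gext_off r x : r != 0 -> r != s -> gext_gr E r x -> x = 0.
Proof.
move=> r0 rs h; have /ext_exact[y hy] : ext_prj E x = 0.
  by apply: (M_off r0); apply: gext_prj_deg.
apply: (gr_disjoint rs h); rewrite -hy; apply: gext_inc_deg; exact: Ns.
Qed.

Lemma gext_ker_s x : ext_prj E x = 0 -> gext_gr E s x.
Proof. by case/ext_exact => y <-; apply: gext_inc_deg. Qed.

Lemma gext_ker0 x : s != 0 -> gext_gr E 0 x -> ext_prj E x = 0 -> x = 0.
Proof. by move=> s0 h0 /gext_ker_s hs; apply: gr_disjoint s0 hs h0. Qed.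

Lemma gext_lift x : exists2 e, gext_gr E 0 e & ext_prj E e = x.
Proof.
have [e <-] := ext_surj E x; have [q [f [uq hf ->]]] := gr_dec (gext_gr E) e.
exists (\sum_(r <- q | r == 0) f r).
  rewrite -big_filter; apply: gr_sum => r; rewrite mem_filter => /andP[/eqP -> _].
  exact: hf.
rewrite !linear_sum big_mkcond; apply: eq_bigr => r _; case: eqP => // /eqP r0.
by rewrite (M_off r0 (gext_prj_deg (hf r))).
Qed.

Lemma gext_all0 x : s = 0 -> gext_gr E 0 x.
Proof.
move=> s0; have [q [f [uq hf ->]]] := gr_dec (gext_gr E) x.
apply: gr_sum => r _; have [<-|r0] := eqVneq r 0; first exact: hf.
by rewrite (gext_off r0 _ (hf r)) ?s0 //; apply: gr_0.
Qed.

(** The degree 0 part of E is then a complement of N. *)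
Lemma gext_split_degree0 : s != 0 ->
  (forall a x, gext_gr E 0 x -> gext_gr E 0 (a *: x)) -> gext_split E.
Proof.
move=> s0 sub; have [f hf] : exists f : {linear M -> ext_mid E}, forall x,
    gext_gr E 0 (f x) /\ ext_prj E (f x) = x.
  apply: ext_complement => [a x y hx hy|x|u hu].
  - by apply: gr_add => //; apply: sub.
  - exact: gext_lift.
  exact: gext_ker0 s0 hu.
exists f; split=> [x|r x hx]; first by have [] := hf x.
have [->|r0] := eqVneq r 0; first by have [] := hf x.
by rewrite (M_off r0 hx) linear0; apply: gr_0.
Qed.

End Concentrated.
End Gradings.

Section PositiveDegree.
Variables (k : fieldType) (n m d : nat).
Local Notation TK := (tzschur k n m d).
Local Notation hom := (@tz_homog k n m d).
Implicit Types (w : word n m d).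

Lemma word_deg_act w (g : 'S_d) : word_deg (wact w g) = word_deg w.
Proof.
rewrite /word_deg [RHS](reindex_inj (@perm_inj _ g)).
by apply: eq_bigr => i _; rewrite ffunE.
Qed.

Lemma tz_eta_homog_word w : hom (word_deg w) (tz_eta k w).
Proof.
move=> o; rewrite ffunE /tzcoef etaE; case: same_orbitP => [[g ->]|_].
  by rewrite word_deg_act.
by rewrite div0z eqxx.
Qed.

Lemma letter_one_deg w : [forall x, letter_one (w x)] -> word_deg w = 0%N.
Proof.
move=> /forallP h; rewrite /word_deg big1 // => x _; have := h x.
by rewrite /letter_one; case: (w x).1.1.
Qed.

Lemma tz_scal_homog c : hom 0 (@tz_scal k n m d c).
Proof.
move=> o; rewrite /tz_scal !ffunE /tzcoef ffunE.
case: (boolP [forall x, _]) => [h|_]; first by rewrite letter_one_deg.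
by rewrite div0z scaler0 eqxx.
Qed.

Variables (M N : gmod hom) (s : int) (E : gextension M N).
Hypothesis M0 : forall x, gmod_gr M 0 x.
Hypothesis Ns : forall y, gmod_gr N s y.

(** A nonsplit extension in different degrees needs an element of A that maps the
    degree 0 part onto the other one. As A is generated in degrees 0 and 1, the
    degrees differ by 1. *)
Lemma gext_nonsplit_degree : (1 < n)%N -> (d <= m)%N -> s != 0 -> ~ gext_split E ->
  s = 1 /\ exists (o : rep_word n m d) x, [/\ word_deg (val o) = 1%N, gext_gr E 0 x &
    tz_eta k (val o) *: x <> 0].
Proof.
move=> n1 dm s0 ns.
have act w y r : gext_gr E r y -> gext_gr E ((word_deg w)%:Z + r) (tz_eta k w *: y).
  by move=> hy; apply: gr_act hy; apply: tz_eta_homog_word.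
have act_scal c y r : gext_gr E r y -> gext_gr E r (tz_scal n m d c *: y).
  by move=> hy; rewrite -[r]add0r; apply: gr_act hy; apply: tz_scal_homog.
have [[o [x [po x0 nz]]]|no] := Classical_Prop.classic (exists (o : rep_word n m d) x,
    [/\ (0 < word_deg (val o))%N, gext_gr E 0 x & tz_eta k (val o) *: x <> 0]); last first.
  case: ns; apply: (gext_split_degree0 M0 Ns s0) => a x x0.
  rewrite tz_act_expand; apply: gr_sum => o _; apply: act_scal.
  have [d0|dpos] := posnP (word_deg (val o)); first by have := act (val o) x 0 x0; rewrite d0.
  have -> : tz_eta k (val o) *: x = 0; last exact: gr_0.
  by apply: Classical_Prop.NNPP => nz; apply: no; exists o, x.
have ds : s = word_deg (val o).
  apply/eqP; apply: contra_notT nz => ne; have := act (val o) x 0 x0; rewrite addr0.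
  by apply: (gext_off M0 Ns); rewrite ?eqz_nat -?lt0n // eq_sym.
have d1 : word_deg (val o) = 1%N.
  apply/eqP; rewrite eqn_leq po andbT leqNgt; apply: contra_notN nz => d2.
  have [u [v [c [-> _ _ du dv]]]] := tz_eta_decomp k n1 dm (rep_adm o) d2.
  rewrite -!scalerA; suff -> : tz_eta k u *: (tz_eta k v *: x) = 0 by rewrite scaler0.
  have hv := act v x 0 x0; rewrite addr0 in hv.
  have [e|ne] := eqVneq (word_deg v)%:Z s; last first.
    by rewrite (gext_off M0 Ns _ ne hv) ?scaler0 // eqz_nat -lt0n.
  have := act u _ _ hv; apply: (gext_off M0 Ns); first by rewrite -PoszD eqz_nat -lt0n addn_gt0 du.
  by rewrite e -subr_eq0 addrK eqz_nat -lt0n.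
by split; [rewrite ds d1 | exists o, x].
Qed.

End PositiveDegree.

(** * Elements of degree 1 *)

Section DegreeOne.
Variables (k : fieldType) (n m d : nat) (dd cc : 'I_n -> nat).
Local Notation TK := (tzschur k n m d).
Implicit Types (w : word n m d).

(** V is a module over the summand of composition dd of the degree 0 part. *)
Definition off_kills (dd : 'I_n -> nat) (V : lmodType TK) := forall w, admissible w ->
  (exists j, e_count w j != dd j) -> forall x : V, tz_eta k w *: x = 0.

Lemma tz_base0 : tz_base k (0 : tens n m d) = 0.
Proof. by apply/ffunP => o; rewrite !ffunE /tzcoef ffunE div0z. Qed.

Lemma one_counts w j : [forall x, letter_one (w x)] ->
  src_count w j = e_count w j /\ tgt_count w j = e_count w j.
Proof.
move=> /forallP h; split; apply: eq_card => x; rewrite !inE; have := h x;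
  rewrite /letter_one; case: (w x).1.1 => //= i _; by apply/eqP/eqP => [->|[]].
Qed.

(** The identity of A is a sum of elements eta_w in the letters e_j, which act by
    zero on M and N unless they have the right composition. So an eta_w that acts
    nontrivially from M to N is composable with them only if its sources and its
    targets have the compositions of M and N. *)
Lemma nonzero_counts (M N : gmod (@tz_homog k n m d)) (s : int) (E : gextension M N)
    (o : rep_word n m d) x :
  (forall x, gmod_gr M 0 x) -> (forall y, gmod_gr N s y) -> s = 1 ->
  off_kills dd M -> off_kills cc N -> word_deg (val o) = 1%N -> gext_gr E 0 x ->
  tz_eta k (val o) *: x <> 0 -> src_count (val o) =1 dd /\ tgt_count (val o) =1 cc.
Proof.
move=> M0 Ns s1 offM offN d1 x0 nz.
have part (V : lmodType TK) (y : V) : y <> 0 ->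
    exists o' : rep_word n m d, [forall i, letter_one (val o' i)] /\ tz_eta k (val o') *: y <> 0.
  move=> ny; apply: Classical_Prop.NNPP => no; case: ny.
  rewrite -[y]scale1r tz_one_expand scaler_suml big1 // => o' ho'.
  by apply: Classical_Prop.NNPP => nz'; apply: no; exists o'.
split.
  have [o' [ho' nz']] : exists o' : rep_word n m d, [forall i, letter_one (val o' i)] /\
      tz_eta k (val o) *: (tz_eta k (val o') *: x) <> 0.
    apply: Classical_Prop.NNPP => no; case: nz.
    rewrite -[x]scale1r tz_one_expand scaler_suml scaler_sumr big1 // => o' ho'.
    by apply: Classical_Prop.NNPP => nz'; apply: no; exists o'.
  have cnt j : e_count (val o') j = dd j.
    apply/eqP; apply: contra_notT nz' => ne.
    rewrite (_ : tz_eta k (val o') *: x = 0) ?scaler0 //.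
    apply: (gext_ker0 Ns) => //; first by rewrite s1.
      have := gr_act (@tz_eta_homog_word k n m d (val o')) x0.
      by rewrite letter_one_deg // addr0.
    by rewrite linearZ_LR (offM _ (rep_adm o')) //; exists j.
  move=> j; rewrite -cnt; have [_ <-] := one_counts j ho'.
  apply: eta_mul_neq0; apply: contra_notN nz' => /eqP e.
  by rewrite scalerA tz_etaM ?rep_adm // e tz_base0 scale0r.
have [o' [ho' nz']] := part _ _ nz.
have cnt j : e_count (val o') j = cc j.
  apply/eqP; apply: contra_notT nz' => ne.
  have /ext_exact[y <-] : ext_prj E (tz_eta k (val o) *: x) = 0.
    apply: (M_off M0 (r := 1)) => //; apply: gext_prj_deg.
    by have := gr_act (@tz_eta_homog_word k n m d (val o)) x0; rewrite d1 addr0.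
  by rewrite -linearZ_LR (offN _ (rep_adm o')) ?linear0 //; exists j.
move=> j; rewrite -cnt; have [<- _] := one_counts j ho'.
apply/esym; move: j; apply: eta_mul_neq0; apply: contra_notN nz' => /eqP e.
by rewrite scalerA tz_etaM ?rep_adm // e tz_base0 scale0r.
Qed.

(** Only the letter of degree 1 has a source different from its target. *)
Lemma degree1_counts w : word_deg w = 1%N -> src_count w =1 dd -> tgt_count w =1 cc ->
  exists i j, [/\ adj i j, cc i = (dd i + 1)%N, (cc j + 1)%N = dd j &
    forall l, l != i -> l != j -> cc l = dd l].
Proof.
move=> d1 hs ht.
have [a ha] : exists a, (0 < zdeg (w a).1.1)%N.
  apply/existsP; apply: contra_eqT d1; rewrite negb_exists => /forallP h.
  by rewrite /word_deg big1 // => x _; have := h x; rewrite -eqn0Ngt => /eqP.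
have rest x : x != a -> zsrc (w x).1.1 = ztgt (w x).1.1.
  move=> xa; have : zdeg (w x).1.1 = 0%N.
    move: d1; rewrite /word_deg (bigD1 a) //= (bigD1 x) //=; move: ha.
    by case: (zdeg (w a).1.1) => // p _; rewrite addSn => -[] /eqP; rewrite !addn_eq0 => /and3P[_ /eqP].
  by case: (w x).1.1.
have za : zdeg (w a).1.1 = 1%N.
  apply/eqP; rewrite eqn_leq ha andbT -d1 /word_deg (bigD1 a) //= leq_addr //.
have cnt (f : zz n -> 'I_n) j : #|[set x | f (w x).1.1 == j]| =
    ((f (w a).1.1 == j) + \sum_(x | x != a) (f (w x).1.1 == j))%N.
  rewrite -sum1_card -[RHS](bigD1 a (P := xpredT) (F := fun x => nat_of_bool (f (w x).1.1 == j))) //.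
  by rewrite big_mkcond; apply: eq_bigr => x _; rewrite inE; case: eqP.
have same j : (\sum_(x | x != a) (zsrc (w x).1.1 == j) = \sum_(x | x != a) (ztgt (w x).1.1 == j))%N.
  by apply: eq_bigr => x xa; rewrite rest.
have hcc l : cc l = ((ztgt (w a).1.1 == l) + \sum_(x | x != a) (ztgt (w x).1.1 == l))%N.
  by rewrite -ht -cnt.
have hdd l : dd l = ((zsrc (w a).1.1 == l) + \sum_(x | x != a) (ztgt (w x).1.1 == l))%N.
  by rewrite -hs -same -cnt.
move: hcc hdd; case: (w a).1.1 za => //= i j ij _ hcc hdd.
have ne : i != j by apply: contraTneq ij => ->; rewrite /adj orbb gtn_eqF.
exists i, j; split=> //.
- by rewrite hcc hdd eqxx eq_sym (negbTE ne) add0n addnC.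
- by rewrite hcc hdd eqxx (negbTE ne) add0n addnC.
- by move=> l li lj; rewrite hcc hdd ![_ == l]eq_sym (negbTE li) (negbTE lj).
Qed.

End DegreeOne.

(** * Extensions in degree 0 *)

Section Separation.
Variables (k : fieldType) (n m d : nat).
Local Notation TK := (tzschur k n m d).
Implicit Types (X : TK) (w : word n m d) (b : {ffun 'I_d -> 'I_n}) (r t : mword m d).

Definition degree0_module (V : lmodType TK) :=
  forall w, (0 < word_deg w)%N -> forall v : V, tz_eta k w *: v = 0.

Lemma concentrated_degree0 (V : lmodType TK) (g : grading (@tz_homog k n m d) V) :
  (forall v, g 0 v) -> degree0_module V.
Proof.
move=> g0 w dw v; have := gr_act (@tz_eta_homog_word k n m d w) (g0 v); rewrite addr0 => h.
by apply: (gr_disjoint _ h (g0 _)); rewrite eqz_nat -lt0n.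
Qed.

(** Modules in degree 0 only see the degree 0 coefficients. *)
Lemma degree0_ev (V : lmodType TK) X (v : V) :
  degree0_module V -> (forall b r t, ev X b r t = 0) -> X *: v = 0.
Proof.
move=> hV h; rewrite tz_act_expand big1 // => o _.
have [d0|dp] := posnP (word_deg (val o)); last by rewrite hV ?scaler0.
have we i : lis_e (val o i).
  move/eqP: d0; rewrite sum_nat_eq0 => /forallP/(_ i); rewrite /lis_e.
  by case: (val o i).1.1.
have [b [r [t oE]]] := ewP we.
have so : same_orbit (val o) (ew b r t) by rewrite oE same_orbit_refl.
by have := h b r t; rewrite (ev_rep _ so) /tz_scal => ->; rewrite scale0r scale0r.
Qed.

Lemma ev_act X b r t (g : 'S_d) : ev X [ffun i => b (g i)] (mwact r g) (mwact t g) = ev X b r t.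
Proof.
apply: eq_bigr => o _; rewrite -wact_ew; congr (_ * (nat_of_bool _)%:R).
exact: same_orbit_act.
Qed.

(** The fixed space of Z is a complement of N. *)
Lemma ext_split_by (M N : lmodType TK) (E : extension M N) Z :
  (forall x : M, Z *: x = x) -> (forall y : N, Z *: y = 0) ->
  (forall a (u : ext_mid E), Z *: u = u -> Z *: (a *: u) = a *: u) -> ext_split E.
Proof.
move=> ZM ZN ZA; have [f hf] : exists f : {linear M -> ext_mid E}, forall x,
    Z *: f x = f x /\ ext_prj E (f x) = x.
  apply: (ext_complement (U := fun u => Z *: u = u)) => [a x y hx hy|x|u hu /ext_exact[y yu]].
  - by rewrite scalerDr hy ZA.
  - have [e <-] := ext_surj E x; exists (Z *: e); last by rewrite linearZ_LR ZM.
    have /ext_exact[y hy] : ext_prj E (Z *: e - e) = 0 by rewrite linearB linearZ_LR ZM subrr.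
    by apply/eqP; rewrite -subr_eq0 -scalerBr -hy -linearZ_LR ZN linear0.
  - by rewrite -hu -yu -linearZ_LR ZN linear0.
by exists f => x; have [] := hf x.
Qed.

Section Blocks.
Variables (dd : 'I_n -> nat).
Hypothesis sum_dd : (\sum_j dd j)%N = d.
Local Notation theta := (theta sum_dd).
Local Notation fam := (forall j, schur k m (dd j)).
Local Notation updS s j x := (@upd n (fun j => schur k m (dd j)) s j x).
Local Notation delta := (theta (fun=> 1)).

Lemma count_b0 b (g : 'S_d) : (forall i, b (g i) = b0 sum_dd i) ->
  forall j, #|[set a | b a == j]| = dd j.
Proof.
move=> h j; rewrite -(b0_count sum_dd j) -(card_preimset [set a | b a == j] (@perm_inj _ g)).
by apply: eq_card => a; rewrite !inE h.
Qed.

(** The idempotent of the composition dd is central in degree 0. *)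
Lemma ev_delta b : exists c, (forall r t, ev (delta : TK) b r t = c * (r == t)%:R) /\
  ((exists j, #|[set a | b a == j]| != dd j) -> c = 0).
Proof.
have [[g hg]|no] := Classical_Prop.classic (exists g : 'S_d, forall i, b (g i) = b0 sum_dd i).
  exists 1; split=> [r t|[j]]; last by rewrite (count_b0 hg) eqxx.
  rewrite mul1r -(ev_act _ _ _ _ g) (_ : [ffun i => b (g i)] = b0 sum_dd); last first.
    by apply/ffunP => i; rewrite ffunE hg.
  by have := Phi_theta sum_dd (fun j => 1 : schur k m (dd j)) (mwact r g) (mwact t g); rewrite Theta1 (inj_eq (@mwact_inj _ _ g)).
exists 0; split=> // r t; rewrite mul0r; apply: ev_theta_off => g.
apply/existsP; apply: contraT; rewrite negb_exists => /forallP h; case: no.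
by exists g => i; apply/eqP; have := h i; rewrite negbK.
Qed.

Lemma e_count_ew b r t j : e_count (ew b r t : word n m d) j = #|[set a | b a == j]|.
Proof. by apply: eq_card => a; rewrite !inE ffunE; apply/eqP/eqP => [[]|->]. Qed.

Lemma e_count_act w (g : 'S_d) j : e_count (wact w g) j = e_count w j.
Proof.
rewrite /e_count -[RHS](card_preimset _ (@perm_inj _ g)).
by apply: eq_card => x; rewrite !inE ffunE.
Qed.

Section Extensions.
Variables (M N : lmodType TK) (E : extension M N).
Hypothesis E0 : degree0_module (ext_mid E).

Lemma delta_comm a (u : ext_mid E) : delta *: (a *: u) = a *: (delta *: u).
Proof.
apply/eqP; rewrite -subr_eq0 !scalerA -scalerBl; apply/eqP.
apply: degree0_ev => // b r t; rewrite evB !evM; have [c [hc _]] := ev_delta b.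
rewrite (bigD1 r) //= big1 ?addr0 => [|q qr]; last first.
  by rewrite hc eq_sym (negbTE qr) mulr0 mul0r.
rewrite (bigD1 t) //= big1 ?addr0 => [|q qt]; last by rewrite hc (negbTE qt) !mulr0.
by rewrite !hc !eqxx mulrC subrr.
Qed.

(** The idempotent delta is the identity on M, so delta x - x lies in N; and
    eta_w delta vanishes in degree 0 when w belongs to another summand. *)
Lemma ext_block : off_kills dd M -> off_kills dd N -> block_module sum_dd (ext_mid E).
Proof.
move=> oM oN; apply: block_moduleP => w aw hj x.
have bM : block_module sum_dd M := block_moduleP oM.
have /ext_exact[y hy] : ext_prj E (x - delta *: x) = 0.
  by rewrite linearB linearZ_LR theta1 // subrr.
have := congr1 (fun z => tz_eta k w *: z) hy; rewrite /= -linearZ_LR (oN _ aw hj) linear0.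
rewrite scalerBr => /esym/eqP; rewrite subr_eq0 => /eqP ->.
rewrite scalerA; apply: degree0_ev => // b r t; rewrite evM big1 // => q _.
rewrite ev_eta //; case: same_orbitP => [[g eg]|_]; last by rewrite mul0r.
have [c [-> ->]] := ev_delta b; first by rewrite mul0r mulr0.
by have [j nj] := hj; exists j; rewrite -(e_count_ew b r q) eg e_count_act.
Qed.

(** The central idempotent delta is the identity on M and zero on N. *)
Lemma ext_split_content (cc : 'I_n -> nat) : (\sum_j cc j)%N = d ->
  off_kills dd M -> off_kills cc N -> (exists j, cc j != dd j) -> ext_split E.
Proof.
move=> sum_cc oM oN ne.
have bM : block_module sum_dd M := block_moduleP oM.
have bN : block_module sum_cc N := block_moduleP oN.
apply: (ext_split_by (Z := delta)) => [x|y|a u hu]; first exact: theta1.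
  apply: bN => r t; rewrite /Phi.
  have [c [-> ->]] := ev_delta (b0 sum_cc); first by rewrite mul0r.
  by have [j nj] := ne; exists j; rewrite b0_count.
by rewrite delta_comm hu.
Qed.

(** If the simple modules differ in the two factors i and j, an element Zi of the
    factor i and an element Zj of the factor j both act as the identity on M and
    as zero on N. They cut out the same complement of N; it is stable under the
    factors other than i, which commute with Zi, and under the factor i, which
    commutes with Zj. *)
Lemma ext_split_two i j (zi : schur k m (dd i)) (zj : schur k m (dd j)) :
  block_module sum_dd (ext_mid E) -> i != j ->
  let Zi := theta (updS (fun=> 1) i zi) in let Zj := theta (updS (fun=> 1) j zj) in
  (forall x : M, Zi *: x = x) -> (forall y : N, Zi *: y = 0) ->
  (forall x : M, Zj *: x = x) -> (forall y : N, Zj *: y = 0) -> ext_split E.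
Proof.
move=> bE ij Zi Zj ZiM ZiN ZjM ZjN.
have comm (s s' : fam) (u : ext_mid E) : (forall l, s l * s' l = s' l * s l) ->
    theta s *: (theta s' *: u) = theta s' *: (theta s *: u).
  move=> h; rewrite !(theta_theta bE); congr (theta _ *: _).
  exact: functional_extensionality_dep.
have same (Z Z' : TK) (u : ext_mid E) : (forall u : ext_mid E, Z *: (Z' *: u) = Z' *: (Z *: u)) ->
    (forall y : N, Z *: y = 0) -> (forall x : M, Z' *: x = x) -> Z *: u = u -> Z' *: u = u.
  move=> zz ZN Z'M hu; have /ext_exact[y hy] : ext_prj E (Z' *: u - u) = 0.
    by rewrite linearB linearZ_LR Z'M subrr.
  have : Z *: (Z' *: u - u) = 0 by rewrite -hy -linearZ_LR ZN linear0.
  by rewrite scalerBr zz hu => /eqP; rewrite subr_eq0 => /eqP.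
have ZZ (u : ext_mid E) : Zi *: (Zj *: u) = Zj *: (Zi *: u).
  rewrite /Zi /Zj; apply: comm => l; have [->|li] := eqVneq l i; first by rewrite upd_in upd_out // mulr1 mul1r.
  by rewrite upd_out // mulr1 mul1r.
have ji : j != i by rewrite eq_sym.
apply: (ext_split_by ZiM ZiN) => a.
apply: (@Phi_ind k n m d dd sum_dd (fun a => forall u : ext_mid E, Zi *: u = u -> Zi *: (a *: u) = a *: u))
    => [X Y e IH u hu|c X Y IH IH' u hu|s u hu].
- by rewrite -(block_eq bE u e) IH.
- by rewrite scalerDl scalerDr IH' // -tz_scalE -!scalerA (scalerA Zi) -tsc_comm -scalerA IH.
have -> : theta s *: u = theta (updS s i 1) *: (theta (updS (fun=> 1) i (s i)) *: u).
  rewrite (theta_theta bE); congr (theta _ *: _); apply: functional_extensionality_dep => l.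
  by have [->|li] := eqVneq l i; [rewrite !upd_in mul1r | rewrite !upd_out // mulr1].
set v := theta (updS _ i _) *: u.
have hv : Zi *: v = v.
  have uj : Zj *: u = u by apply: (same Zi).
  apply: (same Zj) => //; rewrite /v /Zj comm ?[theta _ *: u]uj //.
  move=> l; have [->|li] := eqVneq l i; first by rewrite upd_in upd_out // mulr1 mul1r.
  by rewrite [X in _ * X]upd_out // [X in _ = X * _]upd_out // mulr1 mul1r.
rewrite /Zi comm ?[theta _ *: v]hv // => l.
have [->|li] := eqVneq l i; first by rewrite !upd_in mulr1 mul1r.
by rewrite upd_out // mulr1 mul1r.
Qed.

End Extensions.
End Blocks.
End Separation.

Section Concentrated.
Variables (A : pzRingType) (hom : int -> A -> Prop) (M N : gmod hom).
Hypothesis M0 : forall x, gmod_gr M 0 x.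
Hypothesis N0 : forall y, gmod_gr N 0 y.
Implicit Type E : gextension M N.

Lemma gext_homog E E' (f : {linear ext_mid E -> ext_mid E'}) r e :
  gext_gr E r e -> gext_gr E' r (f e).
Proof.
move=> h; have [->|r0] := eqVneq r 0; first exact: gext_all0 M0 N0 _ _.
by rewrite (gext_off M0 N0 r0 r0 h) linear0; apply: gr_0.
Qed.

Lemma gext_eqv0 E E' : gext_eqv E E' <-> ext_eqv E E'.
Proof.
split=> [[f [hf _]]|[f hf]]; exists f => //; split=> // r e; exact: gext_homog.
Qed.

Lemma gext_split0 E : ext_split E -> gext_split E.
Proof.
move=> [s hs]; exists s; split=> // r x hx; have [->|r0] := eqVneq r 0.
  exact: gext_all0 M0 N0 _ _.
by rewrite (M_off M0 r0 hx) linear0; apply: gr_0.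
Qed.

Section TrivialGrading.
Variables (V : lmodType A).
Hypothesis killed : forall i a (v : V), i != 0 -> hom i a -> a *: v = 0.
Let comp (r : int) (v : V) := r = 0 \/ v = 0.

Definition trivial_grading : grading hom V.
Proof.
apply: (@Grading _ _ V comp) => [r|r u v [r0|->] [r0'|->]|i r a v ha [r0|->]|v|s f us hf sf r rs];
  rewrite /comp; try by [left | right; rewrite ?subrr ?scaler0].
- by have [i0|i0] := eqVneq i 0; [left; rewrite i0 r0 | right; apply: killed i0 ha].
- exists [:: 0], (fun r => if r == 0 then v else 0); split=> //; last by rewrite big_seq1.
  by move=> r; case: eqP; [left | right].
have [r0|r0] := eqVneq r 0; last by case: (hf r) => // /eqP; rewrite (negbTE r0).
move: sf; rewrite (bigD1_seq r) //= big1 ?addr0 // => q.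
by rewrite r0 => q0; case: (hf q) => // /eqP; rewrite (negbTE q0).
Defined.

End TrivialGrading.

Variables (k : Type) (S : pzRingType) (iA : k -> A) (iS : k -> S) (tr : truncation iA iS).
Variables (M' N' : lmodType S) (gM : truncatable tr M) (gN : truncatable tr N).
Variables (cM : corner_iso tr M M') (cN : corner_iso tr N N').
Hypothesis gE : forall E, truncatable tr (ext_mid E).
Hypothesis ind_killed : forall (X : lmodType S) i a (u : induced tr X), i != 0 -> hom i a -> a *: u = 0.

(** Truncation is an equivalence of categories, hence an isomorphism on spaces of
    extensions. *)
Lemma corner_gext_iso : es_iso (gExt1 iA M N) (Ext1 iS M' N').
Proof.
exists (fun E => corner_ext cM cN (gE E)); split=> [E E'|X|E1 E2 E [f [hf _]]|a E E' [f [hf _]]].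
- by rewrite /= gext_eqv0; apply: corner_ext_eqv.
- pose g := trivial_grading (@ind_killed (ext_mid X)).
  have inc_deg r y : gmod_gr N r y -> g r (induced_inc cN X y).
    have [->|r0] := eqVneq r 0; first by left.
    by move/(M_off N0 r0) => ->; right; apply: (linear0 (ext_inc (induced_ext gM gN cM cN X))).
  have prj_deg r e : g r e -> gmod_gr M r (induced_prj cM e).
    case=> [->|->]; first exact: M0.
    have -> : induced_prj cM (0 : induced tr (ext_mid X)) = 0.
      exact: (linear0 (ext_prj (induced_ext gM gN cM cN X))).
    exact: gr_0.
  pose E : gextension M N := @GExtension _ _ M N (induced_ext gM gN cM cN X) g inc_deg prj_deg.
  by exists E; apply: induced_extK.
- by apply: corner_ext_add; exists f.
- by apply: corner_ext_scale => //; exists f.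
Qed.

End Concentrated.

(** * Extensions of the irreducible modules *)

Section Boxes.
Variables (k : fieldType) (n m d : nat) (dd : 'I_n -> nat).
Hypothesis sum_dd : (\sum_j dd j)%N = d.
Local Notation TK := (tzschur k n m d).
Local Notation hom := (@tz_homog k n m d).
Local Notation theta := (theta sum_dd).
Local Notation updS s j x := (@upd n (fun j => schur k m (dd j)) s j x).
Implicit Types (M N : gmod hom).

Lemma box_off_kills L M : @is_box k n m d dd L M -> off_kills dd M.
Proof. by case=> _ [t [_ _ off]]. Qed.

Lemma box_factor L M i (z : schur k m (dd i)) c : @is_box k n m d dd L M ->
  (forall x : L i, z *: x = schur_scal m (dd i) c *: x) ->
  forall x : M, theta (updS (fun=> 1) i z) *: x = tz_scal n m d c *: x.
Proof.
case=> _ [t [tt te off]] hz; apply: (box_eq tt) => v.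
rewrite (box_theta sum_dd tt te off) upd_act hz (tZ tt); congr (_ *: t _).
rewrite (_ : (fun l => 1 *: v l) = v) ?upd_same //.
by apply: functional_extensionality_dep => l; rewrite scale1r.
Qed.

Variables (L : forall e : nat, weight m -> lmodType (schur k m e)).
Hypothesis L_irr : forall e nu, is_part e nu -> is_irr (L e nu) nu.
Variables (la mu : 'I_n -> weight m).
Hypothesis la_part : forall j, is_part (dd j) (la j).
Hypothesis mu_part : forall j, is_part (dd j) (mu j).
Variables M N : gmod hom.
Hypothesis boxM : is_box (fun j => L (dd j) (la j)) M.
Hypothesis boxN : is_box (fun j => L (dd j) (mu j)) N.

Lemma box_separate i : la i <> mu i -> exists z : schur k m (dd i),
  (forall x : M, theta (updS (fun=> 1) i z) *: x = x) /\
  (forall y : N, theta (updS (fun=> 1) i z) *: y = 0).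
Proof.
move=> ne; have [h] := irr_highest_weight (L_irr (la_part i)).
have [h'] := irr_highest_weight (L_irr (mu_part i)).
have [z [z1 z0]] := irr_separate h h' ne; exists z; split=> [x|y].
  by rewrite (box_factor boxM (c := 1)) ?rmorph1 ?scale1r // => u; rewrite z1 scale1r.
by rewrite (box_factor boxN (c := 0)) ?rmorph0 ?scale0r // => u; rewrite z0 scale0r.
Qed.

(** When the simple modules agree in all factors but j, truncation at the highest
    weights in the other factors is an equivalence that takes M and N to the
    factors j. *)
Lemma box_truncation j : (forall i, i != j -> la i = mu i) ->
  exists tr : truncation (@tz_scal k n m d) (@schur_scal k m (dd j)),
    [/\ inhabited (corner_iso tr M (L (dd j) (la j)) * corner_iso tr N (L (dd j) (mu j))),
        truncatable tr M, truncatable tr N,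
        forall E : extension M N, block_module sum_dd (ext_mid E) -> truncatable tr (ext_mid E) &
        forall X, block_module sum_dd (induced tr X)].
Proof.
move=> same.
have /fin_all_exists[N0 hN0] i := irr_compat (L_irr (la_part i)).
(* K > 0 leaves room for the resolution 1 = 1 * 1 * 1 in the factor j, where
   nothing is truncated. *)
pose K := (\max_i N0 i).+1.
have H i : exists D : schur k m (dd i) * (schur k m (dd i) -> k) *
    ('I_K -> schur k m (dd i)) * ('I_K -> schur k m (dd i)),
    (i = j -> D.1.1.1 = 1 /\ \sum_c D.1.2 c * (D.1.1.1 * D.2 c) = 1) /\
    (i != j -> hw_compat (L (dd i) (la i)) (la i) D.1.1.1 D.1.1.2 D.1.2 D.2).
  have [->|ij] := eqVneq i j.
    exists (1, fun=> 0, fun c => (c == ord0)%:R, fun c => (c == ord0)%:R).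
    split=> // _; split=> //=.
    by rewrite (bigD1 ord0) //= mul1r mul1r big1 ?addr0 // => c /negbTE ->; rewrite mul0r.
  have [|x [chi [l [b h]]]] := hN0 i K; first by rewrite ltnW // ltnS leq_bigmax.
  by exists (x, chi, l, b); split=> [/eqP|_]; first by rewrite (negbTE ij).
have [D hD] := fin_all_exists H.
pose xis i := (D i).1.1.1; pose chi i := (D i).1.1.2; pose l i := (D i).1.2; pose b i := (D i).2.
have [xis_j z_j] : xis j = 1 /\ \sum_c l j c * (xis j * b j c) = 1 by have [h _] := hD j; apply: h.
have cM : compat_fam j la xis chi l b (fun i => L (dd i) (la i)) by move=> i; case: (hD i).
have cN : compat_fam j la xis chi l b (fun i => L (dd i) (mu i)).
  by move=> i ij; rewrite -same //; apply: cM.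
have [_ [t [tt te off]]] := boxM; have [_ [t' [tt' te' off']]] := boxN.
have [iM] := box_corner_iso sum_dd xis_j z_j cM cM tt te off.
have [iN] := box_corner_iso sum_dd xis_j z_j cM cN tt' te' off'.
have ZM := box_Z sum_dd z_j cM tt te off; have ZN := box_Z sum_dd z_j cN tt' te' off'.
have aM := box_above sum_dd cM tt te off; have aN := box_above sum_dd cN tt' te' off'.
exists (fam_truncation sum_dd xis_j z_j cM); split=> [||||X].
- by constructor.
- apply: fam_truncatable => [|v|]; [exact: block_moduleP off | | exact: aM].
  by rewrite (scalerBl 1 _ v) scale1r ZM subrr scaler0.
- apply: fam_truncatable => [|v|]; [exact: block_moduleP off' | | exact: aN].
  by rewrite (scalerBl 1 _ v) scale1r ZN subrr scaler0.
- by move=> E bE; apply: ext_truncatable.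
- exact: induced_block.
Qed.

Lemma block_degree0 (V : lmodType TK) i a (v : V) : block_module sum_dd V ->
  i != 0 -> hom i a -> a *: v = 0.
Proof.
move=> bV i0 ha; apply: bV => r t; rewrite /Phi /ev big1 // => o _.
have [->|ao] := eqVneq (a o) 0; first by rewrite mul0r.
case: same_orbitP => [[g eg]|_]; last by rewrite mulr0.
case/eqP: i0; rewrite -(ha o ao); congr Posz.
rewrite -(word_deg_act _ g) -eg /word_deg big1 // => x _; by rewrite ffunE.
Qed.

End Boxes.

(* J = {1, ..., p-1} is 'I_p.-1; L e nu is a choice of L(nu) for every partition
   nu of every e with at most m parts; Lla and Lmu are the graded modules
   L(lambda) and L(mu). *)
Theorem theorem3p14 (p m d : nat) (k : closedFieldType)
    (p_prime : prime p) (p_gt2 : (2 < p)%N) (pchark : p \in [pchar k])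
    (m_gt0 : (0 < m)%N) (le_dm : (d <= m)%N)
    (L : forall e : nat, weight m -> lmodType (schur k m e))
    (L_irr : forall (e : nat) (nu : weight m), is_part e nu -> is_irr (L e nu) nu)
    (dd cc : 'I_p.-1 -> nat) (la mu : 'I_p.-1 -> weight m)
    (sum_dd : (\sum_j dd j)%N = d) (sum_cc : (\sum_j cc j)%N = d)
    (la_part : forall j, is_part (dd j) (la j))
    (mu_part : forall j, is_part (cc j) (mu j))
    (Lla Lmu : gmod (@tz_homog k p.-1 m d))
    (Lla_box : is_box (fun j => L (dd j) (la j)) Lla)
    (Lmu_box : is_box (fun j => L (cc j) (mu j)) Lmu)
    (s : int) :
  (es_nonzero (gExt1 (@tz_scal k p.-1 m d) Lla (gshift s Lmu)) ->
     [/\ s = 0, forall j, cc j = dd j &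
         exists j,
           es_nonzero (Ext1 (@schur_scal k m (dd j)) (L (dd j) (la j)) (L (dd j) (mu j))) /\
           forall i, i != j -> la i = mu i]
     \/
     (s = 1 /\
      exists i j,
        [/\ adj i j, cc i = (dd i + 1)%N, (cc j + 1)%N = dd j &
            forall l, l != i -> l != j -> cc l = dd l]))
  /\
  (forall j,
     (forall i, cc i = dd i) ->
     es_nonzero (Ext1 (@schur_scal k m (dd j)) (L (dd j) (la j)) (L (dd j) (mu j))) ->
     (forall i, i != j -> la i = mu i) ->
     es_iso (gExt1 (@tz_scal k p.-1 m d) Lla Lmu)
            (Ext1 (@schur_scal k m (dd j)) (L (dd j) (la j)) (L (dd j) (mu j)))).
Proof.
have n1 : (1 < p.-1)%N by rewrite -ltnS prednK // prime_gt0.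
have M0 : forall x, gmod_gr Lla 0 x := Lla_box.1.
have N0 : forall y, gmod_gr Lmu 0 y := Lmu_box.1.
have oM := box_off_kills Lla_box; have oN := box_off_kills Lmu_box.
split=> [[E nsE]|j c_d _ same]; last first.
  have ec : cc = dd by apply: functional_extensionality.
  subst cc; have [tr [[[cM cN]] gM gN gE bI]] := box_truncation sum_dd L_irr la_part Lla_box Lmu_box same.
  apply: (corner_gext_iso M0 N0 gM gN cM cN) => [E|X i a u i0 ha]; last exact: block_degree0 (bI X) i0 ha.
  apply/gE/ext_block => //; apply: concentrated_degree0 => v; exact: gext_all0 M0 N0 _ _.
have Ns : forall y, gmod_gr (gshift s Lmu) s y by move=> y; have := N0 y; rewrite /= subrr.
have [s0|s0] := eqVneq s 0; last first.
  right; have [s1 [o [x [d1 x0 nz]]]] := gext_nonsplit_degree M0 Ns n1 le_dm s0 nsE.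
  have [hs ht] := nonzero_counts M0 Ns s1 oM oN d1 x0 nz.
  by split=> //; apply: degree1_counts d1 hs ht.
left; subst s.
have ns : ~ ext_split E by move/(gext_split0 M0 Ns).
have E0 : degree0_module (ext_mid E).
  apply: concentrated_degree0 => v; exact: gext_all0 M0 Ns _ _.
have ec : cc = dd.
  apply: functional_extensionality => j; apply/eqP; apply: contra_notT ns => ne.
  by apply: (ext_split_content sum_dd E0 sum_cc oM oN); exists j.
subst cc; split=> //.
have bE : block_module sum_dd (ext_mid E) by apply: ext_block E0 oM oN.
have one i j : i != j -> la i = mu i \/ la j = mu j.
  move=> ij; apply: Classical_Prop.NNPP => /Decidable.not_or[ni nj]; apply: ns.
  have [zi [zi1 zi0]] := box_separate sum_dd L_irr la_part mu_part Lla_box Lmu_box ni.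
  have [zj [zj1 zj0]] := box_separate sum_dd L_irr la_part mu_part Lla_box Lmu_box nj.
  exact: ext_split_two bE ij zi1 zi0 zj1 zj0.
have [j same] : exists j, forall i, i != j -> la i = mu i.
  have [/existsP[j nj]|no] := boolP [exists j, la j != mu j].
    exists j => i /one[//|ej]; by rewrite ej eqxx in nj.
  exists (Ordinal (ltnW n1)) => i _; apply/eqP; move: no.
  by rewrite negb_exists => /forallP/(_ i); rewrite negbK.
exists j; split=> //.
have [tr [[[cM cN]] gM gN gE bI]] := box_truncation sum_dd L_irr la_part Lla_box Lmu_box same.
exists (@corner_ext _ _ _ _ _ tr _ _ _ _ cM cN E (gE E bE)) => /(corner_ext_split gM); exact: ns.
Qed.
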